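(* Let $(\mathcal{M},d_{\mathrm h})$ be an equation manifold with $n$ independent variables $x^a$ and fibre coordinates $\psi^A$, and let $\sigma=\tfrac12\, d_{\mathrm v}\psi^A\, d_{\mathrm v}\psi^B\,\sigma_{AB}$ be a compatible presymplectic structure on it, i.e. a local $(n-1,2)$-form with $d_{\mathrm v}\sigma=d_{\mathrm h}\sigma=0$. Then, locally: (i) There exist an $(n-1,1)$-form $\chi$ and an $(n,0)$-form $l$ on $\mathcal{M}$ such that $\sigma=d(\chi+l)$. The equivalence class modulo $D_{\mathrm h}$-exact terms of the intrinsic Lagrangian $\mathcal{L}^C=\mathbf{H}(\pi^*(\chi+l))$ on $J^\infty(\mathcal{M})$ is determined by $\sigma$ and does not depend on the choice of the potential $\chi+l$. (ii) The Euler–Lagrange equations of $\mathcal{L}^C$ are $$\bigl(D_{\mathrm h}\psi^B-d_{\mathrm h}\psi^B\bigr)\,\sigma_{BA}=0 .$$ (iii) Consequently, the Euler–Lagrange equations of $\mathcal{L}^C$ are consequences of the equations $D_{\mathrm h}\psi^A=d_{\mathrm h}\psi^A$. That is, the stationary surface of $\mathcal{L}^C$ in $J^\infty(\mathcal{M})$ contains the submanifold singled out by the prolongation of $D_{\mathrm h}\psi^A=d_{\mathrm h}\psi^A$, which is isomorphic to the initial equation manifold $(\mathcal{M},d_{\mathrm h})$.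
   Context: All considerations are local (coordinate charts may be taken contractible), and local functions and forms depend on finitely many coordinates. **Equation manifold.** An equation (PDE) in intrinsic form is a pair $(\mathcal{M},d_{\mathrm h})$. Here $\mathcal{M}$ is a bundle over the space with coordinates $x^a$, $a=1,\dots,n$, with (possibly infinitely many) fibre coordinates $\psi^A$. The horizontal differential acts on functions as $d_{\mathrm h}=dx^a\bigl(\frac{\partial}{\partial x^a}+Y_a\bigr)$, with $Y_a=Y_a^B(\psi,x)\frac{\partial}{\partial\psi^B}$ and $d_{\mathrm h}^2=0$; in particular $d_{\mathrm h}\psi^A=dx^aY_a^A$. It arises by restricting the total derivatives of some jet space to the surface defined by a system of PDEs and all its differential consequences. The vertical differential is $d_{\mathrm v}=d-d_{\mathrm h}$, so that $d_{\mathrm v}\psi^A=d\psi^A-d_{\mathrm h}\psi^A$ and $d_{\mathrm v}^2=d_{\mathrm h}^2=d_{\mathrm h}d_{\mathrm v}+d_{\mathrm v}d_{\mathrm h}=0$. An $(r,s)$-form on $\mathcal{M}$ is a local form of degree $r$ in the $dx^a$ and degree $s$ in the $d_{\mathrm v}\psi^A$. In the expression for $\sigma$, the components $\sigma_{AB}=-\sigma_{BA}$ are horizontal $(n-1)$-forms, i.e. forms in $dx^a$ with coefficients depending on $x,\psi$. **New jet space.** $J^\infty(\mathcal{M})$ is the jet bundle of the bundle $\mathcal{M}\to\{x^a\}$, with coordinates $x^a,\psi^A,\psi^A_a,\psi^A_{ab},\dots$ and horizontal differential $D_{\mathrm h}$: $D_{\mathrm h}x^a=dx^a$, $D_{\mathrm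 h}\psi^A=dx^a\psi^A_a$, $D_{\mathrm h}\psi^A_a=dx^b\psi^A_{ab}$, and so on. The map $\pi:J^\infty(\mathcal{M})\to\mathcal{M}$ is the canonical projection. The expression $d_{\mathrm h}\psi^A=dx^aY^A_a(\psi,x)$ and the components $\sigma_{AB}$ are regarded as forms on $J^\infty(\mathcal{M})$ via $\pi^*$. The horizontalization map $\mathbf{H}$ on forms on $J^\infty(\mathcal{M})$ leaves coefficients unchanged and sends $dx^a\mapsto dx^a$, $d\psi^A_{ab\ldots}\mapsto D_{\mathrm h}\psi^A_{ab\ldots}$. **Stationary surface.** The stationary surface of a Lagrangian (horizontal $n$-form) on $J^\infty(\mathcal{M})$ is the surface defined by its Euler–Lagrange equations together with all their total derivatives (their prolongation). Likewise, the prolongation of $D_{\mathrm h}\psi^A=d_{\mathrm h}\psi^A$ consists of the equations $\psi^A_a=Y^A_a(\psi,x)$ and all their total derivatives. The system in (ii) has one equation for each value of the index $A$, each being the vanishing of a horizontal $n$-form; the Euler–Lagrange expressions are understood up to an overall sign. *)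

(* Defs.v *)
From HB Require Import structures.
From mathcomp Require Import all_boot all_order all_fingroup all_algebra.
From mathcomp Require Import finmap.
From mathcomp Require Import all_classical all_reals all_analysis.
Export numFieldNormedType.Exports.

Set Implicit Arguments.
Unset Strict Implicit.
Unset Printing Implicit Defensive.

Import Order.TTheory GRing.Theory Num.Theory.

Local Open Scope classical_set_scope.
Local Open Scope ring_scope.

(** * Local functions and forms on open subsets of a coordinate space

  Manifolds are handled in one chart.  The coordinates are indexed by an
  arbitrary, possibly infinite, type [K]; a point is a family of reals
  [K -> R] with the product topology, whose basic open sets restrict finitely
  many coordinates.  Functions and forms are total in Rocq, but only their
  values on a given open set [U] are meaningful. *)

Notation cspace R K := {ptws K -> R}.

Section LocalCalculus.
Variables (R : realType) (K : choiceType).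
Implicit Types (U : set (cspace R K)) (f : cspace R K -> R).

Definition pd (k : K) f : cspace R K -> R :=
  fun p => derive1 (fun t : R => f (dfwith p k t)) (p k).

Definition smooth_on U f : Prop :=
  forall (s : seq K) (p : cspace R K), U p ->
    (forall k : K, derivable (fun t : R => foldr pd f s (dfwith p k t)) (p k) 1)
    /\ {for p, continuous (foldr pd f s : cspace R K -> R)}.

Definition local_function U f : Prop :=
  (exists S : {fset K}, forall p q : cspace R K, U p -> U q ->
     (forall k, k \in S -> p k = q k) -> f p = f q)
  /\ smooth_on U f.

(** A form of degree [k] is given by its components
    w = 1/k! dz^{i_1} ... dz^{i_k} w_{i_1 ... i_k},
    antisymmetric in the indices (a condition imposed in [local_form]). *)
Definition diff_form (k : nat) : Type := {ffun 'I_k -> K} -> cspace R K -> R.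

Definition form_eq U k (w w' : diff_form k) : Prop :=
  forall t p, U p -> w t p = w' t p.

Definition local_form U k (w : diff_form k) : Prop :=
  [/\ forall t, local_function U (w t),
      forall (s : 'S_k) (t : {ffun 'I_k -> K}) p, U p ->
        w [ffun i => t (s i)] p = (-1) ^+ s * w t p
    & exists S : {fset {ffun 'I_k -> K}},
        forall t p, t \notin S -> U p -> w t p = 0].

Definition form0 f : diff_form 0 := fun _ => f.

Definition coordinate (k : K) : diff_form 0 := form0 (fun p => p k).

Definition omit k (t : {ffun 'I_k.+1 -> K}) (j : 'I_k.+1) : {ffun 'I_k -> K} :=
  [ffun i => t (lift j i)].

Definition wedge1 k (theta : diff_form 1) (w : diff_form k) : diff_form k.+1 :=
  fun t p => \sum_(j < k.+1)
    (-1) ^+ j * (theta [ffun=> t j] p * w (omit t j) p).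

(** The de Rham differential [dw = dz^l /\ (d w / d z^l)]. *)
Definition de_rham k (w : diff_form k) : diff_form k.+1 :=
  fun t p => \sum_(j < k.+1) (-1) ^+ j * pd (t j) (w (omit t j)) p.

(** Sums over infinite index types are finitely supported sums; they are used
    where the terms vanish for all but finitely many indices. *)
Definition vder (X : K -> cspace R K -> R) f : cspace R K -> R :=
  fun p => \sum_(l \in [set: K]) (X l p * pd l f p).

(** The Lie derivative along [X], in components:
    X w_{i_1 ... i_k} + sum_j (d X^l / d z^{i_j}) w_{i_1 .. l .. i_k}. *)
Definition lie (X : K -> cspace R K -> R) k (w : diff_form k) : diff_form k :=
  fun t p => vder X (w t) p +
    \sum_(j < k) \sum_(l \in [set: K])
      (pd (t j) (X l) p * w [ffun i => if i == j then l else t i] p).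

(** The algebra map that leaves coefficients unchanged and sends each [dz^l]
    to the 1-form [theta l]. *)
Definition substitute (theta : K -> diff_form 1) k (w : diff_form k) :
    diff_form k :=
  fun t p => \sum_(u \in [set: {ffun 'I_k -> K}])
    (w u p * \prod_(i < k) theta (u i) [ffun=> t i] p).

End LocalCalculus.

Arguments form0 {R K} f.
Arguments coordinate {R K} k.

Definition pullback (R : realType) (K K' : choiceType)
    (phi : cspace R K' -> cspace R K) k (w : diff_form R K k) :
    diff_form R K' k :=
  fun t p => \sum_(u \in [set: {ffun 'I_k -> K}])
    (w u (phi p) * \prod_(i < k) pd (t i) (fun q => phi q (u i)) p).

Definition local_map (R : realType) (K K' : choiceType) (U : set (cspace R K'))
    (phi : cspace R K' -> cspace R K) : Prop :=
  forall k : K, local_function U (fun p => phi p k).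

(** * Equation manifolds

  The coordinates are [inl a], i.e. x^a with [a : 'I_n], and [inr A], i.e.
  psi^A with [A : I].  The horizontal differential is given by the functions
  [Y a A], through the total derivatives D_a = d/dx^a + Y_a^A d/dpsi^A. *)

Section EquationManifold.
Variables (R : realType) (n : nat) (I : choiceType).
Local Notation coord := ('I_n + I)%type.
Local Notation pt := (cspace R coord).
Implicit Types (U : set pt) (Y : 'I_n -> I -> pt -> R).

Definition total_field Y (a : 'I_n) : coord -> pt -> R :=
  fun l p => match l with inl b => (b == a)%:R | inr A => Y a A p end.

Definition tder Y (a : 'I_n) : (pt -> R) -> pt -> R := vder (total_field Y a).

Definition iter_tder Y (J : {ffun 'I_n -> nat}) (f : pt -> R) : pt -> R :=
  foldr (fun a => iter (J a) (tder Y a)) f (enum 'I_n).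

(** [d_h w = dx^a /\ L_{D_a} w].  This is the antiderivation that acts on
    functions by dx^a D_a and anticommutes with [d] on coordinates: it sends
    dx^a to 0 and dpsi^A to dx^a /\ d Y_a^A = - d (d_h psi^A). *)
Definition hdiff Y k (w : diff_form R coord k) : diff_form R coord k.+1 :=
  fun t p => \sum_(a < n)
    wedge1 (de_rham (coordinate (inl a : coord))) (lie (total_field Y a) w) t p.

Definition vdiff Y k (w : diff_form R coord k) : diff_form R coord k.+1 :=
  fun t p => de_rham w t p - hdiff Y w t p.

(** The frame dual to the coframe (dx^a, d_v psi^A), in coordinates:
    D_a and d/dpsi^A. *)
Definition adapted_frame Y (k : coord) : coord -> pt -> R :=
  match k with
  | inl a => total_field Y a
  | inr A => fun l _ => (l == inr A)%:R
  end.

(** Components with respect to the coframe (dx^a, d_v psi^A), obtained by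
    expressing each [dz^l] in this coframe. *)
Definition adapted_components Y k (w : diff_form R coord k) :
    diff_form R coord k :=
  substitute (fun l t => adapted_frame Y (t ord0) l) w.

Definition hor_index (l : coord) : bool := if l is inl _ then true else false.

(** Degree r in the dx^a and s in the d_v psi^A. *)
Definition bidegree U Y (r s : nat) k (w : diff_form R coord k) : Prop :=
  forall t : {ffun 'I_k -> coord},
    (#|[pred i | hor_index (t i)]|, #|[pred i | ~~ hor_index (t i)]|) != (r, s) ->
    forall p, U p -> adapted_components Y w t p = 0.

Definition equation_manifold U Y : Prop :=
  [/\ open U,
      forall a A, local_function U (Y a A)
    & forall f, local_function U f ->
        form_eq U (hdiff Y (hdiff Y (form0 f))) (fun _ _ => 0)].

End EquationManifold.

(** * The jet space of the bundle M -> {x^a}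

  The fibre coordinate [(A, J)] is psi^A_J, with [J] the symmetric multi-index
  giving the multiplicity of each x^a.  The jet space with D_h is itself of
  the above kind, with D_a psi^A_J = psi^A_{Ja}. *)

Section JetSpace.
Variables (R : realType) (n : nat) (I : choiceType).
Local Notation coord := ('I_n + I)%type.
Local Notation jfib := (I * {ffun 'I_n -> nat})%type.
Local Notation jcoord := ('I_n + jfib)%type.
Local Notation pt := (cspace R coord).
Local Notation jpt := (cspace R jcoord).

Definition jet_total (a : 'I_n) (AJ : jfib) : jpt -> R :=
  fun p => p (inr (AJ.1, [ffun b => AJ.2 b + (b == a)]%N)).

Definition jet_proj (p : jpt) : pt :=
  fun k => match k with
           | inl a => p (inl a)
           | inr A => p (inr (A, [ffun=> 0%N]))
           end.

Definition jet_over (U : set pt) : set jpt := jet_proj @^-1` U.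

Definition Dh k (w : diff_form R jcoord k) : diff_form R jcoord k.+1 :=
  hdiff jet_total w.

Definition horizontalize k (w : diff_form R jcoord k) : diff_form R jcoord k :=
  substitute (fun l : jcoord => Dh (coordinate l)) w.

(** [D_h psi^A - d_h psi^A], with [d_h psi^A] pulled back from M. *)
Definition dh_defect (Y : 'I_n -> I -> pt -> R) (A : I) :
    diff_form R jcoord 1 :=
  fun t p => Dh (coordinate (inr (A, [ffun=> 0%N]) : jcoord)) t p
    - pullback jet_proj (hdiff Y (coordinate (inr A : coord))) t p.

(** The Euler-Lagrange expression for psi^A, coefficientwise: for a horizontal
    form f dx^1 ... dx^n of top degree this is (E_A f) dx^1 ... dx^n with
    E_A f = sum_J (-1)^|J| D_J (d f / d psi^A_J). *)
Definition euler_lagrange (A : I) k (L : diff_form R jcoord k) :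
    diff_form R jcoord k :=
  fun t p => \sum_(J \in [set: {ffun 'I_n -> nat}])
    ((-1) ^+ (\sum_(a < n) J a)%N *
     iter_tder jet_total J (pd (inr (A, J) : jcoord) (L t)) p).

(** The surface in [W] defined by [F A = 0] for all [A] together with all the
    total derivatives of these equations. *)
Definition prolongation (W : set jpt) k (F : I -> diff_form R jcoord k) :
    set jpt :=
  [set p | W p /\ forall A t J, iter_tder jet_total J (F A t) p = 0].

Definition stationary_surface (U : set pt) k (L : diff_form R jcoord k) :
    set jpt :=
  prolongation (jet_over U) (fun A => euler_lagrange A L).

Definition equation_surface (U : set pt) (Y : 'I_n -> I -> pt -> R) : set jpt :=
  prolongation (jet_over U) (dh_defect Y).

(** [s] is an isomorphism from the equation manifold [(U, Y)] onto the surface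
    [E] equipped with the restriction of D_h, inverse to the projection. *)
Definition equation_isomorphism (U : set pt) (Y : 'I_n -> I -> pt -> R)
    (E : set jpt) (s : pt -> jpt) : Prop :=
  [/\ forall p, U p -> E (s p) /\ jet_proj (s p) = p,
      forall q, E q -> U (jet_proj q) /\ s (jet_proj q) = q,
      local_map U s,
      local_map (jet_over U) jet_proj
    & forall f, local_function (jet_over U) f ->
        form_eq U (pullback s (Dh (form0 f))) (hdiff Y (form0 (f \o s)))].

End JetSpace.

(** * Compatible presymplectic structures

  The number of independent variables is [n.+1], so that an (n, 2)-form below
  is one of horizontal degree one less than the dimension of the base. *)

Section Presymplectic.
Variables (R : realType) (n : nat) (I : choiceType).
Local Notation coord := ('I_n.+1 + I)%type.
Local Notation pt := (cspace R coord).
Implicit Types (U : set pt) (Y : 'I_n.+1 -> I -> pt -> R).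

Definition presymplectic U Y (sigma : diff_form R coord n.+2) : Prop :=
  [/\ local_form U sigma,
      bidegree U Y n 2 sigma,
      form_eq U (vdiff Y sigma) (fun _ _ => 0)
    & form_eq U (hdiff Y sigma) (fun _ _ => 0)].

(** [sigma = 1/2 d_v psi^A d_v psi^B sigma_AB]; the family [sigma_AB] has finite
    support because [sigma] is local. *)
Definition presymplectic_components U Y (sigma : diff_form R coord n.+2)
    (sAB : I -> I -> diff_form R coord n) : Prop :=
  [/\ forall A B, local_form U (sAB A B) /\ bidegree U Y n 0 (sAB A B),
      forall A B (t : {ffun 'I_n -> coord}) p, U p ->
        sAB A B t p = - sAB B A t p,
      exists S : {fset I * I}, forall A B, (A, B) \notin S ->
        form_eq U (sAB A B) (fun _ _ => 0)
    & form_eq U sigma (fun t p => 2^-1 *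
        \sum_(A \in [set: I]) \sum_(B \in [set: I])
          wedge1 (vdiff Y (coordinate (inr A : coord)))
            (wedge1 (vdiff Y (coordinate (inr B : coord))) (sAB A B)) t p)].

(** [chi + l] is a potential of [sigma] on [V], with [chi] of degree
    (n, 1) and [l] of degree (n.+1, 0). *)
Definition potential V Y (sigma : diff_form R coord n.+2)
    (chi l : diff_form R coord n.+1) : Prop :=
  [/\ local_form V chi /\ bidegree V Y n 1 chi,
      local_form V l /\ bidegree V Y n.+1 0 l
    & form_eq V sigma (de_rham (fun t p => chi t p + l t p))].

Definition intrinsic_lagrangian (chi l : diff_form R coord n.+1) :
    diff_form R ('I_n.+1 + I * {ffun 'I_n.+1 -> nat})%type n.+1 :=
  horizontalize (pullback (@jet_proj R n.+1 I) (fun t p => chi t p + l t p)).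

End Presymplectic.

(* Main.v *)
Require Import Defs.
From HB Require Import structures.
From mathcomp Require Import all_boot all_order all_fingroup all_algebra.
From mathcomp Require Import finmap.
From mathcomp Require Import all_classical all_reals all_analysis.
From mathcomp Require Import ring lra zify.

Set Implicit Arguments.
Unset Strict Implicit.
Unset Printing Implicit Defensive.

Import Order.TTheory GRing.Theory Num.Theory.

Local Open Scope classical_set_scope.
Local Open Scope ring_scope.

(** Forms on the equation manifold are handled through their components in the
  coordinates of a star-shaped coordinate box V around the given point.

  Existence: contracting along the fibres, [psi |-> psi0 + s (psi - psi0)] with x
  fixed, gives rho = int_0^1 F_s^*(i_Z sigma) ds with d rho = sigma - F_0^* sigma.
  The correction vanishes, being an (n+2)-form in the n+1 variables x, and since
  sigma has vertical degree 2, rho has vertical degree at most 1.  Hence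
  rho = chi + l.

  Writing T_a = d/dx^a + psi^A_a d/dpsi^A, the Lagrangian H(pi^* rho) has
  components rho(T_{a_0}, ..., T_{a_n}).  Two identities hold for all forms on M:
  D_h H(pi^* beta) = H(pi^* d beta) and E_A(H(pi^* rho)) = H(pi^* i_A d rho); in
  both, the second derivatives psi^A_{ab} drop out, a symmetric array being paired
  with an alternating one.  The first identity and the Poincare lemma on V show
  that two potentials give Lagrangians that differ by a D_h-exact term.  The
  second one, with d rho = sigma, gives the Euler-Lagrange equations.

  The prolongation of D_h psi = d_h psi is the image of the section
  psi^A_J = D^J psi^A over V: the chain rule makes D_a tangent to it, and induction
  on |J| shows that there are no other points.  On it the defects
  D_h psi - d_h psi vanish, hence so do all total derivatives of the
  Euler-Lagrange expressions. *)

(** * Coordinate boxes and partial derivatives *)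

(** Two contractions occur, for opposite reasons. If the base coordinates were contracted too, rho
    would acquire terms of vertical degree 2, which do not fit [chi + l]. The difference of two
    potentials, however, has degree n+1; contracting only the fibres would leave its restriction to
    psi = psi0, an (n+1)-form in n+1 variables that need not vanish, so there all coordinates are
    contracted. The homotopy works in coordinates, while bidegrees refer to the coframe (dx, d_v
    psi). The passage between the two is unitriangular with respect to the vertical degree, so
    bounds on that degree carry over. Smoothness means existence and continuity of all iterated
    partial derivatives in the product topology. The chain rule and differentiation under the
    integral sign are therefore derived from one-variable calculus, finite dependence reducing
    everything to finitely many coordinates. Smoothness of integrals and pullbacks is obtained
    coinductively, from a class of functions stable under partial derivatives. *)

Section PointwiseTopology.
Variables (R : realType) (K : choiceType).
Local Notation pt := (cspace R K).

Lemma cvg_ptws (F : set_system pt) (FF : Filter F) (p : pt) :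
  (forall k, (fun q : pt => q k) @ F --> p k) -> F --> p.
Proof.
move=> h; apply/cvg_sup => k A [B [[C oC <-] Bp] BA].
apply: filterS BA _; apply: (h k); exact: open_nbhs_nbhs.
Qed.

Lemma ptws_proj_cvg (k : K) (p : pt) : (fun q : pt => q k) @ p --> p k.
Proof. exact: (@proj_continuous K (fun=> R) k p). Qed.

(** Only the finitely many coordinates in [S] are constrained, which makes the box open in the
    product topology; contracting any set of coordinates towards [p] maps it into itself. *)
Definition coordinate_box (S : {fset K}) (e : R) (p : pt) : set pt :=
  [set q : pt | forall k, k \in S -> `|q k - p k| < e].

Lemma coordinate_box_nbhs S e p : 0 < e -> nbhs p (coordinate_box S e p).
Proof.
move=> e0.
suff : forall s : seq K,
    nbhs p [set q : pt | forall k, k \in s -> `|q k - p k| < e].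
  by apply.
elim=> [|k s ih]; first by apply: filterS filterT.
have hk : nbhs p [set q : pt | `|q k - p k| < e].
  have /cvgr_dist_lt/(_ e e0) := @ptws_proj_cvg k p.
  by apply: filterS => q /=; rewrite distrC.
apply: filterS2 ih hk => q h1 h2 l; rewrite inE => /predU1P[->|]; first exact: h2.
exact: h1.
Qed.

Lemma coordinate_box_open S e p : open (coordinate_box S e p).
Proof.
rewrite openE => q qB.
(* For empty [S] the box is the whole space. Otherwise [|q k0 - p k0| < e] yields [0 < e], so that
   the minimum of the slacks, started at [e], is positive. *)
have [->|[k0 k0S]] := fset_0Vmem S.
  by apply: (@filterS _ (nbhs q) _ setT) filterT => r _ k.
pose d := \big[Num.min/(e : R)]_(k <- S) (e - `|q k - p k|).
have d0 : 0 < d.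
  rewrite /d big_seq; elim/big_ind: _ => //.
  - by have := qB _ k0S; apply: le_lt_trans.
  - by move=> x y x0 y0; rewrite lt_min x0.
  - by move=> k kS; rewrite subr_gt0; exact: qB.
have := @coordinate_box_nbhs S d q d0; apply: filterS => r rB k kS.
have := rB _ kS; have : d <= e - `|q k - p k| by exact: (@ge_bigmin_seq _ R _ S e k xpredT (fun k => e - `|q k - p k|)).
have := ler_distD (q k) (r k) (p k); lra.
Qed.

(** The sets containing a box around [p] form a filter along which every coordinate tends to its
    value at [p]. By [cvg_ptws] this filter converges to [p], that is, it contains every
    neighbourhood. *)
Lemma nbhs_coordinate_box (p : pt) (U : set pt) : nbhs p U ->
  exists S e, 0 < e /\ coordinate_box S e p `<=` U.
Proof.
pose F : set_system pt := [set A : set pt | exists S e, 0 < e /\ coordinate_box S e p `<=` A].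
have FF : Filter F.
  split.
  - by exists fset0, 1; split => //.
  - move=> A B [S [e [e0 SA]]] [S' [e' [e0' SB]]].
    exists (S `|` S')%fset, (Num.min e e'); split; first by rewrite lt_min e0.
    move=> q h; split; [apply: SA|apply: SB] => k kS.
      by have := h k; rewrite inE kS lt_min => /(_ isT)/andP[].
    by have := h k; rewrite inE kS orbT lt_min => /(_ isT)/andP[].
  - by move=> A B AB [S [e [e0 SA]]]; exists S, e; split => //; apply: subset_trans AB.
have Fp : F --> p.
  apply: cvg_ptws => k; apply/cvgrPdist_lt => e e0.
  exists [fset k]%fset, e; split => // q /(_ k); rewrite inE => /(_ (eqxx _)) /=.
  by rewrite distrC.
exact: (Fp U).
Qed.

Lemma dfwith_id (p : pt) k : dfwith p k (p k) = p.
Proof. by apply/funext => j; case: dfwithP. Qed.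

Lemma dfwith_dfwith (p : pt) k x y : dfwith (dfwith p k x) k y = dfwith p k y.
Proof.
apply/funext => j; have [<-|kj] := eqVneq k j; first by rewrite !dfwithin.
by rewrite !dfwithout.
Qed.

Lemma cvg_dfwith (p : pt) k : (dfwith p k t : pt) @[t --> p k] --> p.
Proof.
move=> A nA; apply: (@dfwith_continuous K (fun=> R) p k (p k) A).
by have E := dfwith_id p k; move: nA; rewrite -[in X in X -> _]E.
Qed.

Lemma near_dfwith (U : set pt) (p : pt) k : nbhs p U ->
  \forall t \near p k, U (dfwith p k t).
Proof. exact: (@cvg_dfwith p k U). Qed.

End PointwiseTopology.

Section PartialDerivatives.
Variables (R : realType) (K : choiceType).
Local Notation pt := (cspace R K).
Implicit Types (U : set pt) (f g : pt -> R) (p q : pt) (k : K).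

Definition eqon U f g := forall p, U p -> f p = g p.

Lemma eqon_sym U f g : eqon U f g -> eqon U g f.
Proof. by move=> h p Up; rewrite h. Qed.

(** [pd] is total and has a default value where no derivative exists; the relation records
    derivability together with the value. *)
Definition has_pd k f p (d : R) :=
  is_derive (p k) 1 (fun t : R => f (dfwith p k t)) d.

Lemma has_pdP k f p :
  derivable (fun t : R => f (dfwith p k t)) (p k) 1 -> has_pd k f p (pd k f p).
Proof. by move=> h; rewrite /has_pd /pd derive1E; exact: derivableP. Qed.

Lemma has_pd_val k f p d : has_pd k f p d -> pd k f p = d.
Proof. by move=> h; rewrite /pd derive1E; exact: derive_val. Qed.

Lemma has_pd_derivable k f p d : has_pd k f p d ->
  derivable (fun t : R => f (dfwith p k t)) (p k) 1.
Proof. by case. Qed.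

Lemma has_pd_eqon U k f g p d : open U -> U p -> eqon U f g ->
  has_pd k f p d -> has_pd k g p d.
Proof.
move=> oU Up fg; apply: near_eq_is_derive.
have : nbhs p U by exact: open_nbhs_nbhs.
by move=> /(@near_dfwith _ _ _ _ k); apply: filterS => t Ut; rewrite fg.
Qed.

Lemma pd_eqon U k f g : open U -> eqon U f g -> eqon U (pd k f) (pd k g).
Proof.
move=> oU fg p Up; rewrite /pd !derive1E; apply: near_eq_derive.
have : nbhs p U by exact: open_nbhs_nbhs.
by move=> /(@near_dfwith _ _ _ _ k); apply: filterS => t Ut; rewrite fg.
Qed.

Lemma has_pd_cst k (c : R) p : has_pd k (fun=> c) p 0.
Proof. exact: is_derive_cst. Qed.

Lemma has_pd_coord k l p : has_pd k (fun q => q l) p (k == l)%:R.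
Proof.
rewrite /has_pd; have [<-|kl] := eqVneq k l.
  by under eq_fun do rewrite dfwithin; exact: is_derive_id.
by under eq_fun do rewrite dfwithout//; exact: is_derive_cst.
Qed.

Lemma has_pdD k f g p df dg : has_pd k f p df -> has_pd k g p dg ->
  has_pd k (fun q => f q + g q) p (df + dg).
Proof. by move=> ? ?; exact: is_deriveD. Qed.

Lemma has_pdM k f g p df dg : has_pd k f p df -> has_pd k g p dg ->
  has_pd k (fun q => f q * g q) p (df * g p + f p * dg).
Proof.
move=> hf hg; apply: is_derive_eq; first exact: (is_deriveM hf hg).
rewrite /= dfwith_id addrC; congr (_ + _); exact: mulrC.
Qed.

End PartialDerivatives.

(** * Local functions *)

Section LocalFunctions.
Variables (R : realType) (K : choiceType).
Local Notation pt := (cspace R K).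
Implicit Types (U V : set pt) (f g : pt -> R) (p q : pt) (k : K).

(** Smoothness is the greatest class of functions that are partially derivable and continuous on [U]
    and that is stable under [pd]; this is its coinduction principle. *)
Lemma smooth_coind U (C : (pt -> R) -> Prop) :
  (forall f, C f -> forall p, U p ->
     (forall k, derivable (fun t : R => f (dfwith p k t)) (p k) 1)
     /\ {for p, continuous f}) ->
  (forall f k, C f -> C (pd k f)) ->
  forall f, C f -> smooth_on U f.
Proof.
move=> C1 C2 f Cf s p Up; apply: (C1 _ _ p Up).
by elim: s => //= k s; exact: C2.
Qed.

Lemma smooth_on_at U f p : smooth_on U f -> U p ->
  (forall k, derivable (fun t : R => f (dfwith p k t)) (p k) 1)
  /\ {for p, continuous f}.
Proof. by move=> sf Up; exact: (sf [::]). Qed.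

Lemma smooth_has_pd U f k p : smooth_on U f -> U p -> has_pd k f p (pd k f p).
Proof. by move=> sf Up; apply: has_pdP; case: (smooth_on_at sf Up). Qed.

Lemma smooth_pd U f k : smooth_on U f -> smooth_on U (pd k f).
Proof. by move=> sf s p Up; have := sf (rcons s k) p Up; rewrite foldr_rcons. Qed.

(** The class fed to [smooth_coind]: the derivative of a product is a sum of products, hence closure
    under both at once. [SmoothEq] is present because the rules for [pd] hold on [U] only, not as
    equalities of total functions. *)
Inductive smooth_closure U : (pt -> R) -> Prop :=
| SmoothBase f of smooth_on U f : smooth_closure U f
| SmoothCst c : smooth_closure U (fun=> c)
| SmoothCoord k : smooth_closure U (fun p => p k)
| SmoothAdd f g of smooth_closure U f & smooth_closure U g :
    smooth_closure U (fun p => f p + g p)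
| SmoothMul f g of smooth_closure U f & smooth_closure U g :
    smooth_closure U (fun p => f p * g p)
| SmoothEq f g of eqon U f g & smooth_closure U f : smooth_closure U g.

Lemma continuous_eqon U f g p : open U -> U p -> eqon U f g ->
  {for p, continuous f} -> {for p, continuous g}.
Proof.
move=> oU Up fg cf; rewrite /prop_for /continuous_at -(fg p Up).
have e : {near p, f =1 g}.
  by apply: filterS (open_nbhs_nbhs (conj oU Up)) => q Uq; exact: fg.
exact: cvg_trans (near_eq_cvg e) cf.
Qed.

Lemma smooth_closure_smooth U f : open U -> smooth_closure U f -> smooth_on U f.
Proof.
move=> oU; apply: smooth_coind => {}f.
  elim=> {f} [f sf p Up|c p Up|l p Up|f g _ hf _ hg p Up|f g _ hf _ hg p Up
             |f g fg _ hf p Up].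
  - exact: smooth_on_at Up.
  - by split=> [k|]; [exact: (has_pd_derivable (has_pd_cst k c p))|exact: (@cst_continuous _ _ c p)].
  - split=> [k|]; [exact: (has_pd_derivable (has_pd_coord k l p))|].
    exact: (@ptws_proj_cvg _ _ l p).
  - have [df cf] := hf p Up; have [dg cg] := hg p Up; split=> [k|]; last exact: (cvgD cf cg).
    exact: (has_pd_derivable (has_pdD (has_pdP (df k)) (has_pdP (dg k)))).
  - have [df cf] := hf p Up; have [dg cg] := hg p Up; split=> [k|]; last exact: (cvgM cf cg).
    exact: (has_pd_derivable (has_pdM (has_pdP (df k)) (has_pdP (dg k)))).
  - have [df cf] := hf p Up; split=> [k|]; last exact: (continuous_eqon oU Up fg cf).
    exact: (has_pd_derivable (has_pd_eqon oU Up fg (has_pdP (df k)))).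
move=> k Cf.
(* The derivability clause strengthens the induction: the sum and product rules require the
   derivatives of both operands to exist. *)
suff : smooth_closure U (pd k f) /\ forall p, U p -> has_pd k f p (pd k f p).
  by case.
elim: Cf => {f} [f sf|c|l|f g _ [hf df] _ [hg dg]|f g cf [hf df] cg [hg dg]
  |f g fg _ [hf df]].
- split; first by apply: SmoothBase; exact: smooth_pd.
  by move=> p; exact: smooth_has_pd.
- have e : pd k (fun=> c) = (fun=> 0) :> (pt -> R).
    by apply/funext => p; exact/has_pd_val/has_pd_cst.
  by rewrite e; split; [exact: SmoothCst|move=> p _; exact: has_pd_cst].
- have e : pd k (fun p : pt => p l) = (fun=> (k == l)%:R).
    by apply/funext => p; exact/has_pd_val/has_pd_coord.
  by rewrite e; split; [exact: SmoothCst|move=> p _; exact: has_pd_coord].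
- have h p : U p -> has_pd k (fun p => f p + g p) p (pd k f p + pd k g p).
    by move=> Up; exact: has_pdD (df p Up) (dg p Up).
  split; last by move=> r /h hp; rewrite (has_pd_val hp).
  by apply: (SmoothEq _ (SmoothAdd hf hg)) => r /h /has_pd_val ->.
- have h p : U p -> has_pd k (fun p => f p * g p) p (pd k f p * g p + f p * pd k g p).
    by move=> Up; exact: has_pdM (df p Up) (dg p Up).
  split; last by move=> r /h hp; rewrite (has_pd_val hp).
  by apply: (SmoothEq _ (SmoothAdd (SmoothMul hf cg) (SmoothMul cf hg))) => r /h /has_pd_val ->.
- split; first by exact: (SmoothEq (pd_eqon k oU fg) hf).
  move=> p Up; rewrite -(pd_eqon _ oU fg Up).
  exact: has_pd_eqon fg (df p Up).
Qed.

Definition depends_on U (S : {fset K}) f := forall p q, U p -> U q ->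
  (forall k, k \in S -> p k = q k) -> f p = f q.

Lemma local_functionS U V f : V `<=` U -> local_function U f -> local_function V f.
Proof.
move=> VU [[S hS] sf]; split; last by move=> s p /VU; exact: sf.
by exists S => p q /VU Up /VU Uq; exact: hS.
Qed.

Lemma local_has_pd U f k p : local_function U f -> U p -> has_pd k f p (pd k f p).
Proof. by case=> _; exact: smooth_has_pd. Qed.

Lemma local_continuous U f p : local_function U f -> U p -> {for p, continuous f}.
Proof. by case=> _ sf Up; case: (smooth_on_at sf Up). Qed.

Lemma local_depends U f : local_function U f -> exists S, depends_on U S f.
Proof. by case. Qed.

Lemma depends_on_sub U S S' f : {subset S <= S'} -> depends_on U S f -> depends_on U S' f.
Proof. by move=> sS h p q Up Uq pq; apply: h => // k /sS; exact: pq. Qed.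

Section OpenDomain.
Variable U : set pt.
Hypothesis oU : open U.

Lemma local_eqon f g : eqon U f g -> local_function U f -> local_function U g.
Proof.
move=> fg [[S hS] sf]; split.
  by exists S => p q Up Uq pq; rewrite -!fg//; exact: hS.
by apply: smooth_closure_smooth => //; apply: (SmoothEq fg); exact: SmoothBase.
Qed.

Lemma local_cst c : local_function U (fun=> c).
Proof. by split; [exists fset0|exact/smooth_closure_smooth/SmoothCst]. Qed.

Lemma local_coord k : local_function U (fun p => p k).
Proof.
split; last exact/smooth_closure_smooth/SmoothCoord.
by exists [fset k]%fset => p q _ _; apply; rewrite inE.
Qed.

Lemma localD f g : local_function U f -> local_function U g ->
  local_function U (fun p => f p + g p).
Proof.
move=> [[S hS] sf] [[S' hS'] sg]; split.
  exists (S `|` S')%fset => p q Up Uq pq; congr (_ + _).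
    by apply: hS => // k kS; apply: pq; rewrite inE kS.
  by apply: hS' => // k kS; apply: pq; rewrite inE kS orbT.
by apply: smooth_closure_smooth => //; apply: SmoothAdd; exact: SmoothBase.
Qed.

Lemma localM f g : local_function U f -> local_function U g ->
  local_function U (fun p => f p * g p).
Proof.
move=> [[S hS] sf] [[S' hS'] sg]; split.
  exists (S `|` S')%fset => p q Up Uq pq; congr (_ * _).
    by apply: hS => // k kS; apply: pq; rewrite inE kS.
  by apply: hS' => // k kS; apply: pq; rewrite inE kS orbT.
by apply: smooth_closure_smooth => //; apply: SmoothMul; exact: SmoothBase.
Qed.

Lemma localN f : local_function U f -> local_function U (fun p => - f p).
Proof.
move=> lf; under eq_fun do rewrite -mulN1r.
by apply: localM lf; exact: local_cst.
Qed.

Lemma localB f g : local_function U f -> local_function U g ->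
  local_function U (fun p => f p - g p).
Proof. by move=> lf /localN; exact: localD. Qed.

Lemma local_sum (T : eqType) (r : seq T) (P : pred T) (F : T -> pt -> R) :
  (forall i, i \in r -> P i -> local_function U (F i)) ->
  local_function U (fun p => \sum_(i <- r | P i) F i p).
Proof.
elim: r => [|i r ih] h.
  by under eq_fun do rewrite big_nil; exact: local_cst.
have {}ih : local_function U (fun p => \sum_(i <- r | P i) F i p).
  by apply: ih => j jr; apply: h; rewrite inE jr orbT.
under eq_fun do rewrite big_cons; have [Pi|Pi] := boolP (P i); last by [].
by apply: localD => //; apply: h => //; exact: mem_head.
Qed.

Lemma local_prod (T : eqType) (r : seq T) (P : pred T) (F : T -> pt -> R) :
  (forall i, i \in r -> P i -> local_function U (F i)) ->
  local_function U (fun p => \prod_(i <- r | P i) F i p).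
Proof.
elim: r => [|i r ih] h.
  by under eq_fun do rewrite big_nil; exact: local_cst.
have {}ih : local_function U (fun p => \prod_(i <- r | P i) F i p).
  by apply: ih => j jr; apply: h; rewrite inE jr orbT.
under eq_fun do rewrite big_cons; have [Pi|Pi] := boolP (P i); last by [].
by apply: localM => //; apply: h => //; exact: mem_head.
Qed.

(** A predicate rather than a finite set, so that it also covers the possibly infinite family of jet
    coordinates of bounded order. *)
Definition depends_on_pred (P : pred K) f := forall p q, U p -> U q ->
  (forall k, P k -> p k = q k) -> f p = f q.

Lemma depends_on_pred_pd0 (P : pred K) f k p :
  depends_on_pred P f -> ~~ P k -> U p -> pd k f p = 0.
Proof.
move=> hP Pk Up; apply: has_pd_val.
apply: near_eq_is_derive (is_derive_cst (f p) (p k) 1).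
have : nbhs p U by exact: open_nbhs_nbhs.
move=> /(@near_dfwith _ _ _ _ k); apply: filterS => t Ut.
apply: hP => // l Pl; rewrite dfwithout//.
by apply: contraNneq Pk => ->.
Qed.

Lemma depends_on_pred_pd (P : pred K) f k :
  depends_on_pred P f -> depends_on_pred P (pd k f).
Proof.
move=> hP p q Up Uq pq; have [Pk|Pk] := boolP (P k); last first.
  by rewrite !(depends_on_pred_pd0 hP).
rewrite /pd !derive1E -(pq _ Pk); apply: near_eq_derive.
have /(@near_dfwith _ _ _ _ k) np : nbhs p U by exact: open_nbhs_nbhs.
have /(@near_dfwith _ _ _ _ k) : nbhs q U by exact: open_nbhs_nbhs.
rewrite -(pq _ Pk) => nq; apply: filterS2 np nq => t Up' Uq'.
apply: hP => // l Pl; have [<-|kl] := eqVneq k l; first by rewrite !dfwithin.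
by rewrite !dfwithout//; exact: pq.
Qed.

Lemma depends_on_pd0 S f k p : depends_on U S f -> k \notin S -> U p -> pd k f p = 0.
Proof. exact: (@depends_on_pred_pd0 (fun k => k \in S)). Qed.

Lemma depends_on_pd S f k : depends_on U S f -> depends_on U S (pd k f).
Proof. exact: (@depends_on_pred_pd (fun k => k \in S)). Qed.

Lemma local_pd f k : local_function U f -> local_function U (pd k f).
Proof.
case=> -[S hS] sf; split; last exact: smooth_pd.
by exists S; exact: depends_on_pd.
Qed.

Lemma vderE X S f p : depends_on U S f -> U p ->
  vder X f p = \sum_(l <- S) X l p * pd l f p.
Proof.
move=> hS Up; rewrite /vder (fsbigTE S)// => l lS.
by rewrite (depends_on_pd0 hS)// mulr0.
Qed.

Lemma vder_eqon X f g : eqon U f g -> eqon U (vder X f) (vder X g).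
Proof.
by move=> fg p Up; apply: eq_fsbigr => l _; rewrite (pd_eqon l oU fg).
Qed.

Lemma local_vder X f : (forall l, local_function U (X l)) ->
  local_function U f -> local_function U (vder X f).
Proof.
move=> lX lf; have [S hS] := local_depends lf.
apply: (@local_eqon (fun p => \sum_(l <- S) X l p * pd l f p)).
  by move=> p Up; rewrite (vderE _ hS).
apply: local_sum => l _ _; apply: localM; first exact: lX.
exact: local_pd.
Qed.

(** A common interface for [pd] and [vder]: the Leibniz expansions of the components of a Lagrangian
    are computed once and used for both partial and total derivatives. *)
Definition derivation_at p (D : (pt -> R) -> R) : Prop :=
  [/\ forall f g, eqon U f g -> D f = D g,
      forall c, D (fun=> c) = 0,
      forall f g, local_function U f -> local_function U g ->
        D (fun q => f q + g q) = D f + D g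
    & forall f g, local_function U f -> local_function U g ->
        D (fun q => f q * g q) = D f * g p + f p * D g].

Lemma derivation_pd p k : U p -> derivation_at p (fun f => pd k f p).
Proof.
move=> Up; split.
- by move=> f g fg; rewrite (pd_eqon k oU fg).
- by move=> c; apply: has_pd_val; exact: has_pd_cst.
- move=> f g lf lg; apply: has_pd_val.
  exact: has_pdD (local_has_pd _ lf Up) (local_has_pd _ lg Up).
- move=> f g lf lg; apply: has_pd_val.
  exact: has_pdM (local_has_pd _ lf Up) (local_has_pd _ lg Up).
Qed.

Lemma derivation_vder X p : U p -> derivation_at p (fun f => vder X f p).
Proof.
move=> Up; split.
- by move=> f g fg; rewrite (vder_eqon X fg).
- by move=> c; rewrite (@vderE _ fset0)// big_seq_fset0.
- move=> f g lf lg; have [S hS] := local_depends lf; have [S' hS'] := local_depends lg.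
  have {}hS : depends_on U (S `|` S')%fset f.
    by apply: depends_on_sub hS => k; rewrite inE => ->.
  have {}hS' : depends_on U (S `|` S')%fset g.
    by apply: depends_on_sub hS' => k; rewrite inE orbC => ->.
  rewrite !(@vderE _ (S `|` S')%fset)//; last first.
    by move=> q r Uq Ur qr; rewrite (hS _ _ Uq Ur)// (hS' _ _ Uq Ur).
  rewrite -big_split; apply: eq_bigr => l _ /=; rewrite -mulrDr; congr (_ * _).
  by have [_ _ -> //] := derivation_pd l Up.
- move=> f g lf lg; have [S hS] := local_depends lf; have [S' hS'] := local_depends lg.
  have {}hS : depends_on U (S `|` S')%fset f.
    by apply: depends_on_sub hS => k; rewrite inE => ->.
  have {}hS' : depends_on U (S `|` S')%fset g.
    by apply: depends_on_sub hS' => k; rewrite inE orbC => ->.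
  rewrite !(@vderE _ (S `|` S')%fset)//; last first.
    by move=> q r Uq Ur qr; rewrite (hS _ _ Uq Ur)// (hS' _ _ Uq Ur).
  rewrite mulr_suml mulr_sumr -big_split; apply: eq_bigr => l _ /=.
  by have [_ _ _ -> //] := derivation_pd l Up; ring.
Qed.

Section Derivation.
Variables (p : pt) (D : (pt -> R) -> R).
Hypothesis (Up : U p) (hD : derivation_at p D).

Lemma derivation_eqon f g : eqon U f g -> D f = D g. Proof. by case: hD => h _ _ _; exact: h. Qed.

Lemma derivation_cst c : D (fun=> c) = 0. Proof. by case: hD. Qed.

Lemma derivationD f g : local_function U f -> local_function U g ->
  D (fun q => f q + g q) = D f + D g.
Proof. by case: hD => _ _ h _; exact: h. Qed.

Lemma derivationM f g : local_function U f -> local_function U g ->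
  D (fun q => f q * g q) = D f * g p + f p * D g.
Proof. by case: hD => _ _ _; exact. Qed.

Lemma derivationZ c f : local_function U f -> D (fun q => c * f q) = c * D f.
Proof.
move=> lf; rewrite derivationM//; last exact: local_cst.
by rewrite derivation_cst mul0r add0r.
Qed.

Lemma derivationB f g : local_function U f -> local_function U g ->
  D (fun q => f q - g q) = D f - D g.
Proof.
move=> lf lg; rewrite derivationD//; last exact: localN.
congr (_ + _); rewrite -mulN1r -derivationZ//.
by apply: derivation_eqon => q _; rewrite mulN1r.
Qed.

Lemma derivation_sum (T : eqType) (r : seq T) (P : pred T) (F : T -> pt -> R) :
  (forall i, i \in r -> P i -> local_function U (F i)) ->
  D (fun q => \sum_(i <- r | P i) F i q) = \sum_(i <- r | P i) D (F i).
Proof.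
elim: r => [|i r ih] h.
  under eq_fun do rewrite big_nil; rewrite big_nil; exact: derivation_cst.
have {}h' j : j \in r -> P j -> local_function U (F j).
  by move=> jr; apply: h; rewrite inE jr orbT.
under eq_fun do rewrite big_cons; rewrite big_cons -ih//; have [Pi|Pi] := boolP (P i); last by [].
by rewrite derivationD//; [apply: h => //; exact: mem_head|exact: local_sum].
Qed.

Lemma derivation_prod m (P : pred 'I_m) (F : 'I_m -> pt -> R) :
  (forall i, local_function U (F i)) ->
  D (fun q => \prod_(i < m | P i) F i q) =
  \sum_(j < m | P j) D (F j) * \prod_(i < m | P i && (i != j)) F i p.
Proof.
move=> lF; pose s := index_enum 'I_m.
have us : uniq s by exact: index_enum_uniq.
rewrite -/s; elim: s us => [_|i s ih /= /andP[si us]].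
  by under eq_fun do rewrite big_nil; rewrite big_nil; exact: derivation_cst.
under eq_fun do rewrite big_cons; rewrite big_cons; have [Pi|Pi] := boolP (P i); last first.
  rewrite ih//; apply: eq_bigr => j Pj.
  by rewrite big_cons (negPf Pi).
rewrite derivationM//; last exact: local_prod.
rewrite big_cons eqxx andbF; congr (_ + _).
  congr (_ * _); rewrite [RHS]big_seq_cond [LHS]big_seq_cond; apply: eq_bigl => l.
  have [ls /=|//] := boolP (l \in s).
  suff -> : l != i by rewrite andbT.
  by apply: contraNneq si => <-.
rewrite ih// mulr_sumr [RHS]big_seq_cond [LHS]big_seq_cond.
apply: eq_bigr => j /andP[js Pj].
rewrite big_cons Pi/=; have -> : i != j by apply: contraNneq si => ->.
by rewrite mulrCA.
Qed.

End Derivation.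
End OpenDomain.
End LocalFunctions.

(** * The chain rule *)

Section Slopes.
Variable R : realType.
Implicit Types (F G : R -> R) (x d : R).

(** Carathéodory's description of the derivative by a slope function continuous at [x]. Slopes
    compose by multiplication, without the division by zero that difference quotients would bring
    into the chain rule. *)
Lemma slope_is_derive F G x d :
  (\forall t \near x, F t = F x + G t * (t - x)) ->
  {for x, continuous G} -> G x = d -> is_derive x 1 F d.
Proof.
move=> hF cG <-.
have c : h^-1 *: ((F \o shift x) (h *: (1 : R)) - F x) @[h --> 0^'] --> G x.
  have c0 : (G \o shift x) h @[h --> 0^'] --> G x.
    apply: cvg_within_filter.
    have cs : (h + x) @[h --> (0 : R)] --> x.
      by rewrite -[X in _ --> X]add0r; exact: (cvgD cvg_id (@cst_continuous _ _ x (0 : R))).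
    exact: (cvg_comp _ _ cs cG).
  apply: cvg_trans c0; apply: near_eq_cvg.
  have hF' : \forall h \near (0 : R)^', F (h + x) = F x + G (h + x) * (h + x - x).
    apply: cvg_within; have := hF; rewrite (near_shift 0)/= subr0.
    by apply: filterS => h.
  near=> h.
  have h0 : h != 0 by near: h; exact: nbhs_dnbhs_neq.
  rewrite /= [h *: 1]mulr1; have -> : F (h + x) = F x + G (h + x) * (h + x - x).
    by near: h.
  rewrite addrK [F x + _]addrC addrK [_ *: _]mulrC -mulrA mulfV// mulr1.
  by [].
split; first by apply/cvg_ex; exists (G x).
exact: cvg_lim c.
Unshelve. all: by end_near. Qed.

Lemma is_derive_slope F x d : is_derive x 1 F d ->
  exists G, [/\ forall t, F t = F x + G t * (t - x),
                {for x, continuous G} & G x = d].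
Proof.
move=> [dF Fd]; pose G t := if t == x then d else (F t - F x) / (t - x).
exists G; split; last by rewrite /G eqxx.
  move=> t; rewrite /G; have [->|tx] := eqVneq t x; first by rewrite subrr mulr0 addr0.
  by rewrite divfK ?subr_eq0// addrC subrK.
rewrite /prop_for /continuous_at {2}/G eqxx.
have c : h^-1 *: ((F \o shift x) (h *: (1 : R)) - F x) @[h --> 0^'] --> d.
  by rewrite -Fd; exact: dF.
apply/cvgrPdist_lt => e e0.
have /cvgrPdist_lt/(_ e e0) := c.
rewrite near_simpl /dnbhs near_withinE => h0.
have : \forall y \near (0 : R), y != 0 ->
    `|d - y^-1 *: (F (y *: 1 + x) - F x)| < e by exact: h0.
rewrite (near_shift x (0 : R))/= sub0r => h.
apply: filterS h => t; rewrite /G.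
have [->|tx] := eqVneq t x; first by rewrite subrr normr0.
move=> /=; rewrite subr_eq0 => /(_ tx); rewrite [(t - x) *: 1]mulr1 subrK.
by rewrite [_ *: _]mulrC.
Qed.

Lemma mean_value F (dF : R -> R) (a b : R) :
  (forall t : R, `|t - a| <= `|b - a| -> `|t - b| <= `|b - a| -> is_derive t 1 F (dF t)) ->
  exists c, [/\ `|c - a| <= `|b - a|, `|c - b| <= `|b - a|
    & F b - F a = dF c * (b - a)].
Proof.
wlog ab : a b F dF / a < b.
  move=> wl h; have [ab|ba|->] := ltgtP a b; first exact: (wl a b F dF).
  - have [|c [h1 h2 hF]] := wl b a F dF ba.
      by move=> t; rewrite (distrC a b) => h1 h2; exact: h.
    by exists c; rewrite (distrC b a); split=> //; lra.
  - by exists b; rewrite !subrr ?normr0 mulr0.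
move=> h.
have ba : `|b - a| = b - a by rewrite ger0_norm// subr_ge0 ltW.
have h' (t : R) : a <= t <= b -> is_derive t 1 F (dF t).
  by move=> /andP[at' tb]; apply: h; rewrite ba ler_norml; lra.
have [||c] := @MVT_segment R F dF a b (ltW ab).
- by move=> t; rewrite in_itv/= => /andP[? ?]; apply: h'; lra.
- apply: derivable_within_continuous => t; rewrite in_itv/= => tab.
  by case: (h' t tab).
rewrite in_itv/= => /andP[ac cb] E; exists c.
by rewrite ba !ler_norml; split => //; lra.
Qed.

Lemma continuous_at_sum (T : eqType) (r : seq T) (A : T -> R -> R) x :
  (forall l, l \in r -> {for x, continuous (A l)}) ->
  {for x, continuous (fun t => \sum_(l <- r) A l t)}.
Proof.
elim: r => [_|l r ih h].
  rewrite /prop_for /continuous_at big_nil.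
  have -> : (fun t => \sum_(l <- [::]) A l t) = cst 0.
    by apply/funext => t; rewrite big_nil.
  exact: cvg_cst.
rewrite /prop_for /continuous_at big_cons.
have -> : (fun t => \sum_(k <- l :: r) A k t) = fun t => A l t + \sum_(k <- r) A k t.
  by apply/funext => t; rewrite big_cons.
apply: cvgD; first by apply: (h l); exact: mem_head.
by apply: ih => k kr; apply: h; rewrite inE kr orbT.
Qed.

End Slopes.

Section ChainRule.
Variables (R : realType) (K : choiceType).
Local Notation pt := (cspace R K).
Implicit Types (U : set pt) (f : pt -> R) (p q : pt).

Lemma cvg_bound (F : set_system pt) (FF : Filter F) (h g : pt -> R) (a : R) :
  g @ F --> a -> (forall q, `|h q - a| <= `|g q - a|) -> h @ F --> a.
Proof.
move=> ga hg; apply/cvgrPdist_lt => e e0.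
have /cvgrPdist_lt/(_ e e0) := ga; apply: filterS => q.
by rewrite (distrC a (g q)) (distrC a (h q)); exact: le_lt_trans.
Qed.

(** The coordinates in [S] are changed from [p] to [q] one at a time. Each change is given by the
    mean value theorem as a partial derivative at an intermediate point, and continuity of the
    partial derivatives makes these slopes continuous at [p]. *)
Lemma local_slopes U f p S : open U -> local_function U f -> depends_on U S f ->
  U p -> exists g : K -> pt -> R,
  (forall l, l \in S -> {for p, continuous (g l)} /\ g l p = pd l f p) /\
  \forall q \near p, f q = f p + \sum_(l <- S) g l q * (q l - p l).
Proof.
move=> oU lf hS Up.
have [S0 [e [e0 SU]]] := nbhs_coordinate_box (open_nbhs_nbhs (conj oU Up)).
pose B := coordinate_box S0 e p.
pose mix (s : seq K) q : pt := fun k => if k \in s then q k else p k.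
have mixB s q : B q -> B (mix s q).
  move=> qB k kS; rewrite /mix; case: ifP => _; first exact: qB.
  by rewrite subrr normr0.
suff H (s : seq K) : uniq s -> exists g : K -> pt -> R,
    (forall l, l \in s -> {for p, continuous (g l)} /\ g l p = pd l f p) /\
    forall q, B q -> f (mix s q) = f p + \sum_(l <- s) g l q * (q l - p l).
  have [g [h1 h2]] := H S (fset_uniq S); exists g; split => //.
  apply: filterS (coordinate_box_nbhs S0 p e0) => q qB.
  rewrite -h2//; apply: hS; [exact: SU|exact/SU/mixB|].
  by move=> k kS; rewrite /mix kS.
elim: s => [_|l s ih /= /andP[ls us]].
  by exists (fun _ _ => 0); split => // q qB; rewrite big_nil addr0.
have {ih us}[g [h1 h2]] := ih us.
have mixE q : mix (l :: s) q = dfwith (mix s q) l (q l).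
  apply/funext => k; rewrite /mix inE; have [->|kl] := eqVneq k l.
    by rewrite dfwithin.
  by rewrite dfwithout// eq_sym.
have mixp q : mix s q = dfwith (mix s q) l (p l).
  apply/funext => k; have [<-|kl] := eqVneq l k; last by rewrite dfwithout.
  by rewrite dfwithin /mix (negPf ls).
(* The bound on [xi] is imposed for every [q], with the default [p l] outside the box. It forces the
   intermediate points to tend to [p], although [xi] is an arbitrary choice and not known to be
   continuous. *)
have mv q : exists xi, `|xi - p l| <= `|q l - p l| /\ (B q ->
    f (mix (l :: s) q) - f (mix s q) =
    pd l f (dfwith (mix s q) l xi) * (q l - p l)).
  have [qB|nqB] := pselect (B q); last by exists (p l); rewrite subrr normr0.
  have [|c [cp _ E]] := @mean_value R (fun t => f (dfwith (mix s q) l t))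
      (fun t => pd l f (dfwith (mix s q) l t)) (p l) (q l).
    move=> t tp _.
    have Ut : U (dfwith (mix s q) l t).
      apply: SU => k kS; have [lk|kl] := eqVneq l k.
        by rewrite -lk dfwithin; apply: le_lt_trans tp _; rewrite lk; exact: qB.
      by rewrite dfwithout//; exact: mixB.
    have := local_has_pd l lf Ut; rewrite /has_pd dfwithin.
    by under eq_fun do rewrite dfwith_dfwith.
  by exists c; split => // _; rewrite mixE {2}mixp E.
have [xi hxi] := choice mv.
exists (fun k q => if k == l then pd l f (dfwith (mix s q) l (xi q)) else g k q).
split=> [k|q qB].
  rewrite inE; have [->|kl] := eqVneq k l => [_|/= ks]; last exact: h1.
  have E0 : dfwith (mix s p) l (xi p) = p.
    have -> : xi p = p l.
      have [+ _] := hxi p; rewrite subrr normr0 normr_le0 subr_eq0; exact/eqP.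
    by rewrite -mixp; apply/funext => j; rewrite /mix; case: ifP.
  split; last by rewrite E0.
  rewrite /prop_for /continuous_at E0.
  pose phi (q : pt) : pt := dfwith (mix s q) l (xi q).
  have c1 : phi @ p --> p.
    apply: (@cvg_ptws R K (phi @ p) (@fmap_filter _ _ phi (nbhs p) _) p) => j.
    suff cc : (fun q => phi q j) @ nbhs p --> p j by exact: cc.
    apply: (@cvg_bound _ _ (fun q => phi q j) (fun q => q j) (p j)).
      exact: ptws_proj_cvg.
    move=> q; rewrite /phi; have [<-|lj] := eqVneq l j.
      by rewrite dfwithin; have [] := hxi q.
    rewrite dfwithout// /mix; case: ifP => // _.
    by rewrite subrr normr0.
  have c2 := local_continuous (local_pd oU l lf) Up.
  exact: (cvg_comp phi (pd l f) c1 c2).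
rewrite big_cons eqxx.
have [_ /(_ qB) E] := hxi q.
have -> : \sum_(j <- s) (if j == l then pd l f (dfwith (mix s q) l (xi q))
     else g j q) * (q j - p j) = \sum_(j <- s) g j q * (q j - p j).
  rewrite !big_seq; apply: eq_bigr => j js; case: eqP => // jl.
  by rewrite -jl js in ls.
by rewrite addrCA -h2// -E subrK.
Qed.

End ChainRule.

Lemma is_derive_continuous (R : realType) (F : R -> R) (x d : R) :
  is_derive x 1 F d -> {for x, continuous F}.
Proof.
by case=> dF _; apply: differentiable_continuous; exact/derivable1_diffP.
Qed.

Lemma cvg_curve (R : realType) (K : choiceType) (g : R -> cspace R K) (x : R)
    (dg : K -> R) :
  (forall l, is_derive x 1 (fun t => g t l) (dg l)) -> g t @[t --> x] --> g x.
Proof.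
move=> hg; apply: (@cvg_ptws R K (g @ x) (@fmap_filter _ _ g (nbhs x) _) (g x)) => l.
exact: (is_derive_continuous (hg l)).
Qed.

(** The slopes of [f] at [s x], evaluated along the curve, are multiplied by the slopes of the
    coordinates of the curve; the sum is a slope function for the composite. *)
Lemma is_derive_curve (R : realType) (K : choiceType) (U : set (cspace R K))
    (f : cspace R K -> R) (S : {fset K}) (s : R -> cspace R K) (x : R)
    (ds : K -> R) :
  open U -> local_function U f -> depends_on U S f -> U (s x) ->
  (forall l, is_derive x 1 (fun t => s t l) (ds l)) ->
  is_derive x 1 (fun t => f (s t)) (\sum_(l <- S) ds l * pd l f (s x)).
Proof.
move=> oU lf hS Us hs.
have [g [hg gE]] := local_slopes oU lf hS Us.
have cs := cvg_curve hs.
have /choice[G hG] : forall l, exists G, [/\ forall t : R,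
    s t l = s x l + G t * (t - x), {for x, continuous G} & G x = ds l].
  by move=> l; exact: (is_derive_slope (hs l)).
apply: (@slope_is_derive _ _ (fun t => \sum_(l <- S) G l t * g l (s t))).
- have gE' : \forall t \near x, f (s t) = f (s x) +
      \sum_(l <- S) g l (s t) * (s t l - s x l).
    exact: (cs _ gE).
  apply: filterS gE' => t /= ->; congr (_ + _).
  rewrite mulr_suml; apply: eq_bigr => l _; have [-> _ _] := hG l.
  by rewrite [s x l + _]addrC addrK; ring.
- apply: continuous_at_sum => l lS; have [_ c1 _] := hG l.
  have [c2 _] := hg l lS; apply: (cvgM c1).
  exact: (cvg_comp s (g l) cs c2).
- rewrite !big_seq; apply: eq_bigr => l lS; have [_ _ ->] := hG l.
  by have [_ ->] := hg l lS.
Qed.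

Lemma has_pd_comp (R : realType) (K K' : choiceType) (U : set (cspace R K'))
    (f : cspace R K' -> R) (S : {fset K'}) (s : cspace R K -> cspace R K')
    (k : K) (p : cspace R K) (ds : K' -> R) :
  open U -> local_function U f -> depends_on U S f -> U (s p) ->
  (forall l, has_pd k (fun q => s q l) p (ds l)) ->
  has_pd k (f \o s) p (\sum_(l <- S) ds l * pd l f (s p)).
Proof.
move=> oU lf hS Usp hs.
have := @is_derive_curve R K' U f S (fun t => s (dfwith p k t)) (p k) ds oU lf hS.
by rewrite dfwith_id => /(_ Usp hs).
Qed.

(** * Integration along rays *)

Section UnitIntegral.
Variable R : realType.
Local Notation mu := (@lebesgue_measure R).
Local Notation I01 := (`[0, 1]%classic : set R).
Implicit Types (h g : R -> R).

Definition unit_integral h : R := \int[mu]_(s in I01) h s.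

Definition continuous01 h := forall s, 0 <= s <= 1 -> {for s, continuous h}.

Lemma continuous01_integrable h : continuous01 h -> mu.-integrable I01 (EFin \o h).
Proof.
move=> ch; apply: continuous_compact_integrable; first exact: segment_compact.
apply: continuous_in_subspaceT => s; rewrite inE/= in_itv/=; exact: ch.
Qed.

Lemma eq_unit_integral h g : (forall s, 0 <= s <= 1 -> h s = g s) ->
  unit_integral h = unit_integral g.
Proof. by move=> hg; apply: eq_Rintegral => s; rewrite inE/= in_itv/=; exact: hg. Qed.

Lemma unit_integralD h g : continuous01 h -> continuous01 g ->
  unit_integral (fun s => h s + g s) = unit_integral h + unit_integral g.
Proof.
move=> ch cg; apply: RintegralD; [exact: measurable_itv| |];
exact: continuous01_integrable.
Qed.

Lemma unit_integralZ a h : continuous01 h ->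
  unit_integral (fun s => a * h s) = a * unit_integral h.
Proof.
by move=> ch; apply: RintegralZl; [exact: measurable_itv|exact: continuous01_integrable].
Qed.

Lemma unit_integral0 : unit_integral (fun=> 0) = 0.
Proof. by rewrite /unit_integral Rintegral_cst ?mul0r//; exact: measurable_itv. Qed.

Lemma continuous01_sum (T : eqType) (r : seq T) (A : T -> R -> R) :
  (forall l, l \in r -> continuous01 (A l)) ->
  continuous01 (fun s => \sum_(l <- r) A l s).
Proof. by move=> cA s s01; apply: continuous_at_sum => l lr; exact: cA. Qed.

Lemma unit_integral_sum (T : eqType) (r : seq T) (A : T -> R -> R) :
  (forall l, l \in r -> continuous01 (A l)) ->
  unit_integral (fun s => \sum_(l <- r) A l s) = \sum_(l <- r) unit_integral (A l).
Proof.
elim: r => [_|l r ih cA].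
  rewrite [RHS]big_nil -[RHS]unit_integral0; apply: eq_unit_integral => s _.
  exact: big_nil.
have cA' k : k \in r -> continuous01 (A k).
  by move=> kr; apply: cA; rewrite inE kr orbT.
rewrite big_cons -ih// -(unit_integralD (cA l (mem_head _ _)) (continuous01_sum cA')).
by apply: eq_unit_integral => s _; exact: big_cons.
Qed.

Lemma unit_integral_norm_le h e : continuous01 h ->
  (forall s, 0 <= s <= 1 -> `|h s| <= e) -> `|unit_integral h| <= e.
Proof.
move=> ch he.
have cn : continuous01 (fun s => `|h s|).
  by move=> s s01; apply: (cvg_norm (ch s s01)).
have cc : continuous01 (fun=> e) by move=> s _; exact: cst_continuous.
apply: (@le_trans _ _ (\int[mu]_(s in I01) `|h s|)).
  by apply: le_normr_Rintegral; [exact: measurable_itv|exact: continuous01_integrable].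
apply: (@le_trans _ _ (\int[mu]_(s in I01) e)).
  apply: le_Rintegral; [exact: measurable_itv| | |];
    [exact: continuous01_integrable|exact: continuous01_integrable|].
  by move=> s; rewrite /= in_itv/=; exact: he.
rewrite Rintegral_cst//= lebesgue_measure_itv/= lte_fin ltr01.
by rewrite -EFinD/= subr0 mulr1.
Qed.

Lemma unit_integral_FTC (F : R -> R) h : continuous01 h ->
  (forall s : R, 0 <= s <= 1 -> is_derive s 1 F (h s)) -> unit_integral h = F 1 - F 0.
Proof.
move=> ch dF; rewrite /unit_integral /Rintegral (@continuous_FTC2 R h F 0 1)//.
- apply: continuous_in_subspaceT => s; rewrite inE/= in_itv/=; exact: ch.
- have c s : 0 <= s <= 1 -> {for s, continuous F}.
    by move=> /dF; exact: is_derive_continuous.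
  split.
  + move=> s; rewrite in_itv/= => /andP[s0 s1].
    by case: (dF s) => //; rewrite !ltW.
  + by apply: cvg_at_right_filter; apply: c; rewrite lexx ler01.
  + by apply: cvg_at_left_filter; apply: c; rewrite lexx ler01.
- move=> s; rewrite in_itv/= => /andP[s0 s1]; rewrite derive1E.
  have ds : is_derive s 1 F (h s) by apply: dF; rewrite !ltW.
  exact: derive_val.
Qed.

End UnitIntegral.

(** * Dilations towards the base point *)

Section Scaling.
Variables (R : realType) (K : choiceType) (p0 : cspace R K) (c : pred K).
Variables (S0 : {fset K}) (e0 : R).
Local Notation pt := (cspace R K).
Implicit Types (f : pt -> R) (p q : pt) (s : R).

(** [c] selects the contracted coordinates: the fibre ones for the existence of a potential, all of
    them for the independence of the Lagrangian class. *)
Definition scale s p : pt := fun k => if c k then p0 k + s * (p k - p0 k) else p k.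

Local Notation V := (coordinate_box S0 e0 p0).

Lemma scale1 p : scale 1 p = p.
Proof.
by apply/funext => k; rewrite /scale; case: ifP => // _; rewrite mul1r addrC subrK.
Qed.

Lemma scale_box s p : 0 <= s <= 1 -> V p -> V (scale s p).
Proof.
move=> /andP[s0 s1] Vp k kS; rewrite /scale; case: ifP => _; last exact: Vp.
rewrite addrC addKr normrM ger0_norm//.
by apply: le_lt_trans (Vp k kS); rewrite ler_piMl.
Qed.

Lemma scale_dfwith s p k t : scale s (dfwith p k t) =
  dfwith (scale s p) k (if c k then p0 k + s * (t - p0 k) else t).
Proof.
apply/funext => j; rewrite /scale; have [<-|kj] := eqVneq k j.
  by rewrite !dfwithin.
by rewrite !dfwithout.
Qed.

Lemma has_pd_scale f k s p : local_function V f -> V p -> 0 <= s <= 1 ->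
  has_pd k (fun q => f (scale s q)) p ((if c k then s else 1) * pd k f (scale s p)).
Proof.
move=> lf Vp s01; set a := if c k then s else 1.
pose phi t := if c k then p0 k + s * (t - p0 k) else t.
have phi_k : phi (p k) = scale s p k by [].
have [G [hG cG Gk]] := is_derive_slope (local_has_pd k lf (scale_box s01 Vp)).
have cphi : {for p k, continuous phi}.
  have : is_derive (p k) 1 phi a.
    apply: (@slope_is_derive _ _ (fun=> a)) => //; last exact: cst_continuous.
    by apply: (@filterE _ _ (nbhs_filter (p k))) => t; rewrite /phi /a; case: ifP => _; ring.
  exact: is_derive_continuous.
apply: (@slope_is_derive _ _ (fun t => a * G (phi t))).
- apply: (@filterE _ _ (nbhs_filter (p k))) => t; rewrite !scale_dfwith -!/(phi _) hG phi_k -phi_k.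
  rewrite [in RHS]hG subrr mulr0 addr0; congr (_ + _).
  by rewrite /phi /a; case: ifP => _; ring.
- apply: cvgM; first exact: cst_continuous.
  by apply: (cvg_comp phi G cphi); rewrite phi_k.
- by rewrite phi_k Gk.
Qed.

Lemma scale_cvg s p : (scale x.1 x.2) @[x --> (s, p)] --> scale s p.
Proof.
pose phi (x : R * pt) : pt := scale x.1 x.2.
apply: (@cvg_ptws R K (phi @ (s, p)) (@fmap_filter _ _ phi (nbhs (s, p)) _) (scale s p)).
move=> k; suff : phi x k @[x --> (s, p)] --> scale s p k by [].
have c2 : (x.2 : pt) k @[x --> (s, p)] --> p k.
  exact: (cvg_comp (@snd R pt) (fun q : pt => q k) cvg_snd (@ptws_proj_cvg R K k p)).
rewrite /phi /scale; case: ifP => // _.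
have FF : Filter (nbhs (s, p)) by exact: nbhs_filter.
have cc : (fun=> p0 k) @ nbhs (s, p) --> p0 k by exact: cvg_cst.
have c1 : (@fst R pt) @ nbhs (s, p) --> s by exact: (@cvg_fst R pt (nbhs s) (nbhs p) _).
exact: (cvgD cc (cvgM c1 (cvgB c2 cc))).
Qed.

Lemma is_derive_scale s p l :
  is_derive s 1 (fun t : R => scale t p l) (if c l then p l - p0 l else 0).
Proof.
apply: (@slope_is_derive _ _ (fun=> if c l then p l - p0 l else 0)) => //.
  apply: (@filterE _ _ (nbhs_filter s)) => t.
  by rewrite /scale; case: ifP => _; ring.
exact: cst_continuous.
Qed.

Lemma continuous_scale f s p : local_function V f -> V p -> 0 <= s <= 1 ->
  {for s, continuous (fun t => f (scale t p))}.
Proof.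
move=> lf Vp s01.
have c1 := cvg_curve (is_derive_scale s p).
exact: (cvg_comp (fun t => scale t p) f c1 (local_continuous lf (scale_box s01 Vp))).
Qed.

(** Compactness of the unit interval gives one neighbourhood of [p] that serves all [s] at once.
    This uniformity yields both the continuity of ray integrals and a bound for differentiating
    them. *)
Lemma scale_near f p (e : R) : local_function V f -> V p -> 0 < e ->
  \forall q \near p, V q /\
    forall s, 0 <= s <= 1 -> `|f (scale s q) - f (scale s p)| < e.
Proof.
move=> lf Vp e_gt0; apply: filterI.
  apply: open_nbhs_nbhs; split => //; exact: coordinate_box_open.
have /compact_near_coveringP cov := @segment_compact R 0 1.
suff H (s : R) : `[0, 1]%classic s -> \forall s' \near s & q \near nbhs p,
    `|f (scale s' q) - f (scale s' p)| < e.
  have := cov pt (nbhs p) (fun q s => `|f (scale s q) - f (scale s p)| < e)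
    (nbhs_filter p) H.
  by apply: filterS => q hq s s01; apply: hq; rewrite /= in_itv.
rewrite /= in_itv/= => s01.
have cf := local_continuous lf (scale_box s01 Vp).
have c2 : f (scale x.1 x.2) @[x --> (s, p)] --> f (scale s p).
  exact: (cvg_comp (fun x : R * pt => scale x.1 x.2) f (@scale_cvg s p) cf).
have e2 : 0 < e / 2 by rewrite divr_gt0.
have c3 : f (scale s' p) @[s' --> s] --> f (scale s p).
  exact: (continuous_scale lf Vp s01).
have /cvgrPdist_lt/(_ _ e2) n2 := c2.
have /cvgrPdist_lt/(_ _ e2) n3 := c3.
have n3' : \forall x \near (s, p), `|f (scale s p) - f (scale x.1 p)| < e / 2.
  exact: (@cvg_fst _ _ (nbhs s) (nbhs p) _ _ n3).
apply: filterS2 n2 n3' => -[s' q] /= h2 h3.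
have -> : f (scale s' q) - f (scale s' p) =
   (f (scale s p) - f (scale s' p)) - (f (scale s p) - f (scale s' q)) by ring.
by apply: le_lt_trans (ler_normB _ _) _; lra.
Qed.

(** The weight [s ^+ m] is the factor produced by pulling back [m] contracted differentials along
    [scale p0 c s]. *)
Definition ray_integral m f p := unit_integral (fun s => s ^+ m * f (scale s p)).

Lemma continuous01_scale f p m : local_function V f -> V p ->
  continuous01 (fun s => s ^+ m * f (scale s p)).
Proof.
move=> lf Vp s s01; apply: cvgM; first exact: exprn_continuous.
exact: (continuous_scale lf Vp s01).
Qed.

End Scaling.

(** * Ray integrals of local functions *)

Section RayIntegral.
Variables (R : realType) (K : choiceType) (p0 : cspace R K) (c : pred K).
Variables (S0 : {fset K}) (e0 : R).
Local Notation pt := (cspace R K).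
Implicit Types (f : pt -> R) (p q : pt).
Local Notation V := (coordinate_box S0 e0 p0).
Local Notation mu := (@lebesgue_measure R).
Local Notation rint := (ray_integral p0 c).

Let oV : open V. Proof. exact: coordinate_box_open. Qed.

Lemma ray_integral_eqon m f g : eqon V f g -> eqon V (rint m f) (rint m g).
Proof.
by move=> fg p Vp; apply: eq_unit_integral => s s01; rewrite fg//; exact: scale_box.
Qed.

Lemma ray_integralZ m a f p : local_function V f -> V p ->
  rint m (fun q => a * f q) p = a * rint m f p.
Proof.
move=> lf Vp; rewrite /ray_integral.
rewrite -(unit_integralZ a (continuous01_scale (c := c) (m := m) lf Vp)).
by apply: eq_unit_integral => s _; rewrite mulrCA.
Qed.

Lemma ray_integral_sum (T : eqType) (r : seq T) m (f : T -> pt -> R) p :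
  (forall l, l \in r -> local_function V (f l)) -> V p ->
  rint m (fun q => \sum_(l <- r) f l q) p = \sum_(l <- r) rint m (f l) p.
Proof.
move=> lf Vp; rewrite /ray_integral.
rewrite -(unit_integral_sum (fun l lr => continuous01_scale (c := c) (m := m) (lf l lr) Vp)).
by apply: eq_unit_integral => s _; rewrite mulr_sumr.
Qed.

Lemma ray_integral_zero m f p : (forall q, V q -> f q = 0) -> V p -> rint m f p = 0.
Proof.
move=> f0 Vp; rewrite /ray_integral -[RHS](@unit_integral0 R).
by apply: eq_unit_integral => s s01; rewrite f0 ?mulr0//; exact: scale_box.
Qed.

Lemma ray_integral_continuous m f p : local_function V f -> V p ->
  {for p, continuous (rint m f)}.
Proof.
move=> lf Vp; suff cc : rint m f @ nbhs p --> rint m f p by exact: cc.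
apply/cvgrPdist_le => e e_gt0.
have n := scale_near c lf Vp e_gt0; apply: filterS n => q [Vq h].
have c1 := continuous01_scale (c := c) (m := m) lf Vp.
have c2 := continuous01_scale (c := c) (m := m) lf Vq.
have c3 : continuous01 (fun s => -1 * (s ^+ m * f (scale p0 c s q))).
  by move=> s s01; apply: cvgM (c2 s s01); exact: cst_continuous.
have cB : continuous01 (fun s => s ^+ m * f (scale p0 c s p)
    + (-1) * (s ^+ m * f (scale p0 c s q))).
  by move=> s s01; exact: (cvgD (c1 s s01) (c3 s s01)).
have -> : rint m f p - rint m f q = unit_integral (fun s =>
    s ^+ m * f (scale p0 c s p) + (-1) * (s ^+ m * f (scale p0 c s q))).
  by rewrite (unit_integralD c1 c3) (unit_integralZ (-1) c2) mulN1r.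
apply: (unit_integral_norm_le cB) => s s01.
have -> : s ^+ m * f (scale p0 c s p) + -1 * (s ^+ m * f (scale p0 c s q)) =
  s ^+ m * (f (scale p0 c s p) - f (scale p0 c s q)) by ring.
have /andP[s0 s1] := s01.
rewrite normrM ger0_norm ?exprn_ge0//.
apply: le_trans (ltW (h s s01)); rewrite distrC.
by apply: ler_piMl => //; exact: exprn_ile1.
Qed.

(** Differentiation under the integral sign; when [k] is contracted, the inner derivative of the
    dilation contributes one more factor [s], hence the exponent [m + c k]. *)
Lemma ray_integral_has_pd m f k p : local_function V f -> V p ->
  has_pd k (rint m f) p (rint (m + c k) (pd k f) p).
Proof.
move=> lf Vp; have lkf := local_pd oV k lf.
have nV := scale_near c lkf Vp ltr01.
have /(@near_dfwith _ _ _ _ k) := nV.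
rewrite -nbhs_nearE => -[d /= d0 hd].
pose F (x y : R) := y ^+ m * f (scale p0 c y (dfwith p k x)).
pose u := p k - d; pose v := p k + d.
have Iin (x : R) : `]u, v[%classic x -> V (dfwith p k x) /\ forall s, 0 <= s <= 1 ->
    `|pd k f (scale p0 c s (dfwith p k x)) - pd k f (scale p0 c s p)| < 1.
  by rewrite /= in_itv/= /u /v => xuv; apply: hd; rewrite /= ltr_norml; lra.
have Ia : `]u, v[%classic (p k) by rewrite /= in_itv/= /u /v; lra.
have hF (x y : R) : `]u, v[%classic x -> `[0, 1]%classic y ->
    is_derive x 1 (F ^~ y) (y ^+ m * ((if c k then y else 1) *
      pd k f (scale p0 c y (dfwith p k x)))).
  rewrite [X in _ -> X -> _]/= in_itv/= => /Iin[Vx _] y01.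
  have := has_pd_scale c k lf Vx y01; rewrite /has_pd dfwithin => hx.
  have hx' : is_derive x 1 (fun t : R => f (scale p0 c y (dfwith p k t)))
      ((if c k then y else 1) * pd k f (scale p0 c y (dfwith p k x))).
    have e : (fun t => f (scale p0 c y (dfwith (dfwith p k x) k t))) =
        (fun t => f (scale p0 c y (dfwith p k t))).
      by apply/funext => t; rewrite dfwith_dfwith.
    by rewrite -e.
  exact: (is_deriveZ (y ^+ m) hx').
(* The dominating function: on the chosen interval around [p k], the derivative along the ray
   differs by less than 1 from its value on the ray of [p], and the extra factors are at most 1. *)
pose G : R -> R := fun y => `|pd k f (scale p0 c y p)| + 1.
have mI := @measurable_itv R `[0, 1].
have intF (x : R) : `]u, v[%classic x -> mu.-integrable `[0, 1] (EFin \o F x).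
  by move=> /Iin[Vx _]; exact: (continuous01_integrable (continuous01_scale (c := c) (m := m) lf Vx)).
have derF (x y : R) : `]u, v[%classic x -> `[0, 1]%classic y -> derivable (F ^~ y) x 1.
  by move=> Ix Iy; case: (hF x y Ix Iy).
have G0 (y : R) : 0 <= G y by rewrite /G addr_ge0.
have intG : mu.-integrable `[0, 1] (EFin \o G).
  apply: continuous01_integrable => s s01; have cs := @cst_continuous R R 1 s; apply: (cvgD _ cs).
  exact: (cvg_norm (continuous_scale lkf Vp s01)).
have Gub (x y : R) : `]u, v[%classic x -> `[0, 1]%classic y -> `|partial1of2 F x y| <= G y.
  move=> Ix Iy; have hxy := hF x y Ix Iy.
  rewrite partial1of2E derive_val /G.
  have [_] := Iin x Ix; move: Iy; rewrite /= in_itv/= => y01 /(_ y y01) h.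
  have /andP[y0 y1] := y01.
  rewrite mulrA normrM; apply: (@le_trans _ _ `|pd k f (scale p0 c y (dfwith p k x))|).
    apply: ler_piMl => //; rewrite normrM ger0_norm ?exprn_ge0//.
    apply: mulr_ile1; rewrite ?exprn_ge0 ?exprn_ile1//.
    by case: ifP; rewrite ?normr1// ger0_norm.
  set A := pd k f _ in h *; set B := pd k f _ in h *.
  have := ler_distD 0 A B; have := ler_normD (A - B) B; rewrite subrK => ? _.
  by lra.
have D := derivable_under_integral (mu := mu) mI Ia intF derF G0 intG Gub.
have E := differentiation_under_integral (mu := mu) mI Ia intF derF G0 intG Gub.
rewrite derive1E in E.
have -> : rint (m + c k) (pd k f) p = \int[mu]_(y in `[0, 1]) partial1of2 F (p k) y.
  apply: eq_Rintegral => y /set_mem Iy; have hy := hF (p k) y Ia Iy.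
  rewrite partial1of2E derive_val dfwith_id exprD -mulrA; congr (_ * (_ * _)).
  by case: (c k); rewrite ?expr1 ?expr0.
by rewrite -E; exact: derivableP.
Qed.

Lemma ray_integral_depends S m f : depends_on V S f -> depends_on V S (rint m f).
Proof.
move=> hS p q Vp Vq pq; apply: eq_unit_integral => s s01; congr (_ * _).
apply: hS; [exact: scale_box|exact: scale_box|].
by move=> k kS; rewrite /scale pq.
Qed.

(** By [ray_integral_has_pd], the ray integrals with all exponents form a class stable under [pd] up
    to equality on the box, so [smooth_coind] applies. *)
Lemma local_ray_integral m f : local_function V f -> local_function V (rint m f).
Proof.
move=> lf; split.
  by have [S hS] := local_depends lf; exists S; exact: ray_integral_depends.
pose C g := exists m f, local_function V f /\ eqon V (rint m f) g.
apply: (@smooth_coind _ _ V C); last by exists m, f; split.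
- move=> g [{}m [{}f [{}lf fg]]] p Vp; split=> [k|].
    apply: (has_pd_derivable (has_pd_eqon oV Vp fg _)).
    exact: ray_integral_has_pd.
  by apply: continuous_eqon fg _ => //; exact: ray_integral_continuous.
- move=> g k [{}m [{}f [{}lf fg]]]; exists (m + c k)%N, (pd k f); split.
    exact: local_pd.
  move=> p Vp; rewrite -(pd_eqon k oV fg Vp).
  exact/esym/has_pd_val/ray_integral_has_pd.
Qed.

Lemma pd_ray_integral m f k p : local_function V f -> V p ->
  pd k (rint m f) p = rint (m + c k) (pd k f) p.
Proof. by move=> lf Vp; apply: has_pd_val; exact: ray_integral_has_pd. Qed.

(** Integrates the derivative in [s] of [s ^+ m * f (scale p0 c s p)]. For [m = 0] the coefficient
    [m%:R] kills the term with the default [m.-1], while [0 ^+ 0 = 1] keeps the value at the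
    contracted point. *)
Lemma ray_integral_FTC m f (L : {fset K}) p :
  local_function V f -> depends_on V L f -> V p ->
  m%:R * rint m.-1 f p +
    \sum_(l <- L | c l) (p l - p0 l) * rint m (pd l f) p =
  f p - 0 ^+ m * f (scale p0 c 0 p).
Proof.
move=> lf hL Vp.
pose h1 s := m%:R * (s ^+ m.-1 * f (scale p0 c s p)).
pose h2 s := \sum_(l <- L) (if c l then p l - p0 l else 0) *
  (s ^+ m * pd l f (scale p0 c s p)).
have c1 : continuous01 h1.
  move=> s s01.
  exact: (cvgM (@cst_continuous _ _ (m%:R : R) s)
    (continuous01_scale (c := c) (m := m.-1) lf Vp s01)).
have c2' l : l \in L -> continuous01 (fun s => (if c l then p l - p0 l else 0) *
    (s ^+ m * pd l f (scale p0 c s p))).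
  move=> _ s s01; apply: (cvgM (@cst_continuous _ _ (if c l then p l - p0 l else 0) s)).
  exact: (continuous01_scale (c := c) (m := m) (local_pd oV l lf) Vp s01).
have c2 : continuous01 h2 by exact: continuous01_sum.
have c12 : continuous01 (fun s => h1 s + h2 s).
  by move=> s s01; apply: cvgD; [exact: c1|exact: c2].
transitivity (unit_integral (fun s => h1 s + h2 s)).
  rewrite (unit_integralD c1 c2); congr (_ + _).
    by rewrite (unit_integralZ _ (continuous01_scale (c := c) (m := m.-1) lf Vp)).
  rewrite (unit_integral_sum c2') big_mkcond; apply: eq_bigr => l _.
  rewrite (unit_integralZ _ (continuous01_scale (c := c) (m := m) (local_pd oV l lf) Vp)).
  by case: ifP => // _; rewrite mul0r.
suff dF (s : R) : 0 <= s <= 1 ->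
    is_derive s 1 (fun t : R => t ^+ m * f (scale p0 c t p)) (h1 s + h2 s).
  by rewrite (unit_integral_FTC c12 dF) expr1n mul1r scale1.
move=> s01.
have d1 := is_derive_curve oV lf hL (scale_box c s01 Vp) (is_derive_scale p0 c s p).
have d2 : is_derive s 1 (fun t : R => t ^+ m) (m%:R * s ^+ m.-1).
  split; first exact: exprn_derivable.
  by rewrite exp_derive; exact: mulr1.
have d3 := is_deriveM d2 d1.
apply: (is_derive_eq d3).
rewrite /= addrC /h1 /h2; congr (_ + _).
  by rewrite [_ *: _]mulrC -mulrA.
rewrite [_ *: _]mulr_sumr; apply: eq_bigr => l _.
by rewrite mulrCA.
Qed.

End RayIntegral.

(** * Antisymmetric forms and the homotopy operator *)

Section Insertion.
Variables (T : Type) (k : nat).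

(** A right inverse of [omit]. With [j = ord0], [w (ins ord0 l u)] gives the components of the
    contraction of [w] with the coordinate vector d/dz^l. *)
Definition ins (j : 'I_k.+1) (l : T) (v : {ffun 'I_k -> T}) : {ffun 'I_k.+1 -> T} :=
  [ffun i => oapp v l (unlift j i)].

Lemma ins_at j l v : ins j l v j = l.
Proof. by rewrite ffunE unlift_none. Qed.

Lemma ins_lift j l v i : ins j l v (lift j i) = v i.
Proof. by rewrite ffunE liftK. Qed.

End Insertion.

Lemma omit_ins (K : choiceType) k (j : 'I_k.+1) (l : K) (v : {ffun 'I_k -> K}) :
  omit (ins j l v) j = v.
Proof. by apply/ffunP => i; rewrite ffunE ins_lift. Qed.

Lemma omit_ins0_lift (K : choiceType) k (l : K) (u : {ffun 'I_k.+1 -> K}) (j : 'I_k.+1) :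
  omit (ins ord0 l u) (lift ord0 j) = ins ord0 l (omit u j).
Proof.
apply/ffunP => i; rewrite ffunE; case: (unliftP ord0 i) => [i' ->|->].
  have -> : lift (lift ord0 j) (lift ord0 i') = lift ord0 (lift j i').
    by apply/val_inj => /=; rewrite /bump /= !add1n !ltnS addnS.
  by rewrite !ins_lift ffunE.
have -> : lift (lift ord0 j) (@ord0 k) = ord0 by exact: val_inj.
by rewrite !ins_at.
Qed.

Lemma sum_ins (V : nmodType) (T : finType) k (j : 'I_k.+1) (G : {ffun 'I_k.+1 -> T} -> V) :
  \sum_u G u = \sum_l \sum_v G (ins j l v).
Proof.
rewrite pair_big /=.
rewrite (reindex (fun x : T * {ffun 'I_k -> T} => ins j x.1 x.2))//=.
exists (fun u : {ffun 'I_k.+1 -> T} => (u j, [ffun i => u (lift j i)])).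
  move=> [l v] _ /=; congr (_, _); first exact: ins_at.
  by apply/ffunP => i; rewrite ffunE ins_lift.
move=> u _ /=; apply/ffunP => i; rewrite ffunE.
by case: unliftP => [i' ->|->//]; rewrite /= ffunE.
Qed.

Section FiniteSupport.
Variables (R : realType) (K : choiceType).
Local Notation pt := (cspace R K).

(** Finiteness is expressed by a set of coordinates instead of a set of index tuples, so that
    finitely supported sums become sums over the finite type of tuples in [F]. *)
Definition vanishes_outside k (U : set pt) (F : {fset K}) (w : diff_form R K k) :=
  forall (u : {ffun 'I_k -> K}) p, U p -> (exists i, u i \notin F) -> w u p = 0.

Definition valf k (F : {fset K}) (v : {ffun 'I_k -> F}) : {ffun 'I_k -> K} :=
  [ffun i => val (v i)].

Lemma valf_inj k F : injective (@valf k F).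
Proof.
by move=> v v' /ffunP e; apply/ffunP => i; apply: val_inj; have := e i; rewrite !ffunE.
Qed.

Lemma valf_onto k (F : {fset K}) (u : {ffun 'I_k -> K}) :
  (forall i, u i \in F) -> exists v : {ffun 'I_k -> F}, valf v = u.
Proof.
move=> uF; exists [ffun i => [` uF i]%fset].
by apply/ffunP => i; rewrite !ffunE.
Qed.

Lemma fsum_valf k (F : {fset K}) (G : {ffun 'I_k -> K} -> R) :
  (forall u : {ffun 'I_k -> K}, (exists i, u i \notin F) -> G u = 0) ->
  \sum_(u \in [set: {ffun 'I_k -> K}]) G u = \sum_(v : {ffun 'I_k -> F}) G (valf v).
Proof.
move=> G0; pose r := map (@valf k F) (enum {ffun 'I_k -> F}).
have ur : uniq r by rewrite map_inj_uniq ?enum_uniq//; exact: valf_inj.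
have -> : \sum_(v : {ffun 'I_k -> F}) G (valf v) = \sum_(u <- r) G u.
  by rewrite big_map big_enum.
rewrite (fsbig_seq _ _ ur); apply/esym/fsbig_widen => // u [_ /= ur'].
apply: G0; apply: contrapT => nE; apply: ur'.
have [v <-] : exists v : {ffun 'I_k -> F}, valf v = u.
  by apply: valf_onto => i; apply: contrapT => /negP h; apply: nE; exists i.
by apply: map_f; rewrite mem_enum.
Qed.

Definition tuples_in k (F : {fset K}) : {fset {ffun 'I_k -> K}} :=
  [fset x in map (@valf k F) (enum {ffun 'I_k -> F})]%fset.

Lemma tuples_inP k (F : {fset K}) (u : {ffun 'I_k -> K}) :
  u \notin tuples_in k F -> exists i, u i \notin F.
Proof.
rewrite inE => h; apply: contrapT => nE; case/negP: h.
have [v <-] : exists v : {ffun 'I_k -> F}, valf v = u.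
  by apply: valf_onto => i; apply: contrapT => /negP h; apply: nE; exists i.
by apply: map_f; rewrite mem_enum.
Qed.

Definition antisymmetric_on k (U : set pt) (w : diff_form R K k) :=
  forall (s : 'S_k) (t : {ffun 'I_k -> K}) p, U p ->
    w [ffun i => t (s i)] p = (-1) ^+ s * w t p.

Lemma local_form_intro k U F (w : diff_form R K k) :
  (forall t, local_function U (w t)) -> antisymmetric_on U w ->
  vanishes_outside U F w -> local_form U w.
Proof.
move=> h1 h2 h3; split => //; exists (tuples_in k F) => t p tF Up.
by apply: h3 => //; exact: tuples_inP.
Qed.

Lemma local_form_finite k U (w : diff_form R K k) : local_form U w ->
  exists F : {fset K}, vanishes_outside U F w /\ forall u, depends_on U F (w u).
Proof.
move=> [lw _ [S hS]].
have [D hD] := choice (fun u => local_depends (lw u)).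
pose F1 := (\bigcup_(u <- S) D u)%fset.
pose F2 := (\bigcup_(u <- S) [fset x in codom u])%fset.
exists (F1 `|` F2)%fset; split.
  move=> u p Up [i iF]; apply: hS => //; apply: contra iF => uS.
  rewrite inE; apply/orP; right; apply/bigfcupP; exists u; rewrite ?uS//.
  by rewrite inE; exact: codom_f.
move=> u; have [uS|uS] := boolP (u \in S); last first.
  by move=> p q Up Uq _; rewrite !hS.
apply: depends_on_sub (hD u) => l lD.
by rewrite inE; apply/orP; left; apply/bigfcupP; exists u; rewrite ?uS.
Qed.

Lemma vanishes_outside_sub k U F F' (w : diff_form R K k) :
  {subset F <= F'} -> vanishes_outside U F w -> vanishes_outside U F' w.
Proof.
move=> FF' h u p Up [i iF']; apply: h => //; exists i.
by apply: contra iF'; exact: FF'.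
Qed.

Lemma antisymmetric_front k U (w : diff_form R K k.+1) (t : {ffun 'I_k.+1 -> K}) j p :
  antisymmetric_on U w -> U p ->
  w (ins ord0 (t j) (omit t j)) p = (-1) ^+ j * w t p.
Proof.
move=> aw Up; have -> : ins ord0 (t j) (omit t j) =
    [ffun i => t (lift_perm ord0 j (1%g : 'S_k) i)].
  apply/ffunP => i; rewrite ffunE [RHS]ffunE; case: (unliftP ord0 i) => [i' ->|->].
    by rewrite /= lift_perm_lift ffunE perm1.
  by rewrite /= lift_perm_id.
rewrite aw//; congr (_ * _).
by rewrite odd_lift_perm odd_perm1 addbF /= signr_odd.
Qed.

Lemma antisymmetric_ins k U (w : diff_form R K k.+1) l :
  antisymmetric_on U w -> antisymmetric_on U (fun u => w (ins ord0 l u)).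
Proof.
move=> aw s t p Up.
have -> : ins ord0 l [ffun i => t (s i)] =
    [ffun i => ins ord0 l t (lift_perm ord0 ord0 s i)].
  apply/ffunP => i; rewrite ffunE [RHS]ffunE; case: (unliftP ord0 i) => [i' ->|->].
    by rewrite /= lift_perm_lift ins_lift ffunE.
  by rewrite /= lift_perm_id ins_at.
by rewrite aw// odd_lift_perm.
Qed.

Lemma antisymmetric_repeat k U (w : diff_form R K k) (t : {ffun 'I_k -> K}) p i j :
  antisymmetric_on U w -> U p -> i != j -> t i = t j -> w t p = 0.
Proof.
move=> aw Up ij tij; have := aw (tperm i j) t p Up.
have -> : [ffun l => t (tperm i j l)] = t.
  apply/ffunP => l; rewrite ffunE.
  by case: tpermP => [->|->|//].
rewrite odd_tperm ij expr1 mulN1r => h.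
by apply/eqP; rewrite -[_ == 0](mulrn_eq0 (w t p) 2) mulr2n {1}h addNr.
Qed.

End FiniteSupport.

(** * The Cartan homotopy formula *)

Section Homotopy.
Variables (R : realType) (K : choiceType) (p0 : cspace R K) (c : pred K).
Variables (S0 : {fset K}) (e0 : R).
Local Notation pt := (cspace R K).
Local Notation V := (coordinate_box S0 e0 p0).
Local Notation rint := (ray_integral p0 c).

Let oV : open V. Proof. exact: coordinate_box_open. Qed.

Definition moved_degree k (u : {ffun 'I_k -> K}) : nat := (\sum_(i < k) c (u i))%N.

Lemma moved_degreeD1 k (t : {ffun 'I_k.+1 -> K}) j :
  moved_degree t = (c (t j) + moved_degree (omit t j))%N.
Proof.
rewrite /moved_degree (bigD1_ord j)//=; congr (_ + _)%N.
by apply: eq_bigr => i _; rewrite ffunE.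
Qed.

(** The components of the integral over [s] of the pullback of i_Z w along the dilation: Z is its
    velocity, with coefficients [p l - p0 l], and each contracted differential in [u] brings a
    factor [s]. *)
Definition homotopy (F : {fset K}) k (w : diff_form R K k.+1) : diff_form R K k :=
  fun u p => \sum_(l <- F | c l)
    (p l - p0 l) * rint (moved_degree u) (w (ins ord0 l u)) p.

Lemma homotopy_local_form F k (w : diff_form R K k.+1) :
  local_form V w -> vanishes_outside V F w -> local_form V (homotopy F w).
Proof.
move=> [lw aw _] vw; apply: (@local_form_intro _ _ _ _ F).
- move=> t; apply: local_sum => // l _ _; apply: localM => //.
    apply: localB => //; [exact: local_coord|exact: local_cst].
  exact: local_ray_integral.
- move=> s t p Vp; rewrite mulr_sumr; apply: eq_bigr => l _.
  rewrite mulrCA; congr (_ * _).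
  have -> : moved_degree [ffun i => t (s i)] = moved_degree t.
    rewrite /moved_degree [RHS](reindex_inj (@perm_inj _ s)) /=.
    by apply: eq_bigr => i _; rewrite ffunE.
  rewrite -(ray_integralZ c _ _ (lw _) Vp).
  apply: (ray_integral_eqon c _ _ Vp) => q Vq.
  exact: (antisymmetric_ins l aw).
- move=> u p Vp [i iF]; apply: big1 => l _; rewrite (ray_integral_zero _ _ _ Vp) ?mulr0//.
  by move=> q Vq; apply: vw => //; exists (lift ord0 i); rewrite ins_lift.
Qed.

(** Differentiating the coefficient [p l - p0 l] produces the term in which the weight is
    differentiated; differentiating the integrand produces, by closedness, the radial derivative of
    [w]. Together they form the integral of a derivative in [s], and the remaining term is the
    pullback of [w] at [s = 0]. *)
Lemma de_rham_homotopy F k (w : diff_form R K k.+1) t p :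
  local_form V w -> vanishes_outside V F w -> (forall u, depends_on V F (w u)) ->
  form_eq V (de_rham w) (fun _ _ => 0) -> V p ->
  de_rham (homotopy F w) t p = w t p - 0 ^+ moved_degree t * w t (scale p0 c 0 p).
Proof.
move=> [lw aw _] vw dw cw Vp; set M := moved_degree t.
rewrite -(ray_integral_FTC c M (lw t) (dw t) Vp).
have step (j : 'I_k.+1) : pd (t j) (homotopy F w (omit t j)) p =
    \sum_(l <- F | c l) (t j == l)%:R * rint (moved_degree (omit t j))
        (w (ins ord0 l (omit t j))) p +
    \sum_(l <- F | c l) (p l - p0 l) * rint M (pd (t j) (w (ins ord0 l (omit t j)))) p.
  have D := derivation_pd oV (t j) Vp.
  have lx l : local_function V (fun q => q l - p0 l).
    by apply: localB => //; [exact: local_coord|exact: local_cst].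
  rewrite (derivation_sum oV D); last first.
    by move=> l _ _; apply: localM => //; exact: local_ray_integral.
  rewrite -big_split; apply: eq_bigr => l _ /=.
  rewrite (derivationM D)//; last exact: local_ray_integral.
  congr (_ * _ + _ * _).
    rewrite (derivationB oV D); [|exact: local_coord|exact: local_cst].
    by rewrite (derivation_cst D) subr0; exact/has_pd_val/has_pd_coord.
  rewrite (pd_ray_integral c _ _ (lw _) Vp); congr (ray_integral _ _ _ _ _).
  by rewrite /M (moved_degreeD1 t j) addnC.
rewrite /de_rham; under eq_bigr do rewrite step mulrDr.
rewrite big_split /=; congr (_ + _).
  transitivity (\sum_(j < k.+1) (c (t j))%:R * rint M.-1 (w t) p).
    apply: eq_bigr => j _; have ME : M = (c (t j) + moved_degree (omit t j))%N.
      exact: moved_degreeD1.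
    have [tF|tF] := boolP (t j \in F); last first.
      rewrite big1_seq ?mulr0 => [|l /andP[_ lF]]; last first.
        by rewrite (_ : t j == l = false) ?mul0r//; apply: contraNF tF => /eqP ->.
      rewrite (ray_integral_zero _ _ _ Vp) ?mulr0// => q Vq.
      by apply: vw => //; exists j.
    rewrite -big_filter; have [cj|cj] := boolP (c (t j)); last first.
      rewrite mul0r big1_seq ?mulr0// => l; rewrite mem_filter => /andP[_ /andP[cl _]].
      by rewrite (_ : t j == l = false) ?mul0r//; apply: contraNF cj => /eqP ->.
    rewrite (bigD1_seq (t j)) ?mem_filter ?cj ?filter_uniq ?fset_uniq//=.
    rewrite eqxx mul1r big1 ?addr0 => [|l lj]; last by rewrite eq_sym (negPf lj) mul0r.
    rewrite ME cj /= [RHS]mul1r -(ray_integralZ c _ _ (lw _) Vp).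
    apply: (ray_integral_eqon c _ _ Vp) => q Vq.
    by rewrite (antisymmetric_front _ _ aw Vq) mulrA -exprD addnn -mul2n exprM sqrrN
      !expr1n mul1r.
  by rewrite -mulr_suml /M /moved_degree natr_sum.
under eq_bigr do rewrite mulr_sumr.
rewrite exchange_big /=; apply: eq_bigr => l _.
under eq_bigr do rewrite mulrCA.
rewrite -mulr_sumr; congr (_ * _).
have lpd (j : 'I_k.+1) : local_function V (pd (t j) (w (ins ord0 l (omit t j)))).
  exact: local_pd.
transitivity (rint M (fun q => \sum_(j <- index_enum 'I_k.+1)
    (-1) ^+ j * pd (t j) (w (ins ord0 l (omit t j))) q) p).
  rewrite (ray_integral_sum c M _ Vp) => [|j _]; last first.
    by apply: localM => //; exact: local_cst.
  by apply: eq_bigr => j _; rewrite (ray_integralZ c _ _ (lpd j) Vp).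
apply: (ray_integral_eqon c _ _ Vp) => q Vq.
(* Closedness at the index [l] followed by [t] turns the alternating sum over [j] into
   [pd l (w t)]. *)
have := cw (ins ord0 l t) q Vq; rewrite /de_rham big_ord_recl /= expr0 mul1r.
rewrite ins_at omit_ins => /eqP; rewrite addr_eq0 => /eqP ->.
rewrite -sumrN; apply: eq_bigr => j _.
by rewrite ins_lift omit_ins0_lift exprS mulN1r mulNr opprK.
Qed.

End Homotopy.

(** * The adapted frame *)

Section SubstitutionSums.
Variables (R : realType) (K : choiceType).
Local Notation pt := (cspace R K).

(** Evaluation of an alternating form on vectors [th] is alternating in them. The type [A] of labels
    is free because the vectors are the adapted frame in one use and the prolonged vectors T_a in
    another. *)
Lemma antisymmetric_eval (A : Type) k (U : set pt) (w : diff_form R K k)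
    (F : {fset K}) (th : A -> K -> R) (s : 'S_k) (t : {ffun 'I_k -> A}) p :
  antisymmetric_on U w -> U p ->
  \sum_(v : {ffun 'I_k -> F}) w (valf v) p * \prod_(i < k) th (t (s i)) (valf v i) =
  (-1) ^+ s * \sum_(v : {ffun 'I_k -> F}) w (valf v) p * \prod_(i < k) th (t i) (valf v i).
Proof.
move=> aw Up.
pose h (r : 'S_k) (v : {ffun 'I_k -> F}) : {ffun 'I_k -> F} := [ffun i => v (r i)].
rewrite (reindex (h s)); last first.
  exists (h s^-1%g) => v _; apply/ffunP => i; rewrite !ffunE.
    by rewrite permKV.
  by rewrite permK.
rewrite mulr_sumr; apply: eq_bigr => v _; rewrite mulrA; congr (_ * _).
  rewrite -aw//; congr (w _ p); apply/ffunP => i; by rewrite !ffunE.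
rewrite [RHS](reindex_inj (@perm_inj _ s)) /=.
by apply: eq_bigr => i _; rewrite !ffunE.
Qed.

Lemma de_rham_coordinate (m : K) (t : {ffun 'I_1 -> K}) (p : pt) :
  de_rham (coordinate m) t p = (t ord0 == m)%:R.
Proof.
by rewrite /de_rham big_ord1 expr0 mul1r; exact/has_pd_val/has_pd_coord.
Qed.

Lemma vder_coordinate X (m : K) (p : pt) : vder X (fun q => q m) p = X m p.
Proof.
rewrite (@vderE R K setT openT X [fset m]%fset)//.
  rewrite big_seq_fset1 (_ : pd m _ p = 1) ?mulr1//.
  by rewrite (has_pd_val (has_pd_coord m m p)) eqxx.
by move=> q r _ _; apply; rewrite inE.
Qed.

End SubstitutionSums.

Section HorizontalDifferential.
Variables (R : realType) (n : nat) (I : choiceType).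
Local Notation coord := ('I_n + I)%type.
Local Notation pt := (cspace R coord).
Variable Y : 'I_n -> I -> pt -> R.

Lemma hdiffE k (w : diff_form R coord k) t p : hdiff Y w t p =
  \sum_(j < k.+1) (-1) ^+ j *
    (if t j is inl a then lie (total_field Y a) w (omit t j) p else 0).
Proof.
rewrite /hdiff /wedge1 exchange_big /=; apply: eq_bigr => j _.
rewrite -mulr_sumr; congr (_ * _).
under eq_bigr do rewrite de_rham_coordinate ffunE.
case: (t j) => [a|A]; last by rewrite big1// => a _; rewrite mul0r.
rewrite (bigD1 a)//= eqxx mul1r big1 ?addr0// => b ba.
by rewrite (_ : (inl a == inl b :> coord) = (a == b))// eq_sym (negPf ba) mul0r.
Qed.

Lemma lie0 X (w : diff_form R coord 0) t p : lie X w t p = vder X (w t) p.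
Proof. by rewrite /lie big_ord0 addr0. Qed.

Lemma hdiff0E (w : diff_form R coord 0) (t : {ffun 'I_1 -> coord}) p :
  hdiff Y w t p = if t ord0 is inl a then tder Y a (w (omit t ord0)) p else 0.
Proof.
rewrite hdiffE big_ord1 expr0 mul1r; case: (t ord0) => // a.
by rewrite lie0.
Qed.

Lemma hdiff_coordinate m (t : {ffun 'I_1 -> coord}) p :
  hdiff Y (coordinate m) t p = if t ord0 is inl a then total_field Y a m p else 0.
Proof. by rewrite hdiff0E; case: (t ord0) => // a; exact: vder_coordinate. Qed.

Lemma vdiff_coordinate m (t : {ffun 'I_1 -> coord}) p :
  vdiff Y (coordinate m) t p = (t ord0 == m)%:R -
    (if t ord0 is inl a then total_field Y a m p else 0).
Proof. by rewrite /vdiff de_rham_coordinate hdiff_coordinate. Qed.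

(** Each correction term of the Lie derivative vanishes: for a base index [l] the coefficient of D_a
    is constant, and for a fibre index the component of [w] is zero. *)
Lemma lie_horizontal k (w : diff_form R coord k) a t p :
  (forall u : {ffun 'I_k -> coord}, (exists i, ~~ hor_index (u i)) -> w u p = 0) ->
  lie (total_field Y a) w t p = tder Y a (w t) p.
Proof.
move=> hw; rewrite /lie big1 ?addr0// => j _; apply: fsbig1 => -[b|B] _.
  rewrite (_ : pd (t j) _ p = 0) ?mul0r//.
  exact: (has_pd_val (has_pd_cst (t j) ((b == a)%:R) p)).
by rewrite hw ?mulr0//; exists j; rewrite ffunE eqxx.
Qed.

Lemma hdiff_horizontal k (w : diff_form R coord k) t p :
  (forall u : {ffun 'I_k -> coord}, (exists i, ~~ hor_index (u i)) -> w u p = 0) ->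
  hdiff Y w t p = \sum_(j < k.+1) (-1) ^+ j *
    (if t j is inl a then tder Y a (w (omit t j)) p else 0).
Proof.
move=> hw; rewrite hdiffE; apply: eq_bigr => j _; congr (_ * _).
by case: (t j) => // a; exact: lie_horizontal.
Qed.

Definition vdeg k (u : {ffun 'I_k -> coord}) :=
  moved_degree (fun l : coord => ~~ hor_index l) u.

Lemma vdeg_card k (u : {ffun 'I_k -> coord}) :
  #|[pred i | ~~ hor_index (u i)]| = vdeg u.
Proof.
rewrite /vdeg /moved_degree -sum1_card big_mkcond /=.
by apply: eq_bigr => i _; rewrite inE; case: (~~ _).
Qed.

Lemma hdeg_card k (u : {ffun 'I_k -> coord}) :
  (#|[pred i | hor_index (u i)]| + vdeg u)%N = k.
Proof.
rewrite -vdeg_card; have := cardC [pred i | hor_index (u i)].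
by rewrite card_ord.
Qed.

Lemma vdeg_gt0 k (u : {ffun 'I_k -> coord}) :
  (0 < vdeg u)%N <-> exists i, ~~ hor_index (u i).
Proof.
rewrite -vdeg_card; split=> [/card_gt0P[i]|[i hi]]; first by rewrite inE; exists i.
by apply/card_gt0P; exists i; rewrite inE.
Qed.

Definition frame_prod k (t u : {ffun 'I_k -> coord}) p :=
  \prod_(i < k) adapted_frame Y (t i) (u i) p.

Lemma frame_prod_refl k (u : {ffun 'I_k -> coord}) p : frame_prod u u p = 1.
Proof.
rewrite /frame_prod big1// => i _.
by case: (u i) => [a|A] /=; rewrite eqxx.
Qed.

Lemma frame_prod_vertical k (t u : {ffun 'I_k -> coord}) p i :
  frame_prod t u p != 0 -> ~~ hor_index (t i) -> u i = t i.
Proof.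
move=> h ti; apply/eqP; apply: contraNT h => uti; rewrite /frame_prod (bigD1 i)//=.
case E : (t i) ti uti => [//|A] _ /negPf /= ->; by rewrite mul0r.
Qed.

(** D_a is d/dx^a plus fibre directions, whereas d/dpsi^A is unchanged. Hence the change of frame
    only adds fibre indices, and it is unitriangular for the vertical degree. *)
Lemma frame_prod_vdeg k (t u : {ffun 'I_k -> coord}) p :
  frame_prod t u p != 0 -> u <> t -> (vdeg t < vdeg u)%N.
Proof.
move=> h ut.
have [i uti] : exists i, u i <> t i.
  by apply: contrapT => nE; apply: ut; apply/ffunP => i; apply: contrapT => ?; apply: nE; exists i.
rewrite -!vdeg_card; apply: proper_card; apply/properP; split.
  apply/fintype.subsetP => j; rewrite !inE => tj.
  by rewrite (frame_prod_vertical h tj).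
exists i; rewrite !inE; last first.
  by apply/negP => ti; apply: uti; exact: frame_prod_vertical h ti.
apply: contraT => /negPn ui; exfalso; apply: uti.
have ti : hor_index (t i).
  apply: contraT => ti; have := frame_prod_vertical h ti => E.
  by move: ui; rewrite E (negPf ti).
move: h; rewrite /frame_prod (bigD1 i)//= mulf_eq0 negb_or => /andP[+ _].
case: (t i) ti => // a _; case: (u i) ui => // b _ /=.
by have [->//|_] := eqVneq b a; rewrite eqxx.
Qed.

Lemma frame_prod_vdeg_le k (t u : {ffun 'I_k -> coord}) p :
  frame_prod t u p != 0 -> (vdeg t <= vdeg u)%N.
Proof.
have [->//|/eqP ut] := eqVneq u t; by move=> h; exact/ltnW/(frame_prod_vdeg h).
Qed.

Lemma adapted_single k (w : diff_form R coord k) t p :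
  (forall u, u <> t -> frame_prod t u p != 0 -> w u p = 0) ->
  adapted_components Y w t p = w t p.
Proof.
move=> hw; rewrite /adapted_components /substitute.
rewrite -(fsbig_widen [set t])//; last first.
  move=> u [_ /= ut]; rewrite /preimage /=.
  have -> : \prod_(i < k) adapted_frame Y ([ffun=> t i] (@ord0 0)) (u i) p = frame_prod t u p.
    by apply: eq_bigr => i _; rewrite ffunE.
  have [->|h] := eqVneq (frame_prod t u p) 0; first by rewrite mulr0.
  by rewrite hw ?mul0r.
rewrite fsbig_set1.
have -> : \prod_(i < k) adapted_frame Y ([ffun=> t i] (@ord0 0)) (t i) p = frame_prod t t p.
  by apply: eq_bigr => i _; rewrite ffunE.
by rewrite frame_prod_refl mulr1.
Qed.

Lemma adapted_finite k (F : {fset coord}) (w : diff_form R coord k) t p :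
  (forall u : {ffun 'I_k -> coord}, (exists i, u i \notin F) -> w u p = 0) ->
  adapted_components Y w t p =
  \sum_(v : {ffun 'I_k -> F}) w (valf v) p * frame_prod t (valf v) p.
Proof.
move=> hw; rewrite /adapted_components /substitute (fsum_valf (F := F)).
  apply: eq_bigr => v _; congr (_ * _).
  by apply: eq_bigr => i _; rewrite [X in adapted_frame Y X]ffunE.
by move=> u /hw ->; rewrite mul0r.
Qed.

(** Descending induction on the vertical degree of [u]: once all components of higher vertical
    degree vanish, the component at [u] equals the adapted one, which is zero by the bidegree. *)
Lemma bidegree_vanish (U : set pt) r s k (w : diff_form R coord k) u p :
  bidegree U Y r s w -> U p -> (s < vdeg u)%N -> w u p = 0.
Proof.
move=> bw Up; have [d] := ubnP (k - vdeg u); elim: d => // d ih in u *.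
move=> hd su; rewrite -(@adapted_single k w u p).
  by apply: bw => //; rewrite vdeg_card; apply/eqP => -[_ E]; rewrite E ltnn in su.
move=> u' uu' /frame_prod_vdeg/(_ uu') lt; apply: ih; last exact: ltn_trans lt.
have : (vdeg u' <= k)%N by rewrite -[leqRHS](hdeg_card u') leq_addl.
by move=> ?; move: hd lt; lia.
Qed.

End HorizontalDifferential.

(** * Existence of a potential *)

Section ExistencePotential.
Variables (R : realType) (n : nat) (I : choiceType).
Local Notation coord := ('I_n.+1 + I)%type.
Local Notation pt := (cspace R coord).
Variables (Y : 'I_n.+1 -> I -> pt -> R) (p0 : pt) (S0 : {fset coord}) (e0 : R).
Local Notation V := (coordinate_box S0 e0 p0).
Hypothesis lY : forall a A, local_function V (Y a A).

Let oV : open V. Proof. exact: coordinate_box_open. Qed.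

Lemma local_adapted_frame (k l : coord) : local_function V (adapted_frame Y k l).
Proof.
case: k => [a|A] /=; last exact: local_cst.
by case: l => [b|B] /=; [exact: local_cst|exact: lY].
Qed.

(** Pigeonhole, with n+2 slots and n+1 base coordinates. This is what removes the endpoint term of
    the fibre homotopy. *)
Lemma horizontal_repeat (t : {ffun 'I_n.+2 -> coord}) :
  vdeg t = 0%N -> exists i j, i != j /\ t i = t j.
Proof.
move=> t0; pose f (i : 'I_n.+2) : 'I_n.+1 := if t i is inl a then a else ord0.
have tE i : t i = inl (f i).
  rewrite /f; case E : (t i) => [//|A].
  have : (0 < vdeg t)%N by apply/vdeg_gt0; exists i; rewrite E.
  by rewrite t0.
have : ~ injective f by move=> /leq_card; rewrite !card_ord ltnn.
move=> nf; apply: contrapT => nE; apply: nf => i j fij.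
apply: contrapT => ij; apply: nE; exists i, j; split; first exact/eqP.
by rewrite !tE fij.
Qed.

(** The adapted components are used, not the coordinate ones, because each dpsi^A contributes d_h
    psi^A to the (k, 0) part. For a horizontal form both kinds of components agree. *)
Definition horizontal_part k (w : diff_form R coord k) : diff_form R coord k :=
  fun t p => if [forall i, hor_index (t i)] then adapted_components Y w t p else 0.

Lemma exists_potential (sigma : diff_form R coord n.+2) :
  local_form V sigma -> bidegree V Y n 2 sigma ->
  form_eq V (de_rham sigma) (fun _ _ => 0) ->
  exists chi l, potential V Y sigma chi l.
Proof.
move=> ls bs ds; have [lsig asig _] := ls.
pose c (l : coord) := ~~ hor_index l.
have [F0 [vF0 dF0]] := local_form_finite ls.
pose F := (F0 `|` [fset x in codom (@inl 'I_n.+1 I)])%fset.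
have F0F : {subset F0 <= F} by move=> x xF; rewrite inE xF.
have inlF a : inl a \in F by rewrite inE; apply/orP; right; rewrite inE; exact: codom_f.
have vF : vanishes_outside V F sigma by exact: vanishes_outside_sub vF0.
have dF u : depends_on V F (sigma u) by exact: depends_on_sub (dF0 u).
pose rho := homotopy p0 c F sigma.
have lrho : local_form V rho by exact: homotopy_local_form.
have [lr ar _] := lrho.
have vrho : vanishes_outside V F rho.
  move=> u p Vp [i iF]; apply: big1 => l _.
  rewrite (ray_integral_zero _ _ _ Vp) ?mulr0// => q Vq.
  by apply: vF => //; exists (lift ord0 i); rewrite ins_lift.
have drho t p : V p -> de_rham rho t p = sigma t p.
  move=> Vp; rewrite (de_rham_homotopy c t ls vF dF ds Vp).
  have [t0|t0] := posnP (moved_degree c t); last by rewrite expr0n gtn_eqF// mul0r subr0.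
  have [i [j [ij tij]]] := horizontal_repeat t0.
  have V0 : V (scale p0 c 0 p) by apply: scale_box => //; rewrite lexx ler01.
  by rewrite (antisymmetric_repeat asig V0 ij tij) mulr0 subr0.
(* The contracted vector is vertical, so a component of [rho] of vertical degree at least 2 comes
   from components of [sigma] of degree at least 3. *)
have rho2 u p : V p -> (1 < vdeg u)%N -> rho u p = 0.
  move=> Vp u2; rewrite /rho /homotopy; apply: big1 => l cl.
  rewrite (ray_integral_zero _ _ _ Vp) ?mulr0// => q Vq.
  apply: (bidegree_vanish bs Vq).
  by rewrite /vdeg (moved_degreeD1 _ _ ord0) ins_at omit_ins -/(c l) cl.
have vrho' p : V p -> forall u : {ffun 'I_n.+1 -> coord},
    (exists i, u i \notin F) -> rho u p = 0.
  by move=> Vp u; exact: vrho.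
pose l := horizontal_part rho.
have hor0 (t : {ffun 'I_n.+1 -> coord}) : [forall i, hor_index (t i)] = (vdeg t == 0%N) :> bool.
  apply/forallP/eqP => [h|h i].
    by apply/eqP; rewrite -leqn0 leqNgt; apply/negP => /vdeg_gt0[i]; rewrite h.
  apply: contraT => hi; have : (0 < vdeg t)%N by apply/vdeg_gt0; exists i.
  by rewrite h.
have lfin (t : {ffun 'I_n.+1 -> coord}) p : V p -> l t p = if vdeg t == 0%N then
    \sum_(v : {ffun 'I_n.+1 -> F}) rho (valf v) p * frame_prod Y t (valf v) p else 0.
  move=> Vp; rewrite /l /horizontal_part hor0; case: ifP => // _.
  by apply: adapted_finite; exact: vrho'.
have ll : local_form V l.
  apply: (@local_form_intro _ _ _ _ F).
  - move=> t; apply: (local_eqon oV (f := fun p => if vdeg t == 0%N then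
      \sum_(v : {ffun 'I_n.+1 -> F}) rho (valf v) p * frame_prod Y t (valf v) p else 0)).
      by move=> p /lfin ->.
    case: (vdeg t == 0%N); last exact: local_cst.
    apply: local_sum => // v _ _; apply: localM => //.
    by apply: local_prod => // i _ _; exact: local_adapted_frame.
  - move=> s t p Vp; rewrite !lfin//.
    have -> : vdeg [ffun i => t (s i)] = vdeg t.
      rewrite /vdeg /moved_degree [RHS](reindex_inj (@perm_inj _ s)) /=.
      by apply: eq_bigr => i _; rewrite ffunE.
    case: ifP => _; last by rewrite mulr0.
    rewrite -(antisymmetric_eval F (fun a b => adapted_frame Y a b p) s t ar Vp).
    apply: eq_bigr => v _; congr (_ * _); apply: eq_bigr => i _.
    by rewrite [X in adapted_frame Y X]ffunE.
  - move=> u p Vp [i iF]; rewrite lfin// -hor0; case: ifP => // /forallP/(_ i).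
    by case: (u i) iF => // a; rewrite inlF.
have l1 (u : {ffun 'I_n.+1 -> coord}) p : V p -> (0 < vdeg u)%N -> l u p = 0.
  by move=> Vp u1; rewrite lfin// gtn_eqF.
have adl0 (t : {ffun 'I_n.+1 -> coord}) p : V p -> (0 < vdeg t)%N -> adapted_components Y l t p = 0.
  move=> Vp t0; rewrite adapted_single => [|u _ /frame_prod_vdeg_le h]; first exact: l1.
  by apply: l1 => //; exact: leq_trans h.
have adlt (t : {ffun 'I_n.+1 -> coord}) p : V p -> vdeg t = 0%N -> adapted_components Y l t p = adapted_components Y rho t p.
  move=> Vp t0; rewrite adapted_single => [|u ut /frame_prod_vdeg/(_ ut) h].
    by rewrite /l /horizontal_part hor0 t0 eqxx.
  by apply: l1 => //; exact: leq_ltn_trans h.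
pose chi : diff_form R coord n.+1 := fun t p => rho t p - l t p.
have vl p : V p -> forall u : {ffun 'I_n.+1 -> coord},
    (exists i, u i \notin F) -> l u p = 0.
  move=> Vp u [i iF]; rewrite lfin// -hor0; case: ifP => // /forallP/(_ i).
  by case: (u i) iF => // a; rewrite inlF.
have lchi : local_form V chi.
  apply: (@local_form_intro _ _ _ _ F).
  - by move=> t; apply: localB => //; case: ll.
  - move=> s t p Vp; rewrite /chi ar//; case: ll => _ -> // _.
    by rewrite mulrBr.
  - by move=> u p Vp h; rewrite /chi vrho'// vl// subr0.
exists chi, l; split; [split => //|split => //|].
- move=> t ht p Vp.
  have t1 : vdeg t != 1%N.
    apply: contraNneq ht => t1; rewrite vdeg_card t1.
    by have := hdeg_card t; rewrite t1 addn1 => -[->].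
  have vchi (u : {ffun 'I_n.+1 -> coord}) : (exists i, u i \notin F) -> chi u p = 0.
    by move=> h; rewrite /chi vrho'// vl// subr0.
  rewrite (adapted_finite _ _ vchi).
  have [t0|t0] := posnP (vdeg t).
    rewrite /chi; under eq_bigr do rewrite mulrBl.
    rewrite sumrB -(adapted_finite _ t (vrho' p Vp)) -(adapted_finite _ t (vl p Vp)).
    by rewrite adlt// subrr.
  apply: big1 => v _; have [->|h] := eqVneq (frame_prod Y t (valf v) p) 0.
    by rewrite mulr0.
  have := frame_prod_vdeg_le h => h'.
  rewrite /chi rho2 ?l1 ?subr0 ?mul0r//; first exact: leq_trans h'.
  by apply: leq_trans h'; rewrite ltn_neqAle eq_sym t1.
- move=> t ht p Vp; apply: adl0 => //; rewrite lt0n; apply: contraNneq ht => t0.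
  by rewrite vdeg_card t0; have := hdeg_card t; rewrite t0 addn0 => ->.
- have E : (fun t p => chi t p + l t p) = rho.
    by apply/funext => t; apply/funext => p; rewrite /chi subrK.
  by move=> t p Vp; rewrite E drho.
Qed.

End ExistencePotential.

(** * Jets *)

Lemma fsum_seq (V : nmodType) (X : choiceType) (r : seq X) (G : X -> V) :
  uniq r -> (forall x, x \notin r -> G x = 0) ->
  \sum_(x \in [set: X]) G x = \sum_(x <- r) G x.
Proof.
move=> ur G0; rewrite (fsbig_seq _ _ ur); apply/esym/fsbig_widen => // x [_ /= xr].
by apply: G0; exact/negP.
Qed.

Lemma fsum_inj (V : nmodType) (T : finType) (X : choiceType) (h : T -> X) (G : X -> V) :
  injective h -> (forall x, (forall v, h v != x) -> G x = 0) ->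
  \sum_(x \in [set: X]) G x = \sum_(v : T) G (h v).
Proof.
move=> hi G0; rewrite (@fsum_seq _ _ (map h (enum T))).
- by rewrite big_map big_enum.
- by rewrite map_inj_uniq ?enum_uniq.
- move=> x xr; apply: G0 => v; apply: contraNneq xr => <-.
  by rewrite map_f// mem_enum.
Qed.

(* Exchanging the two distinguished slots flips the sign of every term. *)
Lemma swap_cancel (R : realDomainType) (m : nat) (X : finType)
    (g : 'I_m -> {ffun 'I_m -> X} -> R) (S : 'I_m -> 'I_m -> X -> R)
    (T : 'I_m -> X -> R) :
  (forall j i (u : {ffun 'I_m -> X}), i != j -> g i [ffun x => u (tperm j i x)] = - g j u) ->
  (forall j i x, S j i x = S i j x) ->
  \sum_j \sum_(i | i != j) \sum_(u : {ffun 'I_m -> X})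
    g j u * (S j i (u i) * \prod_(x | (x != j) && (x != i)) T x (u x)) = 0.
Proof.
move=> gA SS; pose Z j i := \sum_(u : {ffun 'I_m -> X})
  g j u * (S j i (u i) * \prod_(x | (x != j) && (x != i)) T x (u x)).
rewrite -/(\sum_j \sum_(i | i != j) Z j i).
have ZA j i : i != j -> Z i j = - Z j i.
  move=> ij; rewrite /Z.
  pose h (u : {ffun 'I_m -> X}) : {ffun 'I_m -> X} := [ffun x => u (tperm j i x)].
  rewrite (reindex_inj (h := h)); last first.
    by apply: (can_inj (g := h)) => u; apply/ffunP => x; rewrite !ffunE tpermK.
  rewrite -sumrN; apply: eq_bigr => u _; rewrite /h gA// mulNr; congr (- (_ * _)).
  rewrite ffunE tpermL SS; congr (_ * _).
  rewrite (eq_bigl (fun x => (x != j) && (x != i))); last by move=> x; rewrite andbC.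
  apply: eq_bigr => x /andP[xj xi].
  by rewrite ffunE tpermD// eq_sym.
have E : \sum_j \sum_(i | i != j) Z j i = - \sum_j \sum_(i | i != j) Z j i.
  rewrite {1}(exchange_big_dep predT)//= -sumrN; apply: eq_bigr => j _.
  rewrite -sumrN [LHS](eq_bigl (fun i => i != j)); last by move=> i; rewrite eq_sym.
  by apply: eq_bigr => i ij; exact: ZA.
by apply/eqP; rewrite -[_ == 0](mulrn_eq0 _ 2) mulr2n {1}E addNr.
Qed.

(** Provides the alternating factor for the cancellation of second derivatives in
    [Dh_horizontalize], where slot [j] is occupied by the direction of differentiation. *)
Lemma omit_swap (R : realType) (K : choiceType) k (U : set (cspace R K))
    (w : diff_form R K k) (u : {ffun 'I_k.+1 -> K}) (i j : 'I_k.+1) p :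
  antisymmetric_on U w -> U p -> i != j ->
  (-1) ^+ i * w (omit [ffun x => u (tperm j i x)] i) p =
  - ((-1) ^+ j * w (omit u j) p).
Proof.
move=> aw Up ij; pose tp := tperm j i.
have ne x : tp (lift i x) != j.
  by rewrite -(inj_eq (@perm_inj _ tp)) tpermK tpermL eq_sym neq_lift.
pose f x : 'I_k := odflt x (unlift j (tp (lift i x))).
have fE x : lift j (f x) = tp (lift i x).
  by rewrite /f; case: unliftP => [y ->//|E]; have := ne x; rewrite E eqxx.
have fI : injective f.
  by move=> x y /(congr1 (lift j)); rewrite !fE => /perm_inj/lift_inj.
(* The transposition carries the slots other than [i] to those other than [j]. The induced
   permutation of the [k] remaining slots has sign (-1)^(i+j+1), since a transposition is odd. *)
have tpE : tp = lift_perm i j (perm fI).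
  apply/permP => x; case: (unliftP i x) => [y ->|->].
    by rewrite lift_perm_lift [perm fI y]permE fE.
  by rewrite lift_perm_id tpermR.
have sE : true = odd i (+) odd j (+) odd_perm (perm fI).
  by rewrite -odd_lift_perm -tpE odd_tperm eq_sym ij.
have -> : omit [ffun x => u (tperm j i x)] i = [ffun x => omit u j (perm fI x)].
  by apply/ffunP => x; rewrite !ffunE [perm fI x]permE fE.
rewrite aw// mulrA -mulNr; congr (_ * _).
rewrite -(signr_odd R i) -(signr_odd R j); move: sE.
by case: (odd i); case: (odd j); case: (odd_perm _) => //= _; rewrite !(expr0, expr1); ring.
Qed.

Section JetVectors.
Variables (R : realType) (n : nat) (I : choiceType).
Local Notation coord := ('I_n + I)%type.
Local Notation jfib := (I * {ffun 'I_n -> nat})%type.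
Local Notation jcoord := ('I_n + jfib)%type.
Local Notation pt := (cspace R coord).
Local Notation jpt := (cspace R jcoord).
Local Notation jproj := (@jet_proj R n I).
Local Notation jtot := (@jet_total R n I).

Definition jet_emb (l : coord) : jcoord :=
  match l with inl a => inl a | inr A => inr (A, [ffun=> 0%N]) end.

Lemma jet_emb_inj : injective jet_emb.
Proof. by move=> [a|A] [b|B] //= => [[->]|[->]]. Qed.

Lemma jet_projE (q : jpt) l : jproj q l = q (jet_emb l).
Proof. by case: l. Qed.

Lemma jet_proj_dfwith (q : jpt) l x : jproj (dfwith q (jet_emb l) x) = dfwith (jproj q) l x.
Proof.
apply/funext => k; rewrite jet_projE; have [<-|lk] := eqVneq l k.
  by rewrite !dfwithin.
by rewrite !dfwithout ?jet_projE// inj_eq//; exact: jet_emb_inj.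
Qed.

Lemma jet_proj_dfwithN (q : jpt) m x : (forall l, jet_emb l != m) ->
  jproj (dfwith q m x) = jproj q.
Proof.
by move=> h; apply/funext => k; rewrite !jet_projE dfwithout// eq_sym.
Qed.

Lemma has_pd_jet (f : pt -> R) l (q : jpt) d :
  has_pd l f (jproj q) d -> has_pd (jet_emb l) (f \o jproj) q d.
Proof.
rewrite /has_pd jet_projE => h.
have -> : (fun t => (f \o jproj) (dfwith q (jet_emb l) t)) =
  (fun t => f (dfwith (jproj q) l t)).
  by apply/funext => t; rewrite /= jet_proj_dfwith.
exact: h.
Qed.

Lemma has_pd_jetN (f : pt -> R) m (q : jpt) : (forall l, jet_emb l != m) ->
  has_pd m (f \o jproj) q 0.
Proof.
move=> h; rewrite /has_pd.
have -> : (fun t => (f \o jproj) (dfwith q m t)) = cst (f (jproj q)).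
  by apply/funext => t; rewrite /= jet_proj_dfwithN.
exact: is_derive_cst.
Qed.

Lemma pd_jet (f : pt -> R) l (q : jpt) : pd (jet_emb l) (f \o jproj) q = pd l f (jproj q).
Proof.
rewrite /pd jet_projE; congr (derive1 _ _); apply/funext => t.
by rewrite /= jet_proj_dfwith.
Qed.

Lemma jet_proj_continuous : continuous jproj.
Proof.
move=> q; apply: (@cvg_ptws R coord (jproj @ q) (@fmap_filter _ _ jproj (nbhs q) _) (jproj q)) => l.
suff : (fun q' : jpt => q' (jet_emb l)) @ q --> q (jet_emb l).
  rewrite -jet_projE; have -> : (fun q' : jpt => q' (jet_emb l)) = (fun q' => jproj q' l).
    by apply/funext => q'; rewrite jet_projE.
  by [].
exact: ptws_proj_cvg.
Qed.

Lemma jet_over_open (U : set pt) : open U -> open (jet_over U).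
Proof. by move=> oU; apply: open_comp => // q _; exact: jet_proj_continuous. Qed.

Lemma emb_cases (m : jcoord) : (exists l, m = jet_emb l) \/ forall l, jet_emb l != m.
Proof.
have [[l ->]|h] := pselect (exists l, m = jet_emb l); first by left; exists l.
by right => l; apply/eqP => E; apply: h; exists l.
Qed.

Definition jet_deps (S : {fset coord}) : {fset jcoord} := [fset jet_emb l | l in S]%fset.

Lemma depends_on_jet (U : set pt) S f : depends_on U S f ->
  depends_on (jet_over U) (jet_deps S) (f \o jproj).
Proof.
move=> hS q r Wq Wr qr; apply: hS => // l lS; rewrite !jet_projE; apply: qr.
exact: in_imfset.
Qed.

Lemma local_jet (U : set pt) f : open U -> local_function U f ->
  local_function (jet_over U) (f \o jproj).
Proof.
move=> oU lf; split.
  by have [S hS] := local_depends lf; exists (jet_deps S); exact: depends_on_jet.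
pose C (g : jpt -> R) := exists f, local_function U f /\ g = f \o jproj.
apply: (@smooth_coind _ _ (jet_over U) C); last by exists f.
- move=> _ [{}f [{}lf ->]] q Wq; split=> [m|].
    have [[l ->]|h] := emb_cases m.
      exact: (has_pd_derivable (has_pd_jet (local_has_pd l lf Wq))).
    exact: (has_pd_derivable (has_pd_jetN f q h)).
  exact: (cvg_comp jproj f (@jet_proj_continuous q) (local_continuous lf Wq)).
- move=> _ m [{}f [{}lf ->]]; have [[l ->]|h] := emb_cases m.
    exists (pd l f); split; first exact: local_pd.
    by apply/funext => q; rewrite pd_jet.
  exists (fun=> 0); split; first exact: local_cst.
  by apply/funext => q; exact: (has_pd_val (has_pd_jetN f q h)).
Qed.

(** The components of T_a for [c = inl a]. A fibre index gives zero, since horizontalized forms have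
    no fibre components. *)
Definition jet_vector (c : jcoord) (l : coord) : jpt -> R :=
  fun q => if c is inl a then total_field jtot a (jet_emb l) q else 0.

Lemma tder_jet (U : set pt) (F : {fset coord}) f a q : open U ->
  depends_on U F f -> jet_over U q ->
  tder jtot a (f \o jproj) q =
  \sum_(l : F) jet_vector (inl a) (val l) q * pd (val l) f (jproj q).
Proof.
move=> oU hF Wq; have oW := jet_over_open oU.
rewrite /tder (vderE oW _ (depends_on_jet hF) Wq) /jet_deps.
rewrite big_imfset /=; last by move=> l l' _ _; exact: jet_emb_inj.
rewrite big_seq_fsetE /=; apply: eq_bigr => l _.
by rewrite pd_jet.
Qed.

Lemma local_total_field (W : set jpt) a m : open W -> local_function W (total_field jtot a m).
Proof.
by move=> oW; case: m => [b|AJ]; [exact: local_cst|exact: local_coord].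
Qed.

Lemma local_jet_vector (W : set jpt) c l : open W -> local_function W (jet_vector c l).
Proof.
by move=> oW; case: c => [a|AJ]; [exact: local_total_field|exact: local_cst].
Qed.

Definition jet_vector2 (c c' : jcoord) (l : coord) (q : jpt) : R :=
  if c is inl a then tder jtot a (jet_vector c' l) q else 0.

Lemma tder_cst a (x : R) (q : jpt) : tder jtot a (fun=> x) q = 0.
Proof.
exact: (derivation_cst (derivation_vder openT (total_field jtot a) (Logic.I : [set: jpt] q))).
Qed.

(** In the only nonzero case both sides are the coordinate psi^B_{ab}, and multi-indices do not
    remember the order of differentiation. *)
Lemma jet_vector2C c c' l q : jet_vector2 c c' l q = jet_vector2 c' c l q.
Proof.
have h a (B : I) b : tder jtot a (jet_vector (inl b) (inr B)) q =
    q (inr (B, [ffun x => [ffun y => [ffun=> 0] y + (y == b)] x + (x == a)]%N)).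
  exact: vder_coordinate.
case: c c' => [a|AJ] [b|BJ] //=; last 2 first.
- exact: tder_cst.
- by rewrite tder_cst.
case: l => [d|B]; last first.
  rewrite !h; congr (q (inr (_, _))).
  by apply/ffunP => x; rewrite !ffunE !add0n addnC.
by rewrite /jet_vector /= !tder_cst.
Qed.

End JetVectors.

(** * Horizontalization *)

Lemma big_lift_cond (R : Type) (idx : R) (op : Monoid.com_law idx) k (j : 'I_k.+1)
    (P : pred 'I_k.+1) (F : 'I_k.+1 -> R) :
  \big[op/idx]_(i | (i != j) && P i) F i =
  \big[op/idx]_(i < k | P (lift j i)) F (lift j i).
Proof.
rewrite big_mkcond (bigD1_ord j)//= eqxx /= Monoid.mul1m [RHS]big_mkcond.
by apply: eq_bigr => i _; rewrite eq_sym neq_lift.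
Qed.

Lemma big_lift (R : Type) (idx : R) (op : Monoid.com_law idx) k (j : 'I_k.+1)
    (F : 'I_k.+1 -> R) :
  \big[op/idx]_(i | i != j) F i = \big[op/idx]_(i < k) F (lift j i).
Proof.
by rewrite -(big_lift_cond op j xpredT); apply: eq_bigl => i; rewrite andbT.
Qed.

Section HorizontalizedForms.
Variables (R : realType) (n : nat) (I : choiceType).
Local Notation coord := ('I_n + I)%type.
Local Notation jfib := (I * {ffun 'I_n -> nat})%type.
Local Notation jcoord := ('I_n + jfib)%type.
Local Notation pt := (cspace R coord).
Local Notation jpt := (cspace R jcoord).
Local Notation jproj := (@jet_proj R n I).
Local Notation jtot := (@jet_total R n I).
Local Notation Hpull w := (horizontalize (pullback jproj w)).

Lemma Dh_coordinate (m : jcoord) (t : {ffun 'I_1 -> jcoord}) (q : jpt) :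
  Dh (coordinate m) t q = if t ord0 is inl a then total_field jtot a m q else 0.
Proof. exact: hdiff_coordinate. Qed.

Definition emb_tuple k (u : {ffun 'I_k -> coord}) : {ffun 'I_k -> jcoord} :=
  [ffun i => jet_emb (u i)].

Lemma pd_jet_proj_coord (m : jcoord) l (q : jpt) :
  pd m (fun q' => jproj q' l) q = (m == jet_emb l)%:R.
Proof.
have -> : (fun q' : jpt => jproj q' l) = (fun q' => q' (jet_emb l)).
  by apply/funext => q'; rewrite jet_projE.
exact/has_pd_val/has_pd_coord.
Qed.

Lemma pullback_emb k (w : diff_form R coord k) u (q : jpt) :
  pullback jproj w (emb_tuple u) q = w u (jproj q).
Proof.
rewrite /pullback -(fsbig_widen [set u])//; last first.
  move=> u' [_ /= uu']; rewrite /preimage /=.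
  have [i ui] : exists i, u' i != u i.
    apply: contrapT => nE; apply: uu'; apply/ffunP => i; apply/eqP.
    by apply: contrapT => /negP h; apply: nE; exists i.
  rewrite (bigD1 i)//= pd_jet_proj_coord ffunE inj_eq; last exact: jet_emb_inj.
  by rewrite eq_sym (negPf ui) mul0r mulr0.
rewrite fsbig_set1 big1 ?mulr1// => i _.
by rewrite pd_jet_proj_coord ffunE eqxx.
Qed.

Lemma pullback_notemb k (w : diff_form R coord k) (x : {ffun 'I_k -> jcoord}) (q : jpt) :
  (forall u, w u (jproj q) != 0 -> emb_tuple u != x) -> pullback jproj w x q = 0.
Proof.
move=> h; apply: fsbig1 => u _.
have [->|wu] := eqVneq (w u (jproj q)) 0; first by rewrite mul0r.
have [i xi] : exists i, x i != jet_emb (u i).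
  apply: contrapT => nE; have /negP := h u wu; apply; apply/eqP/ffunP => i.
  rewrite ffunE; apply/eqP; apply: contrapT => /negP h'; apply: nE; exists i.
  by rewrite eq_sym.
by rewrite (bigD1 i)//= pd_jet_proj_coord (negPf xi) mul0r mulr0.
Qed.

(** The pullback along the projection is supported on the tuples of order-zero coordinates, so the
    sums of [substitute] and [pullback] collapse into one: the value of [w] on the vectors T_a
    labelled by [t]. *)
Lemma horizontalizeE k (F : {fset coord}) (w : diff_form R coord k) (t : {ffun 'I_k -> jcoord}) (q : jpt) :
  (forall u : {ffun 'I_k -> coord}, (exists i, u i \notin F) -> w u (jproj q) = 0) ->
  Hpull w t q = \sum_(v : {ffun 'I_k -> F}) w (valf v) (jproj q) *
    \prod_(i < k) jet_vector (t i) (valf v i) q.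
Proof.
move=> w0; rewrite /horizontalize /substitute.
rewrite (@fsum_inj _ _ _ (fun v : {ffun 'I_k -> F} => emb_tuple (valf v))).
- apply: eq_bigr => v _; rewrite pullback_emb; congr (_ * _).
  apply: eq_bigr => i _; have -> : emb_tuple (valf v) i = jet_emb (valf v i) by rewrite ffunE.
  by rewrite Dh_coordinate [X in if X is inl _ then _ else _]ffunE.
- move=> v v' /ffunP e; apply: valf_inj; apply/ffunP => i; apply: jet_emb_inj.
  by have := e i; rewrite [LHS]ffunE [RHS]ffunE.
- move=> x hx; rewrite pullback_notemb ?mul0r// => u wu.
  have [v <-] : exists v : {ffun 'I_k -> F}, valf v = u.
    apply: valf_onto => i; apply: contrapT => /negP iF.
    by move: wu; rewrite w0 ?eqxx//; exists i.
  exact: hx.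
Qed.

Lemma horizontalize_vertical k (F : {fset coord}) (w : diff_form R coord k) (t : {ffun 'I_k -> jcoord}) (q : jpt) :
  (forall u : {ffun 'I_k -> coord}, (exists i, u i \notin F) -> w u (jproj q) = 0) ->
  (exists i, ~~ hor_index (t i)) -> Hpull w t q = 0.
Proof.
move=> w0 [i ti]; rewrite (horizontalizeE _ w0); apply: big1 => v _.
rewrite (bigD1 i)//= {1}/jet_vector.
by case: (t i) ti => // AJ _; rewrite mul0r mulr0.
Qed.

Section OpenDomain.
Variable U : set pt.
Hypothesis oU : open U.
Local Notation W := (jet_over U).

Let oW : open W. Proof. exact: jet_over_open. Qed.

Definition jet_prod k (t : {ffun 'I_k -> jcoord}) (u : {ffun 'I_k -> coord}) (q : jpt) :=
  \prod_(i < k) jet_vector (t i) (u i) q.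

Lemma local_jet_prod k (t : {ffun 'I_k -> jcoord}) u : local_function W (jet_prod t u).
Proof. by apply: local_prod => // i _ _; exact: local_jet_vector. Qed.

Lemma horizontalize_eqon k F (w : diff_form R coord k) (t : {ffun 'I_k -> jcoord}) : vanishes_outside U F w ->
  eqon W (Hpull w t) (fun q => \sum_(v : {ffun 'I_k -> F})
    w (valf v) (jproj q) * jet_prod t (valf v) q).
Proof. by move=> vw q Wq; rewrite (horizontalizeE (F := F))// => u; exact: vw. Qed.

Lemma local_horizontalize k (w : diff_form R coord k) (t : {ffun 'I_k -> jcoord}) : local_form U w ->
  local_function W (Hpull w t).
Proof.
move=> lw; have [F [vF _]] := local_form_finite lw; have [lw1 _ _] := lw.
apply: (local_eqon oW (eqon_sym (horizontalize_eqon t vF))).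
apply: local_sum => // v _ _; apply: localM => //; last exact: local_jet_prod.
exact: (local_jet oU (lw1 (valf v))).
Qed.

Lemma horizontalize_local_form k (w : diff_form R coord k) : local_form U w ->
  local_form W (Hpull w).
Proof.
move=> lw; have [F [vF _]] := local_form_finite lw; have [_ aw _] := lw.
apply: (@local_form_intro _ _ _ _ [fset x in codom (@inl 'I_n jfib)]%fset).
- by move=> t; exact: local_horizontalize.
- move=> s t q Wq; rewrite !(horizontalize_eqon _ vF)//.
  rewrite -(antisymmetric_eval F (fun c l => jet_vector c l q) s t aw Wq).
  apply: eq_bigr => v _; congr (_ * _); apply: eq_bigr => i _.
  by rewrite [X in jet_vector X]ffunE.
- move=> u q Wq [i iF]; apply: (horizontalize_vertical (F := F)).
    by move=> u'; exact: vF.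
  exists i; case: (u i) iF => // a; rewrite inE => /negP[].
  exact: codom_f.
Qed.

Lemma jet_derivation_sum k F (w : diff_form R coord k) (t : {ffun 'I_k -> jcoord}) q D : local_form U w ->
  vanishes_outside U F w -> W q -> derivation_at W q D ->
  D (Hpull w t) = \sum_(v : {ffun 'I_k -> F}) (
    D (w (valf v) \o jproj) * jet_prod t (valf v) q +
    w (valf v) (jproj q) * \sum_(j < k) D (jet_vector (t j) (valf v j)) *
      \prod_(i < k | i != j) jet_vector (t i) (valf v i) q).
Proof.
move=> [lw _ _] vF Wq hD; rewrite (derivation_eqon hD (horizontalize_eqon t vF)).
rewrite (derivation_sum oW hD); last first.
  move=> v _ _; apply: localM => //; last exact: local_jet_prod.
  exact: (local_jet oU (lw (valf v))).
apply: eq_bigr => v _.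
rewrite (derivationM hD (local_jet oU (lw (valf v))) (local_jet_prod t (valf v))).
congr (_ + _ * _).
by rewrite (derivation_prod oW hD)// => i; exact: local_jet_vector.
Qed.

Definition jet_tder (c : jcoord) (f : jpt -> R) (q : jpt) : R :=
  if c is inl a then tder jtot a f q else 0.

Lemma jet_tderE F f c q : depends_on U F f -> W q ->
  jet_tder c (f \o jproj) q =
  \sum_(l : F) jet_vector c (val l) q * pd (val l) f (jproj q).
Proof.
move=> hF Wq; case: c => [a|AJ]; first exact: (tder_jet _ oU hF Wq).
by rewrite /= big1// => l _; rewrite mul0r.
Qed.

Lemma pd_vanishes k F (w : diff_form R coord k) (u : {ffun 'I_k -> coord}) m p :
  vanishes_outside U F w -> U p -> (exists i, u i \notin F) -> pd m (w u) p = 0.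
Proof.
move=> vF Up uF; rewrite (pd_eqon (g := fun=> 0) _ oU _ Up).
  exact/has_pd_val/has_pd_cst.
by move=> p' Up'; apply: vF.
Qed.

Lemma de_rham_vanishes k F (w : diff_form R coord k) :
  vanishes_outside U F w -> (forall u, depends_on U F (w u)) ->
  vanishes_outside U F (de_rham w).
Proof.
move=> vF dF u p Up [i iF]; apply: big1 => j _.
have [ij|ij] := eqVneq i j.
  by rewrite -ij (depends_on_pd0 oU (dF _) iF Up) mulr0.
rewrite (pd_vanishes _ vF Up) ?mulr0//.
by case: (unliftP j i) => [i' E|E]; [exists i'; rewrite ffunE -E|rewrite E eqxx in ij].
Qed.

Lemma valf_ins k (F : {fset coord}) (j : 'I_k.+1) (l : F) (v : {ffun 'I_k -> F}) :
  valf (ins j l v) = ins j (val l) (valf v).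
Proof.
apply/ffunP => i; rewrite ffunE; case: (unliftP j i) => [i' ->|->].
  by rewrite !ins_lift ffunE.
by rewrite !ins_at.
Qed.

Lemma jet_prod_ins k (t : {ffun 'I_k.+1 -> jcoord}) j l u q :
  jet_prod t (ins j l u) q = jet_vector (t j) l q * jet_prod (omit t j) u q.
Proof.
rewrite /jet_prod (bigD1_ord j)//= ins_at; congr (_ * _).
by apply: eq_bigr => i _; rewrite ins_lift ffunE.
Qed.

(** By the Leibniz rule, derivatives of the coefficients of [w] assemble into [de_rham w], through
    T_a acting on functions of M; derivatives of the vectors T_a themselves cancel in pairs. *)
Lemma Dh_horizontalize k (w : diff_form R coord k) (t : {ffun 'I_k.+1 -> jcoord}) q (x0 : coord) :
  local_form U w -> W q -> Dh (Hpull w) t q = Hpull (de_rham w) t q.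
Proof.
move=> lw Wq; have [F0 [vF0 dF0]] := local_form_finite lw; have [_ aw _] := lw.
(* [x0] makes [F] nonempty, which supplies the filler value [y0] used in the cancellation below. *)
pose F := (F0 `|` [fset x0])%fset.
have F0F : {subset F0 <= F} by move=> x xF; rewrite inE xF.
have vF : vanishes_outside U F w by exact: vanishes_outside_sub vF0.
have dF u : depends_on U F (w u) by exact: depends_on_sub (dF0 u).
have x0F : x0 \in F by rewrite !inE eqxx orbT.
pose y0 : F := [` x0F]%fset.
rewrite /Dh hdiff_horizontal; last first.
  move=> u hu; apply: (horizontalize_vertical (F := F)) => //.
  by move=> u'; exact: vF.
rewrite (horizontalize_eqon t (de_rham_vanishes vF dF) Wq).
have E1 (j : 'I_k.+1) : (if t j is inl a then tder jtot a (Hpull w (omit t j)) q else 0) =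
    \sum_(v : {ffun 'I_k -> F}) jet_tder (t j) (w (valf v) \o jproj) q *
       jet_prod (omit t j) (valf v) q +
    \sum_(v : {ffun 'I_k -> F}) w (valf v) (jproj q) * \sum_(i < k)
       jet_vector2 (t j) (t (lift j i)) (valf v i) q *
       \prod_(x < k | x != i) jet_vector (t (lift j x)) (valf v x) q.
  rewrite /jet_tder /jet_vector2; case: (t j) => [a|AJ]; last first.
    rewrite !big1 ?addr0// => v _; last by rewrite mul0r.
    by rewrite big1 ?mulr0// => i _; rewrite mul0r.
  have D := derivation_vder oW (total_field jtot a) Wq.
  rewrite /tder (jet_derivation_sum _ lw vF Wq D) big_split /=; congr (_ + _).
  apply: eq_bigr => v _; congr (_ * _); apply: eq_bigr => i _.
  rewrite ffunE; congr (_ * _); apply: eq_bigr => x _; by rewrite ffunE.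
under eq_bigr do rewrite E1 mulrDr.
rewrite big_split /= [X in _ + X](_ : _ = 0) ?addr0; last first.
  (* [swap_cancel] runs over tuples with k+1 slots, while [w] takes only [k] of them. The vacant
     slot [j] is filled with the dummy [y0], and the indicator in [g] makes it count once. *)
  pose g (j : 'I_k.+1) (u : {ffun 'I_k.+1 -> F}) : R :=
    (u j == y0)%:R * ((-1) ^+ j * w (omit (valf u) j) (jproj q)).
  pose S (j i : 'I_k.+1) (l : F) := jet_vector2 (t j) (t i) (val l) q.
  pose T (i : 'I_k.+1) (l : F) := jet_vector (t i) (val l) q.
  have gA j i (u : {ffun 'I_k.+1 -> F}) : i != j ->
      g i [ffun x => u (tperm j i x)] = - g j u.
    move=> ij; rewrite /g ffunE tpermR -mulrN; congr (_ * _).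
    rewrite -(omit_swap (U := U) (valf u) aw Wq ij); congr (_ * w _ _).
    by apply/ffunP => x; rewrite !ffunE.
  have SS j i l : S j i l = S i j l by exact: jet_vector2C.
  rewrite -[RHS](swap_cancel T gA SS); apply: eq_bigr => j _.
  rewrite [RHS]exchange_big /= (sum_ins j) (bigD1 y0)//= [X in _ = _ + X]big1 ?addr0; last first.
    move=> l ly; apply: big1 => v _; apply: big1 => i _.
    by rewrite /g ins_at (negPf ly) !mul0r.
  rewrite mulr_sumr; apply: eq_bigr => v _.
  rewrite big_lift mulrA mulr_sumr; apply: eq_bigr => i _.
  rewrite /g ins_at eqxx mul1r valf_ins omit_ins; congr (_ * (_ * _)).
    by rewrite /S ins_lift ffunE.
  rewrite big_lift_cond; apply: eq_big => [x|x _].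
    by rewrite (inj_eq (@lift_inj _ j)).
  by rewrite /T ins_lift ffunE.
under [RHS]eq_bigr do rewrite mulr_suml.
rewrite [RHS]exchange_big /=; apply: eq_bigr => j _.
rewrite (sum_ins j) exchange_big /= mulr_sumr; apply: eq_bigr => v _.
rewrite (jet_tderE _ (dF _) Wq) mulr_suml mulr_sumr; apply: eq_bigr => l _.
rewrite valf_ins jet_prod_ins ins_at omit_ins.
by rewrite -!mulrA; congr (_ * _); rewrite mulrCA.
Qed.

End OpenDomain.
End HorizontalizedForms.

(** * Euler-Lagrange expressions *)

Section EulerLagrange.
Variables (R : realType) (n : nat) (I : choiceType).
Local Notation coord := ('I_n + I)%type.
Local Notation jfib := (I * {ffun 'I_n -> nat})%type.
Local Notation jcoord := ('I_n + jfib)%type.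
Local Notation pt := (cspace R coord).
Local Notation jpt := (cspace R jcoord).
Local Notation jproj := (@jet_proj R n I).
Local Notation jtot := (@jet_total R n I).
Local Notation Hpull w := (horizontalize (pullback jproj w)).

Definition mindex0 : {ffun 'I_n -> nat} := [ffun=> 0%N].
Definition mindex_add (J : {ffun 'I_n -> nat}) (a : 'I_n) : {ffun 'I_n -> nat} :=
  [ffun b => J b + (b == a)]%N.

Lemma mindex_add0 (a b : 'I_n) : mindex_add mindex0 a b = (b == a).
Proof. by rewrite !ffunE. Qed.

Lemma mindex_add0_inj : injective (mindex_add mindex0).
Proof.
move=> a b /ffunP/(_ a); rewrite !mindex_add0 eqxx.
by case: eqP => // -> .
Qed.

Lemma mindex_add0_neq0 a : mindex_add mindex0 a != mindex0.
Proof. by apply/eqP => /ffunP/(_ a); rewrite mindex_add0 eqxx ffunE. Qed.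

Lemma sum_mindex0 : (\sum_(a < n) mindex0 a = 0)%N.
Proof. by apply: big1 => a _; rewrite ffunE. Qed.

Lemma sum_mindex_add0 a : (\sum_(b < n) mindex_add mindex0 a b = 1)%N.
Proof.
rewrite (bigD1 a)//= mindex_add0 eqxx big1// => b ba.
by rewrite mindex_add0 (negPf ba).
Qed.

Lemma iter_tder_mindex0 (K : choiceType) (Z : 'I_n -> K -> cspace R ('I_n + K)%type -> R) f :
  iter_tder Z mindex0 f = f.
Proof.
rewrite /iter_tder; elim: (enum 'I_n) => //= a s ->.
by rewrite ffunE.
Qed.

Lemma iter_tder_mindex1 (K : choiceType) (Z : 'I_n -> K -> cspace R ('I_n + K)%type -> R) a f :
  iter_tder Z (mindex_add mindex0 a) f = tder Z a f.
Proof.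
rewrite /iter_tder.
have H s : uniq s -> foldr (fun b => iter (mindex_add mindex0 a b) (tder Z b)) f s =
    if a \in s then tder Z a f else f.
  elim: s => //= b s ih /andP[bs us]; rewrite (ih us) mindex_add0 inE eq_sym.
  have [->|ba] := eqVneq a b; last by [].
  by rewrite (negPf bs).
by rewrite H ?enum_uniq// mem_enum.
Qed.

Lemma iter_tder_eqon (K : choiceType) (W : set (cspace R ('I_n + K)%type)) Z J f g :
  open W -> eqon W f g -> eqon W (iter_tder Z J f) (iter_tder Z J g).
Proof.
move=> oW fg; rewrite /iter_tder; elim: (enum 'I_n) => //= a s ih.
by elim: (J a) => //= m ihm; exact: vder_eqon.
Qed.

Lemma tder_zero (K : choiceType) (Z : 'I_n -> K -> cspace R ('I_n + K)%type -> R) a :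
  tder Z a (fun=> 0) = (fun=> 0).
Proof.
apply/funext => q.
exact: (derivation_cst (derivation_vder openT (total_field Z a) (Logic.I : setT q))).
Qed.

Lemma iter_tder_zero (K : choiceType) (Z : 'I_n -> K -> cspace R ('I_n + K)%type -> R) J :
  iter_tder Z J (fun=> 0) = (fun=> 0).
Proof.
rewrite /iter_tder; elim: (enum 'I_n) => //= a s ->.
by elim: (J a) => //= m ->; exact: tder_zero.
Qed.

Lemma pd_jet_vector m c l (q : jpt) : pd m (jet_vector c l) q =
  (if c is inl a then (if l is inr B then m == inr (B, mindex_add mindex0 a) else false)
   else false)%:R.
Proof.
case: c => [a|AJ]; last exact: (has_pd_val (has_pd_cst m 0 q)).
case: l => [b|B]; first exact: (has_pd_val (has_pd_cst m ((b == a)%:R) q)).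
exact: (has_pd_val (has_pd_coord m (inr (B, mindex_add mindex0 a)) q)).
Qed.

Section OpenDomain.
Variable U : set pt.
Hypothesis oU : open U.
Local Notation W := (jet_over U).

Let oW : open W. Proof. exact: jet_over_open. Qed.

Section Lagrangian.
Variables (k : nat) (F : {fset coord}) (w : diff_form R coord k.+1) (A : I).
Hypotheses (lw : local_form U w) (vF : vanishes_outside U F w)
  (dF : forall u, depends_on U F (w u)) (AF : inr A \in F).
Variable t : {ffun 'I_k.+1 -> jcoord}.

Let y0 : F := [` AF]%fset.

(** An explicit form of the derivative of the Lagrangian in psi^A_a: slot [j] must be the direction
    [a] and carry dpsi^A, and the factor in that slot is replaced by its derivative 1. *)
Let momentum (a : 'I_n) (q : jpt) := \sum_(v : {ffun 'I_k.+1 -> F}) w (valf v) (jproj q) *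
  \sum_(j < k.+1) ((t j == inl a) && (v j == y0))%:R *
    \prod_(i < k.+1 | i != j) jet_vector (t i) (valf v i) q.

Let pd_order0 (q : jpt) : W q -> pd (inr (A, mindex0)) (Hpull w t) q =
  \sum_(v : {ffun 'I_k.+1 -> F}) pd (inr A) (w (valf v)) (jproj q) * jet_prod t (valf v) q.
Proof.
move=> Wq; rewrite (jet_derivation_sum oU _ lw vF Wq (derivation_pd oW _ Wq)).
apply: eq_bigr => v _; rewrite (pd_jet (w (valf v)) (inr A)).
rewrite big1 ?mulr0 ?addr0// => j _; rewrite pd_jet_vector.
case: (t j) => [a|AJ]; last by rewrite mul0r.
case: (valf v j) => [b|B]; first by rewrite mul0r.
rewrite (_ : (inr (A, mindex0) == inr (B, mindex_add mindex0 a) :> jcoord) = false) ?mul0r//.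
apply/eqP => -[_ /esym E]; by move: (mindex_add0_neq0 a); rewrite E eqxx.
Qed.

Let pd_order1 (a : 'I_n) (q : jpt) : W q ->
  pd (inr (A, mindex_add mindex0 a)) (Hpull w t) q = momentum a q.
Proof.
move=> Wq; rewrite (jet_derivation_sum oU _ lw vF Wq (derivation_pd oW _ Wq)).
apply: eq_bigr => v _.
have -> : pd (inr (A, mindex_add mindex0 a)) (w (valf v) \o jproj) q = 0.
  apply: has_pd_val; apply: has_pd_jetN => -[//|B] /=.
  by apply/eqP => -[_ /esym E]; move: (mindex_add0_neq0 a); rewrite E eqxx.
rewrite mul0r add0r; congr (_ * _); apply: eq_bigr => j _.
suff -> : pd (inr (A, mindex_add mindex0 a)) (jet_vector (t j) (valf v j)) q =
    ((t j == inl a) && (v j == y0))%:R by [].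
rewrite pd_jet_vector ffunE -(inj_eq val_inj) /=.
case: (t j) => [b|AJ]; last by [].
have -> : (inl b == inl a :> jcoord) = (b == a) by [].
case: (val (v j)) => [d|B]; first by rewrite andbF.
have -> : (inr B == inr A :> coord) = (B == A) by [].
have -> : (inr (A, mindex_add mindex0 a) == inr (B, mindex_add mindex0 b) :> jcoord) =
  ((A, mindex_add mindex0 a) == (B, mindex_add mindex0 b)) by [].
by rewrite xpair_eqE (inj_eq mindex_add0_inj) andbC eq_sym [A == B]eq_sym.
Qed.

Let pd_higher (J : {ffun 'I_n -> nat}) (q : jpt) : W q -> J != mindex0 ->
  (forall a, J != mindex_add mindex0 a) -> pd (inr (A, J)) (Hpull w t) q = 0.
Proof.
move=> Wq J0 J1; rewrite (jet_derivation_sum oU _ lw vF Wq (derivation_pd oW _ Wq)).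
apply: big1 => v _.
have -> : pd (inr (A, J)) (w (valf v) \o jproj) q = 0.
  apply: has_pd_val; apply: has_pd_jetN => -[//|B] /=.
  by apply/eqP => -[_ E]; move: J0; rewrite -E eqxx.
rewrite mul0r add0r big1 ?mulr0// => j _; rewrite pd_jet_vector.
case: (t j) => [b|AJ]; last by rewrite mul0r.
case: (valf v j) => [d|B]; first by rewrite mul0r.
rewrite (_ : (inr (A, J) == inr (B, mindex_add mindex0 b) :> jcoord) = false) ?mul0r//.
by apply/eqP => -[_ E]; move: (J1 b); rewrite -E eqxx.
Qed.

(** The Lagrangian is of first order, so only the zero multi-index and the unit ones contribute to
    the sum over [J]. *)
Let EL_split (q : jpt) : W q -> euler_lagrange A (Hpull w) t q =
  \sum_(v : {ffun 'I_k.+1 -> F}) pd (inr A) (w (valf v)) (jproj q) * jet_prod t (valf v) q -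
  \sum_(a < n) tder jtot a (momentum a) q.
Proof.
move=> Wq; rewrite /euler_lagrange.
rewrite (@fsum_seq _ _ (mindex0 :: map (mindex_add mindex0) (enum 'I_n))).
- rewrite big_cons sum_mindex0 expr0 mul1r iter_tder_mindex0 pd_order0//; congr (_ + _).
  rewrite big_map big_enum -sumrN; apply: eq_bigr => a _.
  rewrite sum_mindex_add0 expr1 mulN1r iter_tder_mindex1; congr (- _).
  have E : eqon W (pd (inr (A, mindex_add mindex0 a)) (Hpull w t)) (momentum a).
    by move=> r Wr; exact: pd_order1.
  exact: (vder_eqon oW (total_field jtot a) E Wq).
- rewrite /= map_inj_uniq ?enum_uniq ?andbT; last exact: mindex_add0_inj.
  by apply/negP => /mapP[a _ /esym E]; move: (mindex_add0_neq0 a); rewrite E eqxx.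
- move=> J; rewrite inE negb_or => /andP[J0 J1].
  rewrite (iter_tder_eqon _ _ oW (g := fun=> 0) _ Wq) ?iter_tder_zero ?mulr0//.
  move=> r Wr; apply: pd_higher => // a; apply: contraNneq J1 => ->.
  by apply: map_f; rewrite mem_enum.
Qed.

(** In the sum over [a], the indicator in the momentum leaves only the direction named by [t j]; the
    derivative then falls either on the coefficient of [w] or on one of the other factors. *)
Let tder_momentum (q : jpt) : W q -> \sum_(a < n) tder jtot a (momentum a) q =
  \sum_(j < k.+1) \sum_(v : {ffun 'I_k.+1 -> F}) (v j == y0)%:R *
    (jet_tder (t j) (w (valf v) \o jproj) q *
       \prod_(i < k.+1 | i != j) jet_vector (t i) (valf v i) q +
     w (valf v) (jproj q) * \sum_(i < k.+1 | i != j) jet_vector2 (t j) (t i) (valf v i) q *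
       \prod_(x < k.+1 | (x != j) && (x != i)) jet_vector (t x) (valf v x) q).
Proof.
move=> Wq; have [lw1 _ _] := lw.
have lP j (v : {ffun 'I_k.+1 -> F}) :
    local_function W (fun q => \prod_(i < k.+1 | i != j) jet_vector (t i) (valf v i) q).
  by apply: local_prod => // i _ _; exact: local_jet_vector.
have step a : tder jtot a (momentum a) q =
    \sum_(j < k.+1) \sum_(v : {ffun 'I_k.+1 -> F}) ((t j == inl a) && (v j == y0))%:R *
    (tder jtot a (w (valf v) \o jproj) q *
       \prod_(i < k.+1 | i != j) jet_vector (t i) (valf v i) q +
     w (valf v) (jproj q) * \sum_(i < k.+1 | i != j) tder jtot a (jet_vector (t i) (valf v i)) q *
       \prod_(x < k.+1 | (x != j) && (x != i)) jet_vector (t x) (valf v x) q).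
  have D := derivation_vder oW (total_field jtot a) Wq.
  have lS (v : {ffun 'I_k.+1 -> F}) : local_function W (fun q =>
      \sum_(j < k.+1) ((t j == inl a) && (v j == y0))%:R *
      \prod_(i < k.+1 | i != j) jet_vector (t i) (valf v i) q).
    by apply: local_sum => // j _ _; apply: localM => //; exact: local_cst.
  rewrite /tder /momentum (derivation_sum oW D); last first.
    by move=> v _ _; apply: localM => //; exact: (local_jet oU (lw1 (valf v))).
  rewrite [RHS]exchange_big; apply: eq_bigr => v _ /=.
  rewrite (derivationM D (local_jet oU (lw1 (valf v))) (lS v)).
  rewrite (derivation_sum oW D); last first.
    by move=> j _ _; apply: localM => //; exact: local_cst.
  rewrite !mulr_sumr -big_split; apply: eq_bigr => j _ /=.
  rewrite (derivationZ oW D)// (derivation_prod oW D); last first.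
    by move=> i; exact: local_jet_vector.
  by rewrite mulrDr; congr (_ + _); rewrite mulrCA.
under eq_bigr do rewrite step.
rewrite exchange_big; apply: eq_bigr => j _ /=; rewrite exchange_big; apply: eq_bigr => v _ /=.
rewrite /jet_tder /jet_vector2; case: (t j) => [a|AJ].
  rewrite (bigD1 a)//= eqxx /= [X in _ + X]big1 ?addr0// => b ba.
  by rewrite (_ : (inl a == inl b :> jcoord) = (a == b))// eq_sym (negPf ba) mul0r.
rewrite [LHS]big1 => [|a _]; last exact: mul0r.
rewrite mul0r add0r [X in _ * (_ * X)]big1 ?mulr0// => i _.
exact: mul0r.
Qed.

(** The leading term of [de_rham w] with first index [inr A] is the derivative of the Lagrangian in
    psi^A. Its other terms, one for each slot [j], are minus the part of the divergence of the
    momenta in which dpsi^A sits in slot [j]. *)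
Lemma euler_lagrange_horizontalize (q : jpt) : W q ->
  euler_lagrange A (Hpull w) t q =
  Hpull (fun u => de_rham w (ins ord0 (inr A) u)) t q.
Proof.
move=> Wq; have [_ aw _] := lw.
rewrite EL_split// tder_momentum//.
rewrite (horizontalizeE (F := F)); last first.
  move=> u [i iF]; apply: (de_rham_vanishes oU vF dF Wq).
  by exists (lift ord0 i); rewrite ins_lift.
under [in X in _ - X]eq_bigr => j _.
  under eq_bigr do rewrite mulrDr.
  rewrite big_split /=; over.
rewrite /= big_split /= [X in _ - (_ + X)](_ : _ = 0) ?addr0; last first.
  (* Here [y0] is [inr A]: slot [j] carries dpsi^A while the factor in slot [i] is differentiated.
     Exchanging the slots changes the sign of [w] but not psi^B_{ab}. *)
  pose g (j : 'I_k.+1) (u : {ffun 'I_k.+1 -> F}) : R :=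
    (u j == y0)%:R * w (valf u) (jproj q).
  pose S (j i : 'I_k.+1) (l : F) := jet_vector2 (t j) (t i) (val l) q.
  pose T (i : 'I_k.+1) (l : F) := jet_vector (t i) (val l) q.
  have gA j i (u : {ffun 'I_k.+1 -> F}) : i != j ->
      g i [ffun x => u (tperm j i x)] = - g j u.
    move=> ij; rewrite /g ffunE tpermR -mulrN; congr (_ * _).
    have -> : valf [ffun x => u (tperm j i x)] = [ffun x => valf u (tperm j i x)].
      by apply/ffunP => x; rewrite !ffunE.
    by rewrite aw// odd_tperm eq_sym ij expr1 mulN1r.
  have SS j i l : S j i l = S i j l by exact: jet_vector2C.
  rewrite -[RHS](swap_cancel T gA SS); apply: eq_bigr => j _.
  rewrite [RHS]exchange_big /=; apply: eq_bigr => v _.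
  rewrite mulrA mulr_sumr; apply: eq_bigr => i _; congr (_ * (_ * _)).
    by rewrite /S ffunE.
  by apply: eq_bigr => x _; rewrite /T ffunE.
under [RHS]eq_bigr => v _.
  rewrite /de_rham big_ord_recl /= expr0 mul1r ins_at omit_ins mulrDl mulr_suml; over.
rewrite big_split /=; congr (_ + _); rewrite -sumrN exchange_big /=.
apply: eq_bigr => j _.
rewrite (sum_ins j) (bigD1 y0)//= [X in - (_ + X)]big1 ?addr0; last first.
  by move=> l ly; apply: big1 => v _; rewrite ins_at (negPf ly) mul0r.
rewrite (sum_ins j) exchange_big /= -sumrN; apply: eq_bigr => v _.
rewrite ins_at eqxx mul1r (jet_tderE oU _ (dF _) Wq) mulr_suml -sumrN.
apply: eq_bigr => l _.
rewrite ins_lift omit_ins0_lift !valf_ins ins_at omit_ins.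
have -> : \prod_(i < k.+1) jet_vector (t i) (ins j (val l) (valf v) i) q =
   jet_vector (t j) (val l) q * jet_prod (omit t j) (valf v) q.
  exact: (jet_prod_ins t j (val l) (valf v) q).
have -> : \prod_(i < k.+1 | i != j) jet_vector (t i) (ins j (val y0) (valf v) i) q =
   jet_prod (omit t j) (valf v) q.
  by rewrite big_lift; apply: eq_bigr => i _; rewrite ins_lift [omit t j i]ffunE.
(* Moving the index [inr A] from slot [j] to the front costs the sign (-1)^j. *)
have -> : pd (val l) (w (ins j (val y0) (valf v))) (jproj q) =
    (-1) ^+ j * pd (val l) (w (ins ord0 (inr A) (valf v))) (jproj q).
  have [lw0 _ _] := lw; have lw1 := lw0 (ins ord0 (inr A) (valf v)).
  rewrite -(derivationZ oU (derivation_pd oU (val l) (Wq : U (jproj q))) _ lw1).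
  apply: (pd_eqon _ oU) => // p Up.
  have := antisymmetric_front (ins j (inr A) (valf v)) j aw Up.
  rewrite ins_at omit_ins => ->.
  by rewrite mulrA -exprD addnn -mul2n exprM sqrrN !expr1n mul1r.
by rewrite /bump /= add1n exprS; ring.
Qed.

End Lagrangian.
End OpenDomain.
End EulerLagrange.

(** * Contraction of the presymplectic form *)

Section Defect.
Variables (R : realType) (n : nat) (I : choiceType).
Local Notation coord := ('I_n + I)%type.
Local Notation jcoord := ('I_n + I * {ffun 'I_n -> nat})%type.
Local Notation jproj := (@jet_proj R n I).
Local Notation jtot := (@jet_total R n I).
Variable Y : 'I_n -> I -> cspace R coord -> R.

Lemma dh_defectE B (x : {ffun 'I_1 -> jcoord}) (q : cspace R jcoord) : dh_defect Y B x q =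
  if x ord0 is inl a then jtot a (B, [ffun=> 0%N]) q - Y a B (jproj q) else 0.
Proof.
rewrite /dh_defect Dh_coordinate; case E : (x ord0) => [a|AJ].
  have -> : x = emb_tuple [ffun=> inl a].
    by apply/ffunP => i; rewrite !ffunE ord1 E.
  by rewrite pullback_emb hdiff_coordinate ffunE.
rewrite pullback_notemb ?subrr// => u; rewrite hdiff_coordinate.
case E' : (u ord0) => [a|A] /eqP; last by [].
by move=> _; apply/eqP => /ffunP/(_ ord0); rewrite ffunE E' E.
Qed.

End Defect.

Section PresymplecticContraction.
Variables (R : realType) (n : nat) (I : choiceType).
Local Notation coord := ('I_n.+1 + I)%type.
Local Notation jfib := (I * {ffun 'I_n.+1 -> nat})%type.
Local Notation jcoord := ('I_n.+1 + jfib)%type.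
Local Notation pt := (cspace R coord).
Local Notation jpt := (cspace R jcoord).
Local Notation jproj := (@jet_proj R n.+1 I).
Local Notation jtot := (@jet_total R n.+1 I).
Local Notation Hpull w := (horizontalize (pullback jproj w)).
Variable Y : 'I_n.+1 -> I -> pt -> R.

Lemma horizontalize_ext k (w w' : diff_form R coord k) t (q : jpt) :
  (forall u, w u (jproj q) = w' u (jproj q)) -> Hpull w t q = Hpull w' t q.
Proof.
move=> ww'; rewrite /horizontalize /substitute; apply: eq_fsbigr => x _.
by congr (_ * _); rewrite /pullback; apply: eq_fsbigr => u _; rewrite ww'.
Qed.

(** Horizontalization fixes every dx^a, hence also a pullback that involves no other
    differentials. *)
Lemma pullback_horizontal k (w : diff_form R coord k) x (q : jpt) :
  (forall u : {ffun 'I_k -> coord}, (exists i, ~~ hor_index (u i)) -> w u (jproj q) = 0) ->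
  pullback jproj w x q = Hpull w x q.
Proof.
move=> hw; rewrite /horizontalize /substitute -(fsbig_widen [set x])//; last first.
  move=> y [_ /= yx]; rewrite /preimage /=.
  have [[u [wu yE]]|h] := pselect (exists u, w u (jproj q) != 0 /\ emb_tuple u = y).
    have [i xi] : exists i, x i != y i.
      apply: contrapT => nE; apply: yx; apply/ffunP => i; apply/eqP.
      by rewrite eq_sym; apply: contrapT => /negP h; apply: nE; exists i.
    rewrite (bigD1 i)//= Dh_coordinate ffunE.
    suff -> : (if x i is inl a then total_field jtot a (y i) q else 0) = 0.
      by rewrite mul0r mulr0.
    have ui : hor_index (u i).
      by apply: contraT => ui; rewrite hw ?eqxx// in wu; exists i.
    move: xi; rewrite -yE ffunE; case: (u i) ui => // b _.
    case: (x i) => // a /= ab; suff -> : (b == a) = false by [].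
    by apply: contraNF ab => /eqP ->.
  rewrite pullback_notemb ?mul0r// => u wu.
  by apply/eqP => E; apply: h; exists u.
rewrite fsbig_set1; have [[u [wu xE]]|h] := pselect (exists u, w u (jproj q) != 0 /\ emb_tuple u = x).
  rewrite big1 ?mulr1// => i _; rewrite Dh_coordinate ffunE -xE ffunE.
  have : hor_index (u i).
    by apply: contraT => ui; rewrite hw ?eqxx// in wu; exists i.
  by case: (u i) => //= a _; rewrite eqxx.
rewrite pullback_notemb ?mul0r// => u wu.
by apply/eqP => E; apply: h; exists u.
Qed.

Lemma sum_delta (X : choiceType) (F : {fset X}) (m : X) (f : X -> R) : m \in F ->
  \sum_(l <- F) (l == m)%:R * f l = f m.
Proof.
move=> mF; rewrite (bigD1_seq m) ?fset_uniq//= eqxx mul1r big1 ?addr0// => l lm.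
by rewrite (negPf lm) mul0r.
Qed.

(** The components of d_v psi^B, whose horizontalization is the defect D_h psi^B - d_h psi^B. *)
Definition contact B (l : coord) (p : pt) : R :=
  vdiff Y (coordinate (inr B : coord)) [ffun=> l] p.

Lemma contactE B l p : contact B l p =
  (l == inr B)%:R - (if l is inl a then Y a B p else 0).
Proof. by rewrite /contact vdiff_coordinate ffunE. Qed.

Lemma contact_vertical B A p : contact B (inr A) p = (A == B)%:R.
Proof. by rewrite contactE subr0. Qed.

Lemma wedge1_contact k B (w : diff_form R coord k) u p :
  wedge1 (vdiff Y (coordinate (inr B : coord))) w u p =
  \sum_(j < k.+1) (-1) ^+ j * (contact B (u j) p * w (omit u j) p).
Proof. by []. Qed.

Lemma wedge1_contact_ins k B A (w : diff_form R coord k.+1) u p :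
  wedge1 (vdiff Y (coordinate (inr B : coord))) w (ins ord0 (inr A) u) p =
  (A == B)%:R * w u p -
  \sum_(j < k.+1) (-1) ^+ j * (contact B (u j) p * w (ins ord0 (inr A) (omit u j)) p).
Proof.
rewrite wedge1_contact big_ord_recl expr0 mul1r ins_at omit_ins contact_vertical.
congr (_ + _); rewrite -sumrN; apply: eq_bigr => j _.
by rewrite ins_lift omit_ins0_lift lift0 exprS mulN1r mulNr.
Qed.

Lemma wedge1_contact_ins_horizontal k B A (w : diff_form R coord k) u p :
  (forall u : {ffun 'I_k -> coord}, (exists i, ~~ hor_index (u i)) -> w u p = 0) ->
  wedge1 (vdiff Y (coordinate (inr B : coord))) w (ins ord0 (inr A) u) p =
  (A == B)%:R * w u p.
Proof.
move=> hw; rewrite wedge1_contact big_ord_recl expr0 mul1r ins_at omit_ins contact_vertical.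
rewrite big1 ?addr0// => j _; rewrite hw ?mulr0//.
case: (unliftP (lift ord0 j) ord0) => [i E|E].
  by exists i; rewrite ffunE -E ins_at.
by move/(congr1 val): E.
Qed.

(** The contraction with d/dpsi^A meets either of the factors d_v psi and not the horizontal [sAB].
    By antisymmetry of [sAB] the two contributions agree, which absorbs the factor 1/2 and leaves
    the overall sign. *)
Lemma presymplectic_contraction (U : set pt) sigma sAB A :
  presymplectic_components U Y sigma sAB ->
  exists G : {fset I}, [/\ forall B p u, B \notin G -> U p -> sAB B A u p = 0 &
  forall u p, U p -> sigma (ins ord0 (inr A) u) p =
    - \sum_(B <- G) wedge1 (vdiff Y (coordinate (inr B : coord))) (sAB B A) u p].
Proof.
move=> [ls anti [S hS] sE].
(* [A] itself is included so that the sums against the Kronecker delta at [A] collapse, even when no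
   component of [sigma] involves it. *)
pose G := ([fset A] `|` [fset x.1 | x in S] `|` [fset x.2 | x in S])%fset.
have AG : A \in G by rewrite !inE eqxx.
have G1 B C u p : B \notin G -> U p -> sAB B C u p = 0.
  move=> BG Up; apply: hS Up; apply: contra BG => BCS.
  rewrite !inE; apply/orP; left; apply/orP; right.
  by apply/imfsetP; exists (B, C).
have G2 B C u p : C \notin G -> U p -> sAB B C u p = 0.
  move=> CG Up; apply: hS Up; apply: contra CG => BCS.
  by rewrite !inE; apply/orP; right; apply/imfsetP; exists (B, C).
have w0 k th (w : diff_form R coord k) u p : (forall u, w u p = 0) -> wedge1 th w u p = 0.
  by move=> h; apply: big1 => j _; rewrite h !mulr0.
exists G; split=> [B p u BG Up|u p Up]; first exact: G1.
have hs B C : forall u : {ffun 'I_n -> coord}, (exists i, ~~ hor_index (u i)) -> sAB B C u p = 0.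
  move=> u' /vdeg_gt0 h; have [_ bs] := ls B C.
  exact: (bidegree_vanish bs Up h).
rewrite sE//.
rewrite (@fsum_seq _ _ G)//; last first.
  move=> B BG; apply: fsbig1 => C _; apply: (w0) => v; apply: (w0) => v'.
  exact: G1.
have inner B : \sum_(C \in [set: I]) wedge1 (vdiff Y (coordinate (inr B : coord)))
      (wedge1 (vdiff Y (coordinate (inr C : coord))) (sAB B C)) (ins ord0 (inr A) u) p =
    \sum_(C <- G) (A == B)%:R *
      wedge1 (vdiff Y (coordinate (inr C : coord))) (sAB B C) u p -
    \sum_(C <- G) \sum_(j < n.+1)
      (-1) ^+ j * (contact B (u j) p * ((A == C)%:R * sAB B C (omit u j) p)).
  rewrite (@fsum_seq _ _ G) ?fset_uniq//; last first.
    by move=> C CG; apply: (w0) => v; apply: (w0) => v'; exact: G2.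
  rewrite -sumrB; apply: eq_bigr => C _; rewrite wedge1_contact_ins; congr (_ - _).
  by apply: eq_bigr => j _; rewrite wedge1_contact_ins_horizontal//; exact: hs.
under eq_bigr do rewrite inner.
rewrite sumrB /=.
have -> : \sum_(B <- G) \sum_(C <- G) (A == B)%:R *
    wedge1 (vdiff Y (coordinate (inr C : coord))) (sAB B C) u p =
    - \sum_(B <- G) wedge1 (vdiff Y (coordinate (inr B : coord))) (sAB B A) u p.
  under eq_bigr do rewrite -mulr_sumr eq_sym.
  rewrite (sum_delta (fun B => \sum_(C <- G)
    wedge1 (vdiff Y (coordinate (inr C : coord))) (sAB B C) u p) AG).
  rewrite -sumrN; apply: eq_bigr => C _; rewrite !wedge1_contact -sumrN.
  by apply: eq_bigr => j _; rewrite anti// !mulrN.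
have -> : \sum_(B <- G) \sum_(C <- G) \sum_(j < n.+1)
   (-1) ^+ j * (contact B (u j) p * ((A == C)%:R * sAB B C (omit u j) p)) =
   \sum_(B <- G) wedge1 (vdiff Y (coordinate (inr B : coord))) (sAB B A) u p.
  apply: eq_bigr => B _; rewrite exchange_big /= wedge1_contact; apply: eq_bigr => j _.
  rewrite -(sum_delta (fun C => (-1) ^+ j * (contact B (u j) p * sAB B C (omit u j) p)) AG).
  by apply: eq_bigr => C _; rewrite eq_sym; ring.
by field.
Qed.

(** Horizontalization is multiplicative: it sends d_v psi^B to the defect and leaves the horizontal
    [sAB B A] unchanged. *)
Lemma horizontalize_contraction (U : set pt) sigma sAB A t (q : jpt) :
  presymplectic_components U Y sigma sAB -> U (jproj q) ->
  Hpull (fun u => sigma (ins ord0 (inr A) u)) t q =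
  - \sum_(B \in [set: I]) wedge1 (dh_defect Y B) (pullback jproj (sAB B A)) t q.
Proof.
move=> hc Up; have [G [G0 sE]] := presymplectic_contraction A hc.
have [ls _ _ _] := hc; set p := jproj q in Up *.
have hs B : forall u : {ffun 'I_n -> coord}, (exists i, ~~ hor_index (u i)) -> sAB B A u p = 0.
  move=> u' /vdeg_gt0 h; have [_ bs] := ls B A.
  exact: (bidegree_vanish bs Up h).
(* Besides dpsi^B, the form d_v psi^B has the components -Y_a^B along dx^a, so every base coordinate
   belongs to [F]. *)
pose F := ([fset x in codom (@inl 'I_n.+1 I)] `|` [fset inr B | B in G])%fset.
have inlF a : inl a \in F by rewrite inE; apply/orP; left; rewrite inE; exact: codom_f.
have inrF B : B \in G -> inr B \in F.
  by move=> BG; rewrite inE; apply/orP; right; exact: in_imfset.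
have nF l : l \notin F -> exists2 C, l = inr C & C \notin G.
  case: l => [a|C]; first by rewrite inlF.
  by move=> CF; exists C => //; apply: contra CF; exact: inrF.
rewrite (fsum_seq (r := G)) ?fset_uniq//; last first.
  move=> B BG; apply: big1 => j _; rewrite pullback_notemb ?mulr0// => u.
  by rewrite G0// eqxx.
rewrite (horizontalize_ext (w' := fun u p => - \sum_(B <- G)
  wedge1 (vdiff Y (coordinate (inr B : coord))) (sAB B A) u p)); last by move=> u; rewrite sE.
rewrite (horizontalizeE (F := F)); last first.
  move=> u [i /nF[C uC CG]]; rewrite big_seq big1 ?oppr0// => B BG.
  rewrite wedge1_contact; apply: big1 => j _.
  have [ij|ij] := eqVneq i j.
    rewrite -ij uC contact_vertical (_ : (C == B) = false) ?mul0r ?mulr0//.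
    by apply: contraNF CG => /eqP ->.
  rewrite hs ?mulr0//; case: (unliftP j i) => [i' E|E]; last by rewrite E eqxx in ij.
  by exists i'; rewrite ffunE -E uC.
under eq_bigr do rewrite mulNr mulr_suml.
rewrite sumrN exchange_big /=; congr (- _); rewrite big_seq [RHS]big_seq.
apply: eq_bigr => B BG.
under eq_bigr do rewrite wedge1_contact mulr_suml.
rewrite exchange_big /= /wedge1; apply: eq_bigr => j _.
rewrite (pullback_horizontal _ (hs B)) (horizontalizeE (F := F)); last first.
  by move=> u [i /nF[C uC _]]; apply: hs; exists i; rewrite uC.
have -> : dh_defect Y B [ffun=> t j] q =
    \sum_(l : F) contact B (val l) p * jet_vector (t j) (val l) q.
  rewrite -(big_seq_fsetE _ F xpredT (fun l => contact B l p * jet_vector (t j) l q)) /=.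
  rewrite dh_defectE ffunE; case: (t j) => [a|AJ]; last first.
    by rewrite big1// => l _; rewrite mulr0.
  rewrite -[X in X - _](sum_delta (fun l => total_field jtot a (jet_emb l) q) (inrF B BG)).
  rewrite -(sum_delta (fun l => Y a B p) (inlF a)) -sumrB; apply: eq_bigr => l _.
  rewrite contactE /jet_vector mulrBl; congr (_ - _).
  case: l => [b|C] /=; last by rewrite !mul0r.
  have -> : (inl b == inl a :> coord) = (b == a) by [].
  by rewrite [RHS]mulrC; have [->|ba] := eqVneq b a; rewrite ?mul0r.
rewrite (sum_ins j) mulr_suml mulr_sumr; apply: eq_bigr => l _.
rewrite mulr_sumr mulr_sumr; apply: eq_bigr => v _.
rewrite valf_ins ins_at omit_ins.
have := jet_prod_ins t j (val l) (valf v) q; rewrite /jet_prod => ->.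
by ring.
Qed.

End PresymplecticContraction.

(** * The equation surface *)

Section EquationSurface.
Variables (R : realType) (n : nat) (I : choiceType).
Local Notation coord := ('I_n + I)%type.
Local Notation jfib := (I * {ffun 'I_n -> nat})%type.
Local Notation jcoord := ('I_n + jfib)%type.
Local Notation pt := (cspace R coord).
Local Notation jpt := (cspace R jcoord).
Local Notation jproj := (@jet_proj R n I).
Local Notation jtot := (@jet_total R n I).
Variables (U V : set pt) (Y : 'I_n -> I -> pt -> R).
Hypotheses (eqU : equation_manifold U Y) (oV : open V) (VU : V `<=` U).

Let oU : open U. Proof. by case: eqU. Qed.
Let lY a A : local_function U (Y a A). Proof. by case: eqU. Qed.
Let oW : open (jet_over V). Proof. exact: jet_over_open. Qed.
Local Notation W := (jet_over V).

Let lX a l : local_function U (total_field Y a l).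
Proof. by case: l => [b|A]; [exact: local_cst|exact: lY]. Qed.

Let ljX a m : local_function W (total_field jtot a m).
Proof. exact: local_total_field. Qed.

Let ltY a f : local_function U f -> local_function U (tder Y a f).
Proof. exact: local_vder. Qed.

Let ltj a f : local_function W f -> local_function W (tder jtot a f).
Proof. exact: local_vder. Qed.

(** The integrability condition d_h^2 = 0 on functions, read off at the pair of base indices [a],
    [b]. *)
Lemma tder_comm f a b p : local_function U f -> U p ->
  tder Y a (tder Y b f) p = tder Y b (tder Y a f) p.
Proof.
move=> lf Up; have [_ _ h] := eqU.
pose t : {ffun 'I_2 -> coord} := [ffun i => if i == ord0 then inl a else inl b].
have := h f lf t p Up; rewrite hdiff_horizontal; last first.
  by move=> u [i]; rewrite hdiff0E ord1; case: (u ord0).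
rewrite big_ord_recl big_ord1 expr0 mul1r lift0 expr1 mulN1r !ffunE.
have e c (j : 'I_2) : t (lift j (@ord0 0)) = inl c ->
    hdiff Y (form0 f) (omit t j) = tder Y c f.
  by move=> tj; apply/funext => r; rewrite hdiff0E ffunE tj.
by rewrite (e b ord0) ?ffunE// (e a (lift ord0 ord0)) ?ffunE// => /subr0_eq.
Qed.

Lemma tder_iter m a b f p : local_function U f -> U p ->
  tder Y a (iter m (tder Y b) f) p = iter m (tder Y b) (tder Y a f) p.
Proof.
move=> lf; have lm k : local_function U (iter k (tder Y b) f).
  by elim: k => //= k; exact: ltY.
elim: m p => //= m ih p Up; rewrite tder_comm//.
by apply: (vder_eqon oU _ _ Up) => r Ur; exact: ih.
Qed.

Lemma local_foldr_tder J f s : local_function U f ->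
  local_function U (foldr (fun a => iter (J a) (tder Y a)) f s).
Proof.
move=> lf; elim: s => //= a s ih; elim: (J a) => //= m; exact: ltY.
Qed.

Lemma iter_eqon m a f g : eqon U f g ->
  eqon U (iter m (tder Y a) f) (iter m (tder Y a) g).
Proof. by move=> fg; elim: m => //= m ih; exact: vder_eqon. Qed.

Lemma tder_foldr (J : 'I_n -> nat) f s a : local_function U f ->
  eqon U (tder Y a (foldr (fun b => iter (J b) (tder Y b)) f s))
         (foldr (fun b => iter (J b) (tder Y b)) (tder Y a f) s).
Proof.
move=> lf; elim: s => [//|b s ih] p Up /=.
rewrite tder_iter//; last exact: local_foldr_tder.
exact: (iter_eqon _ _ ih Up).
Qed.

(** [iter_tder] applies the derivatives in a fixed order; commutativity lets the additional D_a pass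
    through the blocks to the innermost position. *)
Lemma iter_tder_add J f a : local_function U f ->
  eqon U (iter_tder Y (mindex_add J a) f) (iter_tder Y J (tder Y a f)).
Proof.
move=> lf; rewrite /iter_tder.
have out s : a \notin s -> foldr (fun b => iter (mindex_add J a b) (tder Y b)) f s =
    foldr (fun b => iter (J b) (tder Y b)) f s.
  elim: s => //= b s ih; rewrite inE negb_or => /andP[ab /ih ->].
  by rewrite ffunE eq_sym (negPf ab) addn0.
suff H s : uniq s -> a \in s ->
    eqon U (foldr (fun b => iter (mindex_add J a b) (tder Y b)) f s)
           (foldr (fun b => iter (J b) (tder Y b)) (tder Y a f) s).
  by apply: H; rewrite ?enum_uniq ?mem_enum.
elim: s => //= b s ih /andP[bs us]; rewrite inE.
have [ab _|ab /= sa] := eqVneq a b.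
  subst b; rewrite out// ffunE eqxx addn1 iterSr.
  by apply: iter_eqon; exact: tder_foldr.
rewrite ffunE eq_sym (negPf ab) addn0; apply: iter_eqon; exact: ih.
Qed.

Definition fibre_solution (A : I) (J : {ffun 'I_n -> nat}) : pt -> R :=
  iter_tder Y J (fun p => p (inr A)).

Definition solution_jet (p : pt) : jpt := fun m =>
  match m with inl a => p (inl a) | inr AJ => fibre_solution AJ.1 AJ.2 p end.

Lemma local_fibre_solution A J : local_function U (fibre_solution A J).
Proof. by apply: local_foldr_tder; exact: local_coord. Qed.

Lemma local_solution_jet m : local_function U (fun p => solution_jet p m).
Proof. by case: m => [a|[A J]]; [exact: local_coord|exact: local_fibre_solution]. Qed.

Lemma jet_proj_solution p : jproj (solution_jet p) = p.
Proof.
by apply/funext => -[a|A] //=; rewrite /fibre_solution -/(mindex0 n) iter_tder_mindex0.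
Qed.

Lemma tder_fibre_coordinate a (A : I) :
  tder Y a (fun p => p (inr A)) = Y a A.
Proof. by apply/funext => p; exact: vder_coordinate. Qed.

Lemma fibre_solution_add A J a p : U p ->
  fibre_solution A (mindex_add J a) p = iter_tder Y J (Y a A) p.
Proof.
move=> Up; rewrite /fibre_solution (iter_tder_add _ _ _ Up) ?tder_fibre_coordinate//.
exact: local_coord.
Qed.

Lemma tder_solution_jet a m p : U p ->
  tder Y a (fun p => solution_jet p m) p = total_field jtot a m (solution_jet p).
Proof.
case: m => [b|[A J]] Up; first exact: vder_coordinate.
rewrite /= /jet_total /= -/(mindex_add J a) /fibre_solution /iter_tder.
rewrite (tder_foldr _ _ _ _ Up); last exact: local_coord.
by rewrite -/(iter_tder _ _ _) iter_tder_add//; exact: local_coord.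
Qed.

(* The total derivatives are tangent to the image of [solution_jet]. *)
Lemma tder_comp_solution f a p : local_function W f -> V p ->
  tder Y a (f \o solution_jet) p = tder jtot a f (solution_jet p).
Proof.
move=> lf Vp; have Up := VU Vp; have [S hS] := local_depends lf.
have Ws : W (solution_jet p) by rewrite /jet_over /preimage /= jet_proj_solution.
have hc k := has_pd_comp oW lf hS Ws
  (fun l => local_has_pd k (local_solution_jet l) Up).
have [D hD] := choice (fun l => local_depends (local_solution_jet l)).
pose F := (\bigcup_(l <- S) D l)%fset.
have hF l : l \in S -> depends_on U F (fun p => solution_jet p l).
  move=> lS; apply: depends_on_sub (hD l) => k kD.
  by apply/bigfcupP; exists l; rewrite ?lS.
rewrite /tder (vderE oW _ hS Ws) /vder (fsum_seq (r := F)) ?fset_uniq//; last first.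
  move=> k kF; rewrite (has_pd_val (hc k)) big_seq big1 ?mulr0// => l lS.
  by rewrite (depends_on_pd0 oU (hF l lS) kF Up) mul0r.
under eq_bigr do rewrite (has_pd_val (hc _)) mulr_sumr.
rewrite exchange_big /= big_seq [RHS]big_seq; apply: eq_bigr => l lS.
rewrite -tder_solution_jet// /tder (vderE oU _ (hF l lS) Up) mulr_suml.
by apply: eq_bigr => k _; rewrite mulrA.
Qed.

Lemma foldr_comp_solution (J : 'I_n -> nat) f s : local_function W f ->
  local_function W (foldr (fun a => iter (J a) (tder jtot a)) f s) /\
  eqon V (foldr (fun a => iter (J a) (tder Y a)) (f \o solution_jet) s)
    (foldr (fun a => iter (J a) (tder jtot a)) f s \o solution_jet).
Proof.
move=> lf; elim: s => [//|a s [lih ih]] /=.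
elim: (J a) => //= m [lm im]; split; first exact: ltj.
move=> p Vp; apply: etrans (tder_comp_solution a lm Vp).
exact: (vder_eqon oV (total_field Y a) im Vp).
Qed.

Lemma iter_tder_comp_solution J f p : local_function W f -> V p ->
  iter_tder Y J (f \o solution_jet) p = iter_tder jtot J f (solution_jet p).
Proof. by move=> lf; have [_] := foldr_comp_solution J (enum 'I_n) lf; exact. Qed.

Lemma local_dh_defect A t : local_function W (dh_defect Y A t).
Proof.
have -> : dh_defect Y A t = fun q => if t ord0 is inl a then
    jtot a (A, [ffun=> 0%N]) q - Y a A (jproj q) else 0.
  by apply/funext => q; exact: dh_defectE.
case: (t ord0) => [a|AJ]; last exact: local_cst.
apply: localB => //; first exact: local_coord.
exact: (local_jet oV (local_functionS VU (lY a A))).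
Qed.

Lemma dh_defect_solution A t p : V p -> dh_defect Y A t (solution_jet p) = 0.
Proof.
move=> Vp; rewrite dh_defectE; case: (t ord0) => // a.
rewrite jet_proj_solution /jet_total /= -/(mindex0 n) -/(mindex_add (mindex0 n) a).
by rewrite fibre_solution_add ?iter_tder_mindex0 ?subrr//; exact: VU.
Qed.

(** Tangency turns the jet derivatives of [f] on the section into derivatives on [V] of the zero
    function. It serves for the defects and again for the Euler-Lagrange expressions. *)
Lemma iter_tder_comp_zero J f p : local_function W f ->
  (forall p, V p -> f (solution_jet p) = 0) -> V p ->
  iter_tder jtot J f (solution_jet p) = 0.
Proof.
move=> lf f0 Vp; rewrite -iter_tder_comp_solution//.
by rewrite (iter_tder_eqon _ _ oV (g := fun=> 0) _ Vp) ?iter_tder_zero.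
Qed.

Lemma solution_jet_surface p : V p -> equation_surface V Y (solution_jet p).
Proof.
move=> Vp; split; first by rewrite /jet_over /preimage /= jet_proj_solution.
move=> A t J; apply: iter_tder_comp_zero => //; first exact: local_dh_defect.
by move=> r Vr; exact: dh_defect_solution.
Qed.

Definition jet_order_le (k : nat) (m : jcoord) : bool :=
  if m is inr AJ then (\sum_(a < n) AJ.2 a <= k)%N else true.

Lemma sum_mindex_add (J : {ffun 'I_n -> nat}) a :
  (\sum_(b < n) mindex_add J a b = (\sum_(b < n) J b).+1)%N.
Proof.
under eq_bigr do rewrite ffunE.
rewrite big_split /= -addn1; congr (_ + _)%N.
by rewrite (bigD1 a)//= eqxx big1// => b /negPf ->.
Qed.

Lemma jet_order_tder k f a : local_function W f -> depends_on_pred W (jet_order_le k) f ->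
  depends_on_pred W (jet_order_le k.+1) (tder jtot a f).
Proof.
move=> lf hk q r Wq Wr qr; have [S hS] := local_depends lf.
rewrite /tder !(vderE oW _ hS)//; apply: eq_bigr => m _.
have [mk|mk] := boolP (jet_order_le k m); last first.
  by rewrite !(depends_on_pred_pd0 oW hk mk)// !mulr0.
have hk1 : pd m f q = pd m f r.
  apply: (depends_on_pred_pd oW m hk) => // m' m'k; apply: qr.
  by case: m' m'k => //= AJ; exact: leqW.
rewrite hk1; congr (_ * _); case: m mk {hk1} => // -[A J] /= Jk.
by apply: qr; rewrite /= sum_mindex_add.
Qed.

(** Each total derivative raises the order by at most one. This bound lets the uniqueness argument
    compare two jets that agree only up to a given order. *)
Lemma jet_order_iter_tder (J : {ffun 'I_n -> nat}) f : local_function W f ->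
  depends_on_pred W (jet_order_le 0) f ->
  depends_on_pred W (jet_order_le (\sum_(a < n) J a)%N) (iter_tder jtot J f).
Proof.
move=> lf h0; rewrite /iter_tder.
have -> : (\sum_(a < n) J a)%N = (\sum_(a <- enum 'I_n) J a)%N by rewrite big_enum.
elim: (enum 'I_n) => [|a s ih] /=; first by rewrite big_nil.
rewrite big_cons; have [ls _] := foldr_comp_solution J s lf.
elim: (J a) => [//|m ihm]; rewrite addSn iterS; apply: jet_order_tder => //.
by elim: m {ihm} => //= m; exact: ltj.
Qed.

Lemma jet_coordinate_iter (A : I) (K J : {ffun 'I_n -> nat}) :
  iter_tder jtot J (fun q : jpt => q (inr (A, K))) =
  fun q => q (inr (A, [ffun b => K b + J b]%N)).
Proof.
have tc a K' : tder jtot a (fun q : jpt => q (inr (A, K'))) =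
    fun q => q (inr (A, mindex_add K' a)).
  by apply/funext => q; exact: vder_coordinate.
have ic m a K' : iter m (tder jtot a) (fun q : jpt => q (inr (A, K'))) =
    fun q => q (inr (A, [ffun b => K' b + m * (b == a)]%N)).
  elim: m => [|m ih] /=.
    by apply/funext => q; congr (q (inr (_, _))); apply/ffunP => b; rewrite ffunE mul0n addn0.
  rewrite ih tc; apply/funext => q; congr (q (inr (_, _))); apply/ffunP => b.
  by rewrite !ffunE mulSn -addnA [(m * _ + _)%N]addnC.
suff H s : uniq s -> foldr (fun a => iter (J a) (tder jtot a)) (fun q : jpt => q (inr (A, K))) s =
    fun q => q (inr (A, [ffun b => K b + (if b \in s then J b else 0)]%N)).
  rewrite /iter_tder H ?enum_uniq//; apply/funext => q; congr (q (inr (_, _))).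
  by apply/ffunP => b; rewrite !ffunE mem_enum.
elim: s => [_|a s ih /= /andP[as_ us]].
  by apply/funext => q /=; congr (q (inr (_, _))); apply/ffunP => b; rewrite ffunE addn0.
rewrite ih// ic; apply/funext => q; congr (q (inr (_, _))); apply/ffunP => b.
rewrite !ffunE inE; have [->|ba] := eqVneq b a.
  by rewrite (negPf as_) muln1 addn0.
by rewrite muln0 addn0.
Qed.

Lemma iter_tderB J f g q : local_function W f -> local_function W g -> W q ->
  iter_tder jtot J (fun q => f q - g q) q = iter_tder jtot J f q - iter_tder jtot J g q.
Proof.
move=> lf lg; rewrite /iter_tder; elim: (enum 'I_n) q => [//|a s ih] q Wq /=.
have [lfs _] := foldr_comp_solution J s lf; have [lgs _] := foldr_comp_solution J s lg.
elim: (J a) q Wq => [|m ihm] q Wq /=; first exact: ih.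
have lm h k : local_function W h -> local_function W (iter k (tder jtot a) h).
  by move=> lh; elim: k => //= k; exact: ltj.
rewrite -(derivationB oW (derivation_vder oW (total_field jtot a) Wq) (lm _ m lfs) (lm _ m lgs)).
by apply: (vder_eqon oW _ _ Wq) => r Wr; exact: ihm.
Qed.

(** Write J = J' + a. The J'-th derivative of psi^A_a = Y_a^A expresses psi^A_J as D_{J'} Y_a^A,
    which sees only jets of order at most |J'|; there the induction hypothesis identifies [q] with
    the section. *)
Lemma solution_jet_unique q : equation_surface V Y q -> solution_jet (jproj q) = q.
Proof.
move=> [Wq hq]; have Vp : V (jproj q) by [].
set p := jproj q in Vp *.
have base A : solution_jet p (inr (A, mindex0 n)) = q (inr (A, mindex0 n)).
  by rewrite /= /fibre_solution iter_tder_mindex0.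
suff H k A (J : {ffun 'I_n -> nat}) : (\sum_(a < n) J a <= k)%N -> solution_jet p (inr (A, J)) = q (inr (A, J)).
  by apply/funext => -[a|[A J]] //; exact: (H (\sum_(a < n) J a)%N).
elim: k A J => [|k ih] A J Jk.
  suff -> : J = mindex0 n by exact: base.
  apply/ffunP => a; apply/eqP; rewrite ffunE -leqn0 (leq_trans _ Jk)//.
  by rewrite (bigD1 a)//= leq_addr.
have [[a Ja]|h] := pselect (exists a, (0 < J a)%N); last first.
  suff -> : J = mindex0 n by exact: base.
  apply/ffunP => a; rewrite ffunE; apply/eqP; rewrite -leqn0 leqNgt.
  by apply/negP => Ja; apply: h; exists a.
pose J' : {ffun 'I_n -> nat} := [ffun b => J b - (b == a)]%N.
have JE : J = mindex_add J' a.
  by apply/ffunP => b; rewrite !ffunE; case: eqVneq => [->|_]; rewrite ?subnK ?subn0 ?addn0.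
have J'k : (\sum_(b < n) J' b <= k)%N by move: Jk; rewrite JE sum_mindex_add.
have lq : local_function W (fun q : jpt => q (inr (A, mindex_add (mindex0 n) a))) by exact: local_coord.
have lYj : local_function W (Y a A \o jproj).
  exact: (local_jet oV (local_functionS VU (lY a A))).
have := hq A [ffun=> inl a] J'.
have -> : dh_defect Y A [ffun=> inl a] =
    fun q => q (inr (A, mindex_add (mindex0 n) a)) - (Y a A \o jproj) q.
  by apply/funext => r; rewrite dh_defectE ffunE.
rewrite iter_tderB// jet_coordinate_iter => /subr0_eq.
have -> : [ffun b => mindex_add (mindex0 n) a b + J' b]%N = J.
  by rewrite JE; apply/ffunP => b; rewrite !ffunE add0n addnC.
move=> ->.
have Ws : W (solution_jet p) by rewrite /jet_over /preimage /= jet_proj_solution.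
have d0 : depends_on_pred W (jet_order_le 0) (Y a A \o jproj).
  move=> r r' _ _ rr' /=; congr (Y a A _); apply/funext => l; rewrite !jet_projE.
  by apply: rr'; case: l => //= B; rewrite sum_mindex0.
rewrite -(jet_order_iter_tder (J := J') lYj d0 Ws Wq) => [|[//|[B L]] /= Lk]; last first.
  by apply: ih; exact: leq_trans J'k.
rewrite -iter_tder_comp_solution// [in LHS]JE /= fibre_solution_add//; last exact: VU.
by apply: (iter_tder_eqon _ _ oV _ Vp) => r Vr /=; rewrite jet_proj_solution.
Qed.

Lemma solution_jet_isomorphism :
  equation_isomorphism V Y (equation_surface V Y) solution_jet.
Proof.
split.
- by move=> p Vp; split; [exact: solution_jet_surface|exact: jet_proj_solution].
- by move=> q Eq; split; [case: Eq|exact: solution_jet_unique].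
- by move=> m; exact: (local_functionS VU (local_solution_jet m)).
- move=> l; have -> : (fun q : jpt => jproj q l) = (fun q => q (jet_emb l)).
    by apply/funext => q; rewrite jet_projE.
  exact: local_coord.
- move=> f lf t p Vp; rewrite hdiff0E /pullback.
  rewrite (@fsum_inj _ _ _ (fun a : 'I_n => [ffun=> inl a] : {ffun 'I_1 -> jcoord})).
  + rewrite (eq_bigr (fun a => tder jtot a f (solution_jet p) * (t ord0 == inl a)%:R)).
      case: (t ord0) => [a|A]; last by rewrite big1// => a _; rewrite mulr0.
      rewrite (bigD1 a)//= eqxx mulr1 big1 ?addr0 => [|b ba].
        by rewrite -tder_comp_solution.
      by rewrite (_ : (inl a == inl b :> coord) = (a == b))// eq_sym (negPf ba) mulr0.
    move=> a _; rewrite /Dh hdiff0E ffunE big_ord1 ffunE; congr (_ * _).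
    exact: (has_pd_val (has_pd_coord (t ord0) (inl a) p)).
  + by move=> a b /ffunP/(_ ord0); rewrite !ffunE => -[].
  + move=> u hu; rewrite /Dh hdiff0E; case E : (u ord0) => [a|AJ]; last by rewrite mul0r.
    have := hu a; suff -> : u = [ffun=> inl a] by rewrite eqxx.
    by apply/ffunP => i; rewrite ffunE ord1.
Qed.

End EquationSurface.

(** * Potentials and their Lagrangians *)

Section FormArithmetic.
Variables (R : realType) (K : choiceType) (U : set (cspace R K)).
Hypothesis oU : open U.

Lemma local_formS (V : set (cspace R K)) k (w : diff_form R K k) :
  V `<=` U -> local_form U w -> local_form V w.
Proof.
move=> VU [lw aw [S hS]]; split.
- by move=> t; exact: local_functionS VU (lw t).
- by move=> s t p /VU; exact: aw.
- by exists S => t p tS /VU; exact: hS.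
Qed.

Lemma local_formD k (w w' : diff_form R K k) : local_form U w -> local_form U w' ->
  local_form U (fun t p => w t p + w' t p).
Proof.
move=> [lw aw [S hS]] [lw' aw' [S' hS']]; split.
- by move=> t; exact: localD.
- by move=> s t p Up; rewrite aw// aw'// mulrDr.
- exists (S `|` S')%fset => t p; rewrite inE negb_or => /andP[tS tS'] Up.
  by rewrite hS// hS'// addr0.
Qed.

Lemma local_formB k (w w' : diff_form R K k) : local_form U w -> local_form U w' ->
  local_form U (fun t p => w t p - w' t p).
Proof.
move=> [lw aw [S hS]] [lw' aw' [S' hS']]; split.
- by move=> t; exact: localB.
- by move=> s t p Up; rewrite aw// aw'// mulrBr.
- exists (S `|` S')%fset => t p; rewrite inE negb_or => /andP[tS tS'] Up.
  by rewrite hS// hS'// subr0.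
Qed.

Lemma de_rhamB k (w w' : diff_form R K k) t p : local_form U w -> local_form U w' ->
  U p -> de_rham (fun t p => w t p - w' t p) t p = de_rham w t p - de_rham w' t p.
Proof.
move=> [lw _ _] [lw' _ _] Up; rewrite /de_rham -sumrB; apply: eq_bigr => j _.
by rewrite (derivationB oU (derivation_pd oU (t j) Up) (lw _) (lw' _)) mulrBr.
Qed.

End FormArithmetic.

Section LagrangianClass.
Variables (R : realType) (n : nat) (I : choiceType).
Local Notation coord := ('I_n.+1 + I)%type.
Local Notation jfib := (I * {ffun 'I_n.+1 -> nat})%type.
Local Notation jcoord := ('I_n.+1 + jfib)%type.
Local Notation pt := (cspace R coord).
Local Notation jpt := (cspace R jcoord).
Local Notation jproj := (@jet_proj R n.+1 I).
Local Notation jtot := (@jet_total R n.+1 I).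
Local Notation Hpull w := (horizontalize (pullback jproj w)).

Lemma horizontalize_bidegree (U : set pt) k (w : diff_form R coord k) : open U ->
  local_form U w -> bidegree (jet_over U) jtot k 0 (Hpull w).
Proof.
move=> oU lw t ht q Wq; have [F [vF _]] := local_form_finite lw.
have w0 (u : {ffun 'I_k -> jcoord}) : (0 < vdeg u)%N -> Hpull w u q = 0.
  move=> /vdeg_gt0 h; apply: (horizontalize_vertical (F := F)) => // u'.
  exact: vF.
have t0 : (0 < vdeg t)%N.
  rewrite lt0n; apply: contraNneq ht => t0; rewrite vdeg_card t0.
  by have := hdeg_card t; rewrite t0 addn0 => ->.
rewrite adapted_single => [|u _ /frame_prod_vdeg_le h]; first exact: w0.
by apply: w0; exact: leq_trans h.
Qed.

Lemma horizontalizeB (U : set pt) k (w w' : diff_form R coord k) t q :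
  local_form U w -> local_form U w' -> jet_over U q ->
  Hpull (fun t p => w t p - w' t p) t q = Hpull w t q - Hpull w' t q.
Proof.
move=> lw lw' Wq; have [F0 [vF0 _]] := local_form_finite lw.
have [F1 [vF1 _]] := local_form_finite lw'.
pose F := (F0 `|` F1)%fset.
have v0 : vanishes_outside U F w.
  by apply: vanishes_outside_sub vF0 => x xF; rewrite inE xF.
have v1 : vanishes_outside U F w'.
  by apply: vanishes_outside_sub vF1 => x xF; rewrite inE xF orbT.
rewrite !(horizontalizeE (F := F)).
- by rewrite -sumrB; apply: eq_bigr => v _; rewrite mulrBl.
- by move=> u; exact: v1.
- by move=> u; exact: v0.
- by move=> u h; rewrite v0// v1// subr0.
Qed.

Lemma moved_degree_all k (t : {ffun 'I_k -> coord}) : moved_degree xpredT t = k.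
Proof. by rewrite /moved_degree sum1_card card_ord. Qed.

(** The difference of the two forms is closed. With all coordinates contracted, every component has
    n+1 moved differentials, so the endpoint term of the homotopy vanishes and the difference is
    exact on [V]. *)
Lemma lagrangian_class (p0 : pt) (S0 : {fset coord}) (e0 : R)
    (V := coordinate_box S0 e0 p0) (w w' : diff_form R coord n.+1) :
  local_form V w -> local_form V w' -> form_eq V (de_rham w) (de_rham w') ->
  exists b : diff_form R jcoord n,
    [/\ local_form (jet_over V) b, bidegree (jet_over V) jtot n 0 b
      & form_eq (jet_over V) (fun t p => Hpull w t p - Hpull w' t p) (Dh b)].
Proof.
move=> lw lw' dww'; have oV : open V by exact: coordinate_box_open.
pose rho : diff_form R coord n.+1 := fun t p => w t p - w' t p.
have lr : local_form V rho by exact: local_formB.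
have cr : form_eq V (de_rham rho) (fun _ _ => 0).
  by move=> t p Vp; rewrite (de_rhamB oV _ lw lw' Vp) dww'// subrr.
have [F [vF dF]] := local_form_finite lr.
pose beta := homotopy p0 xpredT F rho.
have lb : local_form V beta by exact: homotopy_local_form.
have db t p : V p -> de_rham beta t p = rho t p.
  move=> Vp; rewrite (de_rham_homotopy xpredT t lr vF dF cr Vp).
  by rewrite moved_degree_all expr0n mul0r subr0.
exists (Hpull beta); split.
- exact: horizontalize_local_form.
- exact: horizontalize_bidegree.
(* [inl ord0] serves as filler coordinate; it exists because there is at least one base variable. *)
- move=> t q Wq; rewrite (Dh_horizontalize oV t (inl ord0) lb Wq).
  rewrite -(horizontalizeB t lw lw' Wq); apply: horizontalize_ext => u.
  exact/esym/(db u _ Wq).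
Qed.

Lemma euler_lagrange_potential (U V : set pt) Y sigma sAB (w : diff_form R coord n.+1) A t q :
  presymplectic_components U Y sigma sAB -> open V -> V `<=` U ->
  local_form V w -> form_eq V sigma (de_rham w) -> jet_over V q ->
  euler_lagrange A (Hpull w) t q = Hpull (fun u => sigma (ins ord0 (inr A) u)) t q.
Proof.
move=> hc oV VU lw sw Wq; have [F0 [vF0 dF0]] := local_form_finite lw.
pose F := (F0 `|` [fset inr A])%fset.
have F0F : {subset F0 <= F} by move=> x xF; rewrite inE xF.
have vF : vanishes_outside V F w by exact: vanishes_outside_sub vF0.
have dF u : depends_on V F (w u) by exact: depends_on_sub (dF0 u).
have AF : inr A \in F by rewrite !inE eqxx orbT.
rewrite (euler_lagrange_horizontalize oV lw vF dF AF t Wq).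
by apply: horizontalize_ext => u; rewrite (sw _ _ Wq).
Qed.

Lemma local_contraction (U : set pt) k (w : diff_form R coord k.+1) l :
  local_form U w -> local_form U (fun u => w (ins ord0 l u)).
Proof.
move=> lw; have [F [vF _]] := local_form_finite lw; have [lw1 aw _] := lw.
apply: (@local_form_intro _ _ _ _ F) => //.
- exact: antisymmetric_ins.
- by move=> u p Up [i iF]; apply: vF => //; exists (lift ord0 i); rewrite ins_lift.
Qed.

End LagrangianClass.

(** * Assembly on a coordinate box *)

Theorem mainTheorem2 (R : realType) (n : nat) (I : choiceType)
    (U : set (cspace R ('I_n.+1 + I)%type))
    (Y : 'I_n.+1 -> I -> cspace R ('I_n.+1 + I)%type -> R)
    (sigma : diff_form R ('I_n.+1 + I)%type n.+2)
    (sAB : I -> I -> diff_form R ('I_n.+1 + I)%type n) :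
  equation_manifold U Y ->
  presymplectic U Y sigma ->
  presymplectic_components U Y sigma sAB ->
  forall p0, U p0 ->
  exists V : set (cspace R ('I_n.+1 + I)%type),
  [/\ [/\ open V, V p0 & V `<=` U],
      (exists chi l, potential V Y sigma chi l) /\
      (forall chi l chi' l',
         potential V Y sigma chi l -> potential V Y sigma chi' l' ->
         exists b : diff_form R ('I_n.+1 + I * {ffun 'I_n.+1 -> nat})%type n,
         [/\ local_form (jet_over V) b,
             bidegree (jet_over V) (@jet_total R n.+1 I) n 0 b
           & form_eq (jet_over V)
               (fun t p => intrinsic_lagrangian chi l t p
                           - intrinsic_lagrangian chi' l' t p)
               (Dh b)]),
      (forall chi l, potential V Y sigma chi l ->
         forall A : I,
         form_eq (jet_over V)
           (euler_lagrange A (intrinsic_lagrangian chi l))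
           (fun t p => - \sum_(B \in [set: I])
              wedge1 (dh_defect Y B)
                (pullback (@jet_proj R n.+1 I) (sAB B A)) t p))
    & (forall chi l, potential V Y sigma chi l ->
         equation_surface V Y
           `<=` stationary_surface V (intrinsic_lagrangian chi l))
      /\ exists s : cspace R ('I_n.+1 + I)%type ->
                    cspace R ('I_n.+1 + I * {ffun 'I_n.+1 -> nat})%type,
           equation_isomorphism V Y (equation_surface V Y) s].
Proof.
move=> eqU [ls bs dv dh] hc p0 Up0; have [oU lY _] := eqU.
(* The box depends only on [U] and [p0], so the same neighbourhood serves all potentials. *)
have [S0 [e0 [e0_gt0 VU]]] := nbhs_coordinate_box (open_nbhs_nbhs (conj oU Up0)).
pose V := coordinate_box S0 e0 p0.
have oV : open V by exact: coordinate_box_open.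
have lsV : local_form V sigma by exact: local_formS ls.
have bsV : bidegree V Y n 2 sigma by move=> t ht p /VU; exact: bs.
(* [vdiff] is [de_rham] minus [hdiff], so the two closure conditions together say that sigma is
   closed. *)
have dsV : form_eq V (de_rham sigma) (fun _ _ => 0).
  by move=> t p /VU Up; have := dv t p Up; rewrite /vdiff dh// subr0.
have lpot chi l : potential V Y sigma chi l ->
    local_form V (fun t p => chi t p + l t p).
  by move=> [[lchi _] [ll _] _]; exact: local_formD.
have EL chi l : potential V Y sigma chi l -> forall A : I,
    form_eq (jet_over V) (euler_lagrange A (intrinsic_lagrangian chi l))
      (horizontalize (pullback (@jet_proj R n.+1 I) (fun u => sigma (ins ord0 (inr A) u)))).
  move=> hp A t q Wq; have [_ _ sp] := hp.
  exact: (euler_lagrange_potential A t hc oV VU (lpot _ _ hp) sp Wq).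
have contr A : form_eq (jet_over V)
    (horizontalize (pullback (@jet_proj R n.+1 I) (fun u => sigma (ins ord0 (inr A) u))))
    (fun t p => - \sum_(B \in [set: I])
       wedge1 (dh_defect Y B) (pullback (@jet_proj R n.+1 I) (sAB B A)) t p).
  by move=> t q Wq; apply: (horizontalize_contraction A t hc); exact: VU.
exists V; split.
- by split => // k _; rewrite subrr normr0.
- split; first by apply: exists_potential => // a A; exact: local_functionS VU (lY a A).
  move=> chi l chi' l' h h'; have [_ _ s1] := h; have [_ _ s2] := h'.
  by apply: (lagrangian_class (lpot _ _ h) (lpot _ _ h')) => t p Vp; rewrite -s1// -s2.
- by move=> chi l h A t q Wq; rewrite (EL _ _ h)// contr.
- split; last by exists (solution_jet Y); exact: (solution_jet_isomorphism eqU oV VU).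
  move=> chi l h q Eq; have [Wq _] := Eq; split => // A t J.
  have oW := jet_over_open oV.
  rewrite (iter_tder_eqon _ _ oW (fun r Wr => EL _ _ h A t r Wr) Wq).
  (* Since [q] lies on the section, it suffices that the expression vanishes along the section,
     where each wedge product contains a vanishing defect. *)
  rewrite -(solution_jet_unique eqU oV VU Eq).
  apply: (iter_tder_comp_zero eqU oV VU) => //.
    by apply: (local_horizontalize oV); exact: local_contraction.
  move=> p Vp; rewrite contr; last by rewrite /jet_over /preimage /= jet_proj_solution.
  apply/eqP; rewrite oppr_eq0; apply/eqP; apply: fsbig1 => B _; apply: big1 => j _.
  by rewrite (dh_defect_solution eqU VU)// mul0r mulr0.
Qed.
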